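(* Let $d\in\{2,3\}$, $M\ge 1$, and consider the multi-emitter Poisson frame model with parameter space $\Theta\subset\mathbb{R}^{dM}$, per-frame log-likelihood $\ell_1(\boldsymbol\theta)$ and per-frame Fisher information matrix $\mathbf F(\boldsymbol\theta)$ described in the context. Fix the true parameter $\boldsymbol\theta_0\in\Theta$ and assume: (C1) $\Theta$ is compact and $\boldsymbol\theta_0\in\operatorname{int}\Theta$ (every emitter is strictly inside the field of view and all pairwise separations strictly exceed $\delta$). (C2) There exists $v_{\min}>0$ with $v(\boldsymbol k)\ge v_{\min}$ for all $\boldsymbol k\in\Omega$ and all $\boldsymbol\theta\in\Theta$; and $v(\boldsymbol k)\in C^3(\Theta)$ as a function of $\boldsymbol\theta$ (or, more weakly, the model is differentiable in quadratic mean). (C3) $\mathbf F(\boldsymbol\theta_0)\succ\mathbf 0$ (positive definite). (C4) The third-order partial derivatives of $\ell_1(\boldsymbol\theta)$ are bounded by an integrable envelope uniformly on a neighborhood of $\boldsymbol\theta_0$. Let $V^{(1)},V^{(2)},\dots$ be i.i.d. frames drawn from the Poisson model at $\boldsymbol\theta_0$ and let $\hat{\boldsymbol\theta}_N^{\mathrm{GML}}\in\arg\max_{\boldsymbol\theta\in\Theta}\ell_N(\boldsymbol\theta)$, where $\ell_N(\boldsymbol\theta)=\sum_{n=1}^N\ell_1^{(n)}(\boldsymbol\theta)$ and $\ell_1^{(n)}$ is the log-likelihood of frame $V^{(n)}$. Then, as $N\to\infty$: (i) $\hat{\boldsymbol\theta}_N^{\mathrm{GML}}\xrightarrow{p}\boldsymbol\theta_0$;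 (ii) $\sqrt N\,\bigl(\hat{\boldsymbol\theta}_N^{\mathrm{GML}}-\boldsymbol\theta_0\bigr)\xrightarrow{d}\mathcal N\bigl(\mathbf 0,\mathbf F(\boldsymbol\theta_0)^{-1}\bigr)$; (iii) $\mathbb E\bigl(\hat{\boldsymbol\theta}_N^{\mathrm{GML}}\bigr)\to\boldsymbol\theta_0$, and the bias satisfies $\mathbb E\bigl(\hat{\boldsymbol\theta}_N^{\mathrm{GML}}\bigr)-\boldsymbol\theta_0=O(N^{-1})$. Equivalently, for large $N$, $\hat{\boldsymbol\theta}_N^{\mathrm{GML}}\approx\mathcal N\bigl(\boldsymbol\theta_0,(N\mathbf F(\boldsymbol\theta_0))^{-1}\bigr)$, i.e. the estimator is asymptotically Gaussian and unbiased and attains the Cramér–Rao bound $(N\mathbf F(\boldsymbol\theta_0))^{-1}$.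
   Context: Pixels. $\Omega=\{0,\dots,K_x-1\}\times\{0,\dots,K_y-1\}$ is the finite pixel set; pixel $\boldsymbol k=(k_x,k_y)$ occupies $p(\boldsymbol k)=[\Delta_xk_x,\Delta_x(k_x+1)]\times[\Delta_yk_y,\Delta_y(k_y+1)]$, with $\Delta_x,\Delta_y>0$; $\Delta_t>0$ is the exposure time; $L_x=K_x\Delta_x$, $L_y=K_y\Delta_y$. Parameter space. The field of view is $\mathcal F=[0,L_x]\times[0,L_y]$ if $d=2$ and $\mathcal F=[0,L_x]\times[0,L_y]\times[-L_z,L_z]$ if $d=3$, with $L_z>0$. For $\delta>0$, $$\Theta=\Bigl\{\boldsymbol\theta=(\boldsymbol\theta_1^\top,\dots,\boldsymbol\theta_M^\top)^\top\in\mathcal F^M:\ \min_{m\ne m'}\|\boldsymbol\theta_m-\boldsymbol\theta_{m'}\|\ge\delta\Bigr\}\subset\mathbb R^{dM},$$ where $\boldsymbol\theta_m\in\mathbb R^d$ is the position of emitter $m$. Point spread functions. For each emitter $m$, $q_m(\boldsymbol u)$, $\boldsymbol u\in\mathbb R^2$, is a probability density determined by $\boldsymbol\theta_m$ (it may differ between emitters), and its pixel average is $q_m(\boldsymbol k)=\frac1{\Delta_x\Delta_y}\int_{p(\boldsymbol k)}q_m(\boldsymbol u)\,d\boldsymbol u$. Frame model. The intensities $I_1,\dots,I_M>0$ are known, and the noise means $b(\boldsymbol k)>0$ are known and do not depend on $\boldsymbol\theta$. A frame is $V=(V(\boldsymbol k))_{\boldsymbol k\in\Omega}$ with independent entries $V(\boldsymbol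 k)\sim\mathrm{Poisson}(v(\boldsymbol k))$, where $$v(\boldsymbol k)=\Delta_t\Delta_x\Delta_y\sum_{m=1}^M I_m\,q_m(\boldsymbol k)+b(\boldsymbol k)$$ depends on $\boldsymbol\theta$ through the $q_m$. Log-likelihood and information. Up to a $\boldsymbol\theta$-independent constant, the per-frame log-likelihood is $\ell_1(\boldsymbol\theta)=\sum_{\boldsymbol k\in\Omega}[V(\boldsymbol k)\ln v(\boldsymbol k)-v(\boldsymbol k)]$, and the per-frame Fisher information matrix is $$\mathbf F(\boldsymbol\theta)=\sum_{\boldsymbol k\in\Omega}\frac1{v(\boldsymbol k)}\frac{\partial v(\boldsymbol k)}{\partial\boldsymbol\theta}\frac{\partial v(\boldsymbol k)}{\partial\boldsymbol\theta}^{\top}\in\mathbb R^{dM\times dM}.$$ The Cramér–Rao bound for $N$ i.i.d. frames is the matrix $(N\mathbf F(\boldsymbol\theta))^{-1}$. Standing convention: the one-to-one correspondence between the emitter indices of the estimated positions and those of the true positions is known (so estimates are not ambiguous up to relabeling of the emitters). Notation: $\xrightarrow{p}$ and $\xrightarrow{d}$ denote convergence in probability and in distribution under $\boldsymbol\theta_0$; $\succ\mathbf 0$ means positive definite.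
   Formalization: Adds identifiability: any θ in Θ with the same pixel means as θ0 is a relabeling of θ0 that never changes the means (otherwise false, e.g. a PSF symmetric in z). The label convention is read as taking the relabeling closest to θ0; DQM is read at every θ in Θ. *)

(* Defs.v *)
From HB Require Import structures.
From mathcomp Require Import all_boot all_order all_algebra.
From mathcomp Require Import perm.
From mathcomp Require Import all_classical all_reals all_analysis.

Set Implicit Arguments.
Unset Strict Implicit.
Unset Printing Implicit Defensive.

Import Order.TTheory GRing.Theory Num.Theory.
Import numFieldNormedType.Exports.

Local Open Scope classical_set_scope.
Local Open Scope ring_scope.

Section Euclidean.
Context {R : realType} {n : nat}.
Implicit Types (x y a : 'rV[R]_n) (A S : 'M[R]_n).

Definition dot x y : R := \sum_(i < n) x 0 i * y 0 i.

(* The library norm on ['rV[R]_n] is the sup norm. *)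
Definition enorm x : R := Num.sqrt (dot x x).

Definition posdef A : Prop :=
  A^T = A /\ forall a, a != 0 -> 0 < (a *m A *m a^T) 0 0.

End Euclidean.

Section Smoothness.
Context {R : realType} {n : nat}.
Implicit Types (U A : set 'rV[R]_n) (f g : 'rV[R]_n -> R).

Definition basis (i : 'I_n) : 'rV[R]_n := delta_mx 0 i.

Definition partial (i : 'I_n) f : 'rV[R]_n -> R := fun x => 'D_(basis i) f x.

Fixpoint Ck_open (k : nat) U f : Prop :=
  (forall x, U x -> {for x, continuous f}) /\
  if k is k'.+1 then
    forall i, (forall x, U x -> derivable f x (basis i)) /\
              Ck_open k' U (partial i f)
  else True.

(* On a set that need not be open, C^k means: restriction of a function that
   is C^k on an open set containing it. *)
Definition Ck (k : nat) A f : Prop :=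
  exists (U : set 'rV[R]_n) (g : 'rV[R]_n -> R),
    [/\ open U, A `<=` U, Ck_open k U g & forall x, A x -> g x = f x].

Definition thrice_derivable_at f (x : 'rV[R]_n) (i j k : 'I_n) : Prop :=
  [/\ derivable f x (basis i),
      derivable (partial i f) x (basis j) &
      derivable (partial j (partial i f)) x (basis k)].

End Smoothness.

Definition borel_rV (R : realType) (n : nat) :=
  g_sigma_algebraType (@open 'rV[R]_n).

Section Probability.
Context {d} {T : measurableType d} {R : realType} (P : probability T R).

Definition random_vector n (X : T -> 'rV[R]_n) : Prop :=
  measurable_fun [set: T] (X : T -> borel_rV R n).

Definition mean_vec n (X : T -> 'rV[R]_n) : 'rV[R]_n :=
  \row_i fine 'E_P[fun w => (X w 0 i)%R].

Definition mutually_independent (I : eqType) d' (S : measurableType d')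
    (X : I -> T -> S) : Prop :=
  forall (s : seq I) (A : I -> set S), uniq s ->
    (forall i, measurable (A i)) ->
    P (\bigcap_(i in [set` s]) X i @^-1` A i) =
      (\prod_(i <- s) fine (P (X i @^-1` A i)))%:E.

Definition cvg_in_probability n (X : nat -> T -> 'rV[R]_n) (x : 'rV[R]_n) :
    Prop :=
  forall e : R, 0 < e ->
    P [set w | e <= enorm (X N w - x)] @[N --> \oo] --> 0%E.

Definition bounded_continuous n (f : 'rV[R]_n -> R) : Prop :=
  continuous f /\ exists C : R, forall x, `|f x| <= C.

Definition cvg_in_distribution n (X : nat -> T -> 'rV[R]_n)
    (G : probability (borel_rV R n) R) : Prop :=
  forall f : 'rV[R]_n -> R, bounded_continuous f ->
    \int[P]_w f (X N w) @[N --> \oo] --> \int[G]_x f x.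

End Probability.

(* [G] is the normal law N(m, S): the linear form x |-> <a, x> has law
   N(<a, m>, a S a^T). The degenerate case is spelled out because
   [normal_prob _ 0] is not a Dirac mass; the second argument of [normal_prob]
   is the standard deviation. *)
Definition is_gaussian {R : realType} n (G : probability (borel_rV R n) R)
    (m : 'rV[R]_n) (S : 'M[R]_n) : Prop :=
  forall (a : 'rV[R]_n) (B : set R), measurable B ->
    let var := (a *m S *m a^T) 0 0 in
    G [set x : 'rV[R]_n | B (dot a x)] =
      if var == 0 then (\d_(dot a m) B)%E
      else normal_prob (dot a m) (Num.sqrt var) B.

Section Model.
Context {R : realType}.

(* Coordinates 0 and 1 are lateral, coordinate 2 (when [d = 3]) is axial. *)
Definition field_of_view (d : nat) (Lx Ly Lz : R) : set 'rV[R]_d :=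
  [set x | forall i : 'I_d,
     match val i with
     | 0%N => 0 <= x 0 i <= Lx
     | 1%N => 0 <= x 0 i <= Ly
     | _ => - Lz <= x 0 i <= Lz
     end].

Definition is_density2 (q : R * R -> R) :
    Prop :=
  [/\ measurable_fun [set: _] q, forall u, 0 <= q u &
      (\int[lebesgue_measure \x lebesgue_measure]_u (q u)%:E)%E = 1%E].

Record frame_model (d M Kx Ky : nat) := FrameModel {
  dx : R; dy : R; dt : R;
  Lz : R;
  sep : R;
  psf : 'I_M -> 'rV[R]_d -> R * R -> R;
  intensity : 'I_M -> R;
  noise : 'I_Kx * 'I_Ky -> R;
  dx_gt0 : 0 < dx;
  dy_gt0 : 0 < dy;
  dt_gt0 : 0 < dt;
  Lz_gt0 : 0 < Lz;
  sep_gt0 : 0 < sep;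
  psf_density : forall m x,
    field_of_view (Kx%:R * dx) (Ky%:R * dy) Lz x -> is_density2 (psf m x);
  intensity_gt0 : forall m, 0 < intensity m;
  noise_gt0 : forall k, 0 < noise k
}.

Context {d M Kx Ky : nat} (S : frame_model d M Kx Ky).
Local Notation pixel := ('I_Kx * 'I_Ky)%type.
Local Notation param := ('rV[R]_(M * d)).
Local Notation frame := {ffun pixel -> nat}.
Implicit Types (t : param) (k : pixel) (m : 'I_M) (z : frame).

(* Parameters are stacked emitter by emitter: theta_m is the m-th block of
   length d. *)
Definition emitter t m : 'rV[R]_d := row m (vec_mx t).

Definition Theta : set param :=
  [set t | (forall m, field_of_view (Kx%:R * dx S) (Ky%:R * dy S) (Lz S)
                        (emitter t m)) /\
           forall m m', m != m' -> sep S <= enorm (emitter t m - emitter t m')].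

Definition pixel_area k : set (R * R) :=
  `[dx S * (k.1)%:R, dx S * (k.1.+1)%:R] `*`
  `[dy S * (k.2)%:R, dy S * (k.2.+1)%:R].

Definition pixel_psf m t k : R :=
  (dx S * dy S)^-1 *
  \int[(lebesgue_measure \x lebesgue_measure)%E]_(u in pixel_area k)
     psf S m (emitter t m) u.

Definition rate k t : R :=
  dt S * dx S * dy S * (\sum_(m < M) intensity S m * pixel_psf m t k)
  + noise S k.

Definition loglik1 z t : R :=
  \sum_(k : pixel) ((z k)%:R * ln (rate k t) - rate k t).

Definition fisher t : 'M[R]_(M * d) :=
  \matrix_(i, j) \sum_(k : pixel)
     (rate k t)^-1 * (partial i (rate k) t * partial j (rate k) t).

Definition cramer_rao (N : nat) t : 'M[R]_(M * d) := invmx (N%:R *: fisher t).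

Definition frame_pmf t z : R := \prod_(k : pixel) poisson_pmf (rate k t) (z k).

Definition dqm_at t : Prop :=
  exists score : frame -> param,
    forall e : R, 0 < e -> exists2 r : R, 0 < r &
      forall t', Theta t' -> enorm (t' - t) < r ->
        (\esum_(z in [set: frame])
           ((Num.sqrt (frame_pmf t' z) - Num.sqrt (frame_pmf t z)
             - 2^-1 * dot (t' - t) (score z) * Num.sqrt (frame_pmf t z))
            ^+ 2)%:E
         <= (e * enorm (t' - t) ^+ 2)%:E)%E.

Definition dqm : Prop := forall t, Theta t -> dqm_at t.

Definition relabel (s : 'S_M) t : param := mxvec (row_perm s (vec_mx t)).

(* Relabelings that the frames cannot detect, e.g. permutations of emitters
   with the same intensity and the same point spread function. *)
Definition undetectable (s : 'S_M) : Prop :=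
  forall t, Theta t -> forall k, rate k (relabel s t) = rate k t.

(* Undetectable relabelings are the only ambiguity about [t0]. *)
Definition identifiable_up_to_relabeling t0 : Prop :=
  forall t, Theta t -> (forall k, rate k t = rate k t0) ->
    exists2 s, undetectable s & t = relabel s t0.

(* The emitter indices of the estimate [t] are matched to those of [t0]: no
   undetectable relabeling brings [t] closer to [t0]. *)
Definition labels_matched t0 t : Prop :=
  forall s, undetectable s -> enorm (t - t0) <= enorm (relabel s t - t0).

Section Sampling.
Context {dT} {T : measurableType dT} (P : probability T R).

Definition frame_of (V : pixel -> {RV P >-> nat}) (w : T) : frame :=
  [ffun k => V k w].

(* All the counts, across pixels and frames, are mutually independent: the
   entries within each frame are independent and the frames are i.i.d. The
   last argument of [poisson_prob] is a dummy. *)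
Definition iid_frames t0 (V : nat -> pixel -> {RV P >-> nat}) : Prop :=
  (forall n k (A : set nat),
     distribution P (V n k) A = poisson_prob (rate k t0) 0 A) /\
  mutually_independent P
    (fun nk : nat * pixel => V nk.1 nk.2 : T -> nat).

Definition loglik (V : nat -> pixel -> {RV P >-> nat}) (N : nat) (w : T) t :
    R :=
  \sum_(n < N) loglik1 (frame_of (V n) w) t.

Definition is_gml (V : nat -> pixel -> {RV P >-> nat}) (N : nat) (w : T) t :
    Prop :=
  Theta t /\ forall t', Theta t' -> loglik V N w t' <= loglik V N w t.

Definition third_derivatives_dominated t0 (V : pixel -> {RV P >-> nat}) :
    Prop :=
  exists (U : set param) (W : frame -> R),
    [/\ nbhs t0 U,
        P.-integrable [set: T] (fun w => (W (frame_of V w))%:E) &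
        forall z t, U t -> forall i1 i2 i3,
          thrice_derivable_at (loglik1 z) t i1 i2 i3 /\
          `|partial i3 (partial i2 (partial i1 (loglik1 z))) t| <= W z].

End Sampling.
End Model.

(* Main.v *)
Require Import Defs.
From HB Require Import structures.
From mathcomp Require Import all_boot all_order all_algebra.
From mathcomp Require Import all_classical all_reals all_analysis.
From mathcomp Require Import perm measurable_realfun lra ring.

Set Implicit Arguments.
Unset Strict Implicit.
Unset Printing Implicit Defensive.

Import Order.TTheory GRing.Theory Num.Theory.
Import numFieldNormedType.Exports.

Local Open Scope classical_set_scope.
Local Open Scope ring_scope.

(** Why the theorem holds.

    The log-likelihood of [N] frames is [N] times [mean_loglik] evaluated at
    the pixelwise mean counts, so the estimate depends on the frames only
    through the errors [e k] of these means, which are centered, independent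
    across pixels, and of variance [v k / N]. Everything about the estimator
    is therefore proved first for an arbitrary deterministic vector of errors.

    Deterministic part. The dominated third derivatives, read at the empty
    frame and at the frames with one count, control each log-rate
    ([log_rate_expansion]). A maximizer close to [theta0] is a zero of the
    score, and inverting the linear part of the score gives it as a linear
    function of [e] up to a quadratic error ([critical_point_linearization]).
    A maximizer is close to [theta0] as soon as [e] is small: by compactness
    one only excludes small neighborhoods of the other points of [Theta], by
    the positivity of the relative entropy where the rates differ and by the
    matching of labels where they agree ([mean_argmax_consistent]). When [e]
    is not small the quadratic bound is trivial because [Theta] is bounded. So
    [mean_argmax_linearization] holds for every frame sequence:
    the distance from [gml - theta0] to [\sum_k e k *: L k] is at most
    [C * (\sum_k `|e k|)^2].

    Probabilistic part. The linear term has mean zero and the quadratic one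
    has expectation of order [1 / N], which gives consistency
    ([linearized_consistent]) and the bias ([linearized_bias]) at once. After
    multiplication by [sqrt N] the quadratic term still vanishes in mean, so
    asymptotic normality reduces to the central limit theorem for the linear
    term ([poisson_clt]), whose limiting covariance is the inverse Fisher
    information ([linearization_covariance]).

    The central limit theorem is proved by Lindeberg's replacement
    ([iter_average_replacement]), phrased with operators that average a
    bounded uniformly continuous function over a random translation along a
    line. Smooth test functions are obtained by averaging over short segments,
    three times along each direction ([smooth_approximation]). The Gaussian
    side of the replacement is summed up by the convolution of normal
    densities ([ge0_normal_convolution]), which also identifies the law of
    the linear forms of the limit vector ([gaussian_vector]); the Poisson side
    is turned into an expectation by integrating out independent counts one at
    a time ([independent_iter_integral]). Bounded continuous test functions
    are reached from below by Lipschitz ones ([cvg_in_distribution_buc]). *)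

(** * Differential calculus in coordinates *)

Local Notation basis := Defs.basis.

Lemma le_sum_term {R : realType} (I : finType) (F : I -> R) i :
  (forall j, 0 <= F j) -> F i <= \sum_j F j.
Proof. by move=> F0; rewrite (bigD1 i)//= lerDl sumr_ge0. Qed.

Section SupNorm.
Context {R : realType} {n : nat}.
Implicit Types (x g : 'rV[R]_n) (A : 'M[R]_n).

Lemma entry_le_norm x i : `|x 0 i| <= `|x|.
Proof.
rewrite /Num.norm/= mx_normrE.
exact: (le_bigmax _ (fun ij : 'I_1 * 'I_n => `|x ij.1 ij.2|) (0, i)).
Qed.

Lemma norm_le_entry x c : 0 <= c -> (forall i, `|x 0 i| <= c) -> `|x| <= c.
Proof.
move=> c0 xc; rewrite /Num.norm/= mx_normrE; apply/bigmax_leP; split => // -[i j] _.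
by rewrite /= (ord1 i).
Qed.

Lemma norm_dot_le g x : `|dot g x| <= n%:R * (`|g| * `|x|).
Proof.
rewrite /dot (le_trans (ler_norm_sum _ _ _))//.
rewrite -[X in X%:R]card_ord -sumr_const mulr_suml; apply: ler_sum => i _.
by rewrite mul1r normrM ler_pM// entry_le_norm.
Qed.

Lemma norm_mulmx_le A x :
  `|x *m A| <= (\sum_i \sum_j `|A i j|) * `|x|.
Proof.
apply: norm_le_entry => [|j].
  by rewrite mulr_ge0// sumr_ge0// => i _; rewrite sumr_ge0.
rewrite mxE (le_trans (ler_norm_sum _ _ _))// mulr_suml; apply: ler_sum => i _.
rewrite normrM mulrC ler_pM ?entry_le_norm//.
exact: (le_sum_term (F := fun j => `|A i j|)).
Qed.

Lemma dotBr g x y : dot g (x - y) = dot g x - dot g y.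
Proof. by rewrite /dot -sumrB; apply: eq_bigr => i _; rewrite !mxE mulrBr. Qed.

Lemma dotDr g x y : dot g (x + y) = dot g x + dot g y.
Proof. by rewrite /dot -big_split; apply: eq_bigr => i _; rewrite !mxE mulrDr. Qed.

Lemma dotZr g a x : dot g (a *: x) = a * dot g x.
Proof. by rewrite /dot mulr_sumr; apply: eq_bigr => i _; rewrite !mxE mulrCA. Qed.

Lemma dot_basis g i : dot g (basis i) = g 0 i.
Proof.
rewrite /dot (bigD1 i)//= big1 => [|j ji]; rewrite mxE ?eqxx ?mulr1 ?addr0//=.
by rewrite (negbTE ji) mulr0.
Qed.

End SupNorm.

(** The mean value theorem on the segment between [0] and [s], whatever the
    sign of [s]. *)
Lemma real_increment_le {R : realType} (g dg : R -> R) (s C : R) :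
  (forall t : R, `|t| <= `|s| -> is_derive t 1 g (dg t) /\ `|dg t| <= C) ->
  `|g s - g 0| <= C * `|s|.
Proof.
move=> gd; suff H (a b : R) : a <= b -> (forall t, a <= t <= b -> `|t| <= `|s|) ->
    `|g b - g a| <= C * (b - a).
  have [s0|s0] := leP 0 s.
    rewrite (ger0_norm s0) -[X in C * X]subr0; apply: H => // t /andP[t0 ts].
    by rewrite !ger0_norm.
  rewrite distrC (ltr0_norm s0) -[X in C * X]add0r; apply: H; first exact: ltW.
  by move=> t /andP[t0 ts]; rewrite ler0_norm ?(ltr0_norm s0) ?lerN2.
move=> ab abs.
have H (t : R) : t \in `[a, b] -> is_derive t 1 g (dg t).
  by rewrite in_itv/= => /abs /gd[].
have Hoo (t : R) : t \in `]a, b[ -> is_derive t 1 g (dg t).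
  by move=> tab; apply: H; exact: subset_itv_oo_cc tab.
have cg : {within `[a, b], continuous g}.
  by apply: derivable_within_continuous => t /H tab; exact: ex_derive.
have [c cab ->] := MVT_segment ab Hoo cg.
rewrite normrM (ger0_norm (_ : 0 <= b - a)) ?subr_ge0// ler_wpM2r ?subr_ge0//.
by apply: (gd c _).2; apply: abs; move: cab; rewrite in_itv.
Qed.

Section PartialDerivatives.
Context {R : realType} {n : nat}.
Implicit Types (f : 'rV[R]_n -> R) (x v : 'rV[R]_n).

(** A directional derivative is the derivative of the restriction to a line;
    this brings one-variable calculus to functions of several variables that
    need only have partial derivatives. *)
Lemma is_derive_line f x v (t : R) : derivable f (x + t *: v) v ->
  is_derive t 1 (fun u => f (x + u *: v)) ('D_v f (x + t *: v)).
Proof.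
have E : (fun h : R => h^-1 *: (((fun u => f (x + u *: v)) \o shift t) (h *: 1)
    - f (x + t *: v))) =
  (fun h : R => h^-1 *: ((f \o shift (x + t *: v)) (h *: v) - f (x + t *: v))).
  apply/funext => h /=; congr (_ *: (f _ - _)).
  by rewrite scalerDl addrCA -scalerA scale1r.
move=> df; split.
  by rewrite /derivable E.
by rewrite /derive E.
Qed.

Lemma derive_lineE f x v : 'D_v f x = 'D_1 (fun u : R => f (x + u *: v)) 0.
Proof.
rewrite /derive; set F := (X in lim (X @ _)); set G := (X in _ = lim (X @ _)).
suff -> : F = G by [].
apply/funext => u; rewrite /F /G /=; congr (_ *: (f _ - f _)).
  by rewrite addr0 -[u%:A]/(u * 1) mulr1 addrC.
by rewrite scale0r addr0.
Qed.

Lemma is_derive_dot (g x y v : 'rV[R]_n) :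
  is_derive x v (fun t => dot g (t - y)) (dot g v).
Proof.
have E : h^-1 *: (((fun t => dot g (t - y)) \o shift x) (h *: v) - dot g (x - y))
   @[h --> 0^'] --> dot g v.
  apply: cvg_near_cst; near=> h.
  rewrite /= -(addrA (h *: v)) (dotDr g (h *: v)) addrK dotZr.
  rewrite -[_ *: _]/(_ * _) mulrA mulVf ?mul1r//.
  by near: h; exact: nbhs_dnbhs_neq.
split; first by apply/cvg_ex; exists (dot g v).
exact/cvg_lim.
Unshelve. all: by end_near. Qed.

Lemma increment_le f x i (s C : R) :
  (forall t : R, `|t| <= `|s| -> derivable f (x + t *: basis i) (basis i) /\
     `|partial i f (x + t *: basis i)| <= C) ->
  `|f (x + s *: basis i) - f x| <= C * `|s|.
Proof.
move=> fd; rewrite -[X in _ - f X]addr0 -(scale0r (basis i)).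
apply: (real_increment_le (g := fun u => f (x + u *: basis i))
  (dg := fun u => partial i f (x + u *: basis i))).
by move=> t /fd[dt Ct]; split; [exact: is_derive_line|exact: Ct].
Qed.

(** Move from [x0] to [x] one coordinate at a time: all the intermediate points
    stay in the sup-norm ball, and each step is an increment along a basis
    vector. *)
Lemma coordinate_lipschitz f x0 (r C : R) :
  (forall x i, `|x - x0| <= r ->
     derivable f x (basis i) /\ `|partial i f x| <= C) ->
  forall x, `|x - x0| <= r -> `|f x - f x0| <= n%:R * C * `|x - x0|.
Proof.
move=> fd x xr.
pose hyb (j : nat) : 'rV[R]_n := \row_i if (i < j)%N then x 0 i else x0 0 i.
have -> : f x = f (hyb n).
  by congr f; apply/rowP => i; rewrite mxE ltn_ord.
have -> : f x0 = f (hyb 0%N).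
  by congr f; apply/rowP => i; rewrite mxE ltn0.
rewrite -(telescope_sumr (fun j => f (hyb j))) // big_mkord.
rewrite (le_trans (ler_norm_sum _ _ _))//.
rewrite -mulrA -[X in X%:R]card_ord -sumr_const mulr_suml; apply: ler_sum => j _.
(* [hyb j] has the first [j] coordinates of [x] and the others of [x0]. *)
have step : hyb j.+1 = hyb j + (x - x0) 0 j *: basis j.
  apply/rowP => i; rewrite !mxE ltnS eqxx/= leq_eqVlt -val_eqE/=.
  case: ltngtP => ij; rewrite ?mulr0 ?addr0 ?mulr1//.
  by rewrite (ord_inj ij) addrC subrK.
have C0 : 0 <= C by exact: le_trans (fd x j xr).2.
rewrite mul1r step (le_trans (@increment_le _ _ _ _ C _)) ?ler_wpM2l ?entry_le_norm//.
move=> t tj; apply: fd; apply: le_trans xr; apply: norm_le_entry => // i.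
rewrite !mxE eqxx/= -val_eqE/=.
case: ltngtP => ij; rewrite ?mulr0 ?addr0 ?mulr1 ?subrr ?normr0//.
  by have := entry_le_norm (x - x0) i; rewrite !mxE.
by rewrite (ord_inj ij) addrC addKr (le_trans tj)// entry_le_norm.
Qed.

Definition gradient f x : 'rV[R]_n := \row_i partial i f x.

(** Bounded third-order partial derivatives make the second-order ones
    Lipschitz, hence bounded near [x0]; then the gradient is Lipschitz at [x0],
    and [f] minus its linear part has a gradient of order [|x - x0|]. *)
Lemma gradient_expansion f x0 (r K : R) :
  0 < r ->
  (forall x i j k, `|x - x0| <= r -> thrice_derivable_at f x i j k /\
     `|partial k (partial j (partial i f)) x| <= K) ->
  exists2 C, 0 <= C & forall x, `|x - x0| <= r ->
    [/\ forall i, derivable f x (basis i),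
        `|gradient f x - gradient f x0| <= C * `|x - x0| &
        `|f x - f x0 - dot (gradient f x0) (x - x0)| <= C * `|x - x0| ^+ 2].
Proof.
move=> r0 fd.
have x0r : `|x0 - x0| <= r by rewrite subrr normr0 ltW.
pose K2 : R := n%:R * `|K| * r + \sum_i \sum_j `|partial j (partial i f) x0|.
have K2_ge0 : 0 <= K2.
  apply: addr_ge0; first by rewrite !mulr_ge0// ltW.
  rewrite sumr_ge0// => i _.
  by rewrite sumr_ge0.
have second x i j : `|x - x0| <= r -> `|partial j (partial i f) x| <= K2.
  move=> xr; rewrite -[X in `|X|](subrK (partial j (partial i f) x0)).
  rewrite (le_trans (ler_normD _ _))// lerD//.
    rewrite (le_trans (coordinate_lipschitz (r := r) (C := `|K|) _ xr))//.
      by move=> y k yr; have [[_ _ ?] /le_trans] := fd y i j k yr; split=> //;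
        rewrite -?ler_norm; apply: (le_trans (fd y i j k yr).2); exact: ler_norm.
    by rewrite ler_wpM2l// mulr_ge0.
  apply: (le_trans (le_sum_term (F := fun j => `|partial j (partial i f) x0|) j _)) => //.
  apply: (le_sum_term (F := fun i => \sum_j `|partial j (partial i f) x0|)) => k.
  by rewrite sumr_ge0.
pose C1 : R := n%:R * K2.
have first x : `|x - x0| <= r ->
    `|gradient f x - gradient f x0| <= C1 * `|x - x0|.
  move=> xr; apply: norm_le_entry => [|i]; first by rewrite !mulr_ge0.
  rewrite !mxE; apply: (coordinate_lipschitz (r := r)) => // y j yr.
  by split; [have [[]] := fd y i j j yr|exact: second].
exists (C1 + n%:R * C1) => [|x xr]; first by rewrite addr_ge0 ?mulr_ge0.
split.
- by move=> i; have [[]] := fd x i i i xr.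
- by rewrite (le_trans (first x xr))// ler_wpM2r// lerDl !mulr_ge0.
pose u y := f y - dot (gradient f x0) (y - x0).
have ux0 : u x0 = f x0.
  by rewrite /u dotBr subrr subr0.
have -> : f x - f x0 - dot (gradient f x0) (x - x0) = u x - u x0.
  by rewrite ux0 /u addrAC.
rewrite (@le_trans _ _ (n%:R * (C1 * `|x - x0|) * `|x - x0|))//; last first.
  have -> : n%:R * (C1 * `|x - x0|) * `|x - x0| = n%:R * C1 * `|x - x0| ^+ 2.
    by rewrite expr2 !mulrA.
  by rewrite ler_wpM2r ?exprn_ge0// lerDr !mulr_ge0.
apply: (coordinate_lipschitz (r := `|x - x0|)) => // y i yx.
have yr := le_trans yx xr.
have d1 : derivable f y (basis i) by have [[]] := fd y i i i yr.
have d2 := is_derive_dot (gradient f x0) y x0 (basis i).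
have du : is_derive y (basis i) u
    (partial i f y - dot (gradient f x0) (basis i)).
  by apply: is_deriveB; exact: derivableP.
split; first exact: ex_derive.
rewrite /partial derive_val dot_basis.
have := entry_le_norm (gradient f y - gradient f x0) i; rewrite !mxE => /le_trans; apply.
by rewrite (le_trans (first y yr))// ler_wpM2l// !mulr_ge0.
Qed.

End PartialDerivatives.

(** * Linearization of critical points *)

Section CriticalPoint.
Context {R : realType} {n : nat}.
Implicit Types (x g : 'rV[R]_n) (A : 'M[R]_n).

Lemma posdef_unitmx A : posdef A -> A \in unitmx.
Proof.
case=> _ A0; rewrite -row_free_unit; apply: inj_row_free => v vA.
by apply/eqP/negP => /negP /A0; rewrite vA mul0mx mxE ltxx.
Qed.

Lemma mulmx_outer x g : x *m (g^T *m g) = dot g x *: g.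
Proof.
rewrite mulmxA; apply/rowP => j; rewrite !mxE big_ord1 mxE; congr (_ * _).
by apply: eq_bigr => i _; rewrite mxE mulrC.
Qed.

(** The upper bound comes from [expR (- x) >= 1 - x]. *)
Lemma expR_expansion (x : R) : `|x| <= 2^-1 ->
  `|expR x - 1 - x| <= 2 * x ^+ 2.
Proof.
move=> xh; have /andP[x1 x2] : - 2^-1 <= x <= 2^-1 by rewrite -ler_norml.
have e1 := expR_ge1Dx x; have e2 := expR_ge1Dx (- x).
rewrite ger0_norm; last by lra.
have p : 0 < 1 - x by lra.
have e3 : expR x * (1 - x) <= 1.
  by rewrite -[leRHS](expRxMexpNx_1 x) ler_wpM2l ?expR_ge0.
have e4 : expR x <= 1 + x + 2 * x ^+ 2.
  rewrite -(ler_pM2r p) (le_trans e3)//; nra.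
lra.
Qed.

Variables (K : finType) (h : K -> 'rV[R]_n -> R) (t0 : 'rV[R]_n) (r C : R).
Hypotheses (r0 : 0 < r) (C0 : 0 <= C).
Hypothesis hC : forall k t, `|t - t0| <= r ->
  `|gradient (h k) t - gradient (h k) t0| <= C * `|t - t0| /\
  `|h k t - h k t0 - dot (gradient (h k) t0) (t - t0)| <= C * `|t - t0| ^+ 2.

Let v k := expR (h k t0).
Let g k := gradient (h k) t0.
Let F := \sum_k v k *: ((g k)^T *m g k).
Let score (y : K -> R) t := \sum_k (y k - expR (h k t)) *: gradient (h k) t.

(** The score is compared with its linear part: replacing [gradient (h k) t] by
    [g k] costs [C * `|t - t0|], and replacing [expR (h k t)] by its first-order
    expansion at [t0] costs a multiple of [`|t - t0| ^+ 2]. The first error is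
    multiplied by [y k - v k] minus its linear part, which is itself of order
    [`|y k - v k| + `|t - t0|]. *)
Lemma score_expansion : exists A r' : R, [/\ 0 <= A, 0 < r', r' <= r &
  forall t y, `|t - t0| <= r' -> score y t = 0 ->
    `|\sum_k (y k - v k) *: g k - (t - t0) *m F| <=
      A * ((\sum_k `|y k - v k|) + `|t - t0|) * `|t - t0|].
Proof.
pose a k : R := n%:R * `|g k|.
have a0 k : 0 <= a k by rewrite mulr_ge0.
have v0 k : 0 <= v k by exact: expR_ge0.
pose B k : R := C + v k * a k * C +
  v k * (2 * (a k + C) ^+ 2 + C) * (`|g k| + C).
have B0 k : 0 <= B k.
  by rewrite !addr_ge0 ?mulr_ge0 ?addr_ge0 ?mulr_ge0 ?exprn_ge0// addr_ge0.
pose S : R := \sum_k (a k + C).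
have S0 : 0 <= S by rewrite sumr_ge0// => k _; rewrite addr_ge0.
(* This radius keeps [h k t - h k t0] below [1/2], as [expR_expansion] needs. *)
pose r' : R := Num.min r (Num.min 1 (2 * (1 + S))^-1).
exists (\sum_k B k), r'; split.
- by rewrite sumr_ge0.
- by rewrite !lt_min r0 ltr01 invr_gt0 mulr_gt0// ltr_wpDr.
- by rewrite ge_min lexx.
move=> t y; rewrite !le_min => /and3P[tr t1 tS] sc.
set D := t - t0 in tr t1 tS *; set e := fun k => y k - v k.
have -> : \sum_k (y k - v k) *: g k - D *m F =
   \sum_k ((e k - v k * dot (g k) D) *: (g k - gradient (h k) t) +
     (expR (h k t) - v k - v k * dot (g k) D) *: gradient (h k) t).
  apply/rowP => i; have := congr1 (fun m : 'rV[R]_n => m 0 i) sc.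
  rewrite /score /F mulmx_sumr !(mxE, summxE) => sci.
  have sumB (p q : K -> R) : \sum_k p k - \sum_k q k = \sum_k (p k - q k).
    by rewrite sumrB.
  transitivity (\sum_k ((y k - v k) * g k 0 i - v k * dot (g k) D * g k 0 i) -
    \sum_k ((y k - expR (h k t)) *: gradient (h k) t) 0 i).
    rewrite sci subr0 -sumB; congr (_ - _); apply: eq_bigr => k _.
      by rewrite mxE.
    by rewrite -scalemxAr mulmx_outer scalerA mxE.
  by rewrite sumB; apply: eq_bigr => k _; rewrite !mxE /e; ring.
rewrite (le_trans (ler_norm_sum _ _ _))// -mulrA mulr_suml ler_sum// => k _.
have [gC hC2] := hC k tr; rewrite -/(g k) -/D in gC hC2.
have dD : `|dot (g k) D| <= a k * `|D| by rewrite -mulrA norm_dot_le.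
have GC : `|gradient (h k) t| <= `|g k| + C.
  rewrite -[X in `|X|](subrK (g k)) (le_trans (ler_normD _ _))// addrC lerD2l.
  by rewrite (le_trans gC)// -[leRHS]mulr1 ler_wpM2l.
set x := h k t - h k t0 in hC2.
have xD : `|x| <= (a k + C) * `|D|.
  rewrite -[X in `|X|](subrK (dot (g k) D)) (le_trans (ler_normD _ _))//.
  rewrite addrC mulrDl lerD// (le_trans hC2)// ler_wpM2l// expr2.
  by rewrite -[leRHS]mulr1 ler_wpM2l.
have aS : a k + C <= S.
  by apply: (le_sum_term (F := fun k => a k + C)) => j; rewrite addr_ge0.
have xh : `|x| <= 2^-1.
  rewrite (le_trans xD)// (@le_trans _ _ ((1 + S) * (2 * (1 + S))^-1))//.
    by rewrite ler_pM ?addr_ge0// (le_trans aS)// lerDr.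
  by rewrite invfM mulrCA mulfV ?mulr1// gt_eqF// ltr_wpDr.
have E : expR (h k t) - v k - v k * dot (g k) D =
    v k * ((expR x - 1 - x) + (x - dot (g k) D)).
  have -> : expR (h k t) = v k * expR x by rewrite /v -expRD /x addrC subrK.
  ring.
have EC : `|expR (h k t) - v k - v k * dot (g k) D| <=
    v k * (2 * (a k + C) ^+ 2 + C) * `|D| ^+ 2.
  rewrite E normrM (ger0_norm (v0 k)) -mulrA ler_wpM2l//.
  rewrite (le_trans (ler_normD _ _))// mulrDl lerD//.
  rewrite (le_trans (expR_expansion xh))// -mulrA ler_wpM2l// -exprMn.
  by rewrite -(real_normK (num_real x)) lerXn2r// nnegrE// mulr_ge0// addr_ge0.
have eC : `|e k - v k * dot (g k) D| <= `|e k| + v k * a k * `|D|.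
  rewrite (le_trans (ler_normB _ _))// lerD2l normrM (ger0_norm (v0 k)) -mulrA.
  by rewrite ler_wpM2l.
have ek : `|e k| <= \sum_j `|y j - v j|.
  exact: (le_sum_term (F := fun j => `|y j - v j|)).
rewrite (le_trans (ler_normD _ _))// !normrZ (distrC (g k)).
apply: (@le_trans _ _ ((`|e k| + v k * a k * `|D|) * (C * `|D|) +
   v k * (2 * (a k + C) ^+ 2 + C) * `|D| ^+ 2 * (`|g k| + C))).
  by rewrite lerD// ler_pM.
rewrite (@le_trans _ _ (B k * ((`|e k| + `|D|) * `|D|)))//; last first.
  by rewrite ler_wpM2l// ler_wpM2r// lerD2r.
rewrite -subr_ge0.
have -> : B k * ((`|e k| + `|D|) * `|D|) - ((`|e k| + v k * a k * `|D|) * (C * `|D|) +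
   v k * (2 * (a k + C) ^+ 2 + C) * `|D| ^+ 2 * (`|g k| + C)) =
  C * `|D| ^+ 2 + v k * a k * C * `|e k| * `|D| +
  v k * (2 * (a k + C) ^+ 2 + C) * (`|g k| + C) * `|e k| * `|D|.
  rewrite /B; ring.
by rewrite !addr_ge0 ?mulr_ge0 ?addr_ge0 ?mulr_ge0 ?exprn_ge0// addr_ge0.
Qed.

(** Applying [F^-1] to [score_expansion] bounds the distance from [t - t0] to the
    linear term by [c A (e + `|t - t0|) `|t - t0|]. Near [t0] this is at most half
    of [`|t - t0|], which bounds [`|t - t0|] by a multiple of [e]; inserting
    that bound back makes the error quadratic in [e]. *)
Lemma critical_point_linearization : posdef F ->
  exists C' rho : R, [/\ 0 <= C', 0 < rho, rho <= r &
  forall t y, `|t - t0| <= rho -> \sum_k `|y k - v k| <= rho -> score y t = 0 ->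
    `|t - t0 - \sum_k (y k - v k) *: (g k *m invmx F)| <=
      C' * (\sum_k `|y k - v k|) ^+ 2].
Proof.
move=> /posdef_unitmx uF; have [A [r' [A0 r'0 r'r sc]]] := score_expansion.
pose c : R := \sum_i \sum_j `|invmx F i j|.
have c0 : 0 <= c by rewrite sumr_ge0// => i _; rewrite sumr_ge0.
pose B : R := \sum_k `|g k *m invmx F|.
have B0 : 0 <= B by rewrite sumr_ge0.
exists (c * A * (1 + 2 * B) * (2 * B)), (Num.min r' (4 * (1 + c * A))^-1); split.
- by rewrite !mulr_ge0 ?addr_ge0 ?mulr_ge0.
- by rewrite lt_min r'0 invr_gt0 mulr_gt0// ltr_wpDr// mulr_ge0.
- by rewrite ge_min r'r.
move=> t y; rewrite !le_min; set D := t - t0; set e := \sum_k _.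
move=> /andP[Dr Ds] /andP[_ es] /(sc _ _ Dr); rewrite -/D -/e => bd.
have e0 : 0 <= e by rewrite sumr_ge0.
have lin : `|D - \sum_k (y k - v k) *: (g k *m invmx F)| <=
    c * A * (e + `|D|) * `|D|.
  have -> : D - \sum_k (y k - v k) *: (g k *m invmx F) =
      - ((\sum_k (y k - v k) *: g k - D *m F) *m invmx F).
    rewrite mulmxBl mulmxK// opprB mulmx_suml; congr (_ - _).
    by apply: eq_bigr => k _; rewrite -scalemxAl.
  by rewrite normrN (le_trans (norm_mulmx_le _ _))// -!mulrA ler_wpM2l// mulrA.
have Le : `|\sum_k (y k - v k) *: (g k *m invmx F)| <= B * e.
  rewrite (le_trans (ler_norm_sum _ _ _))// mulr_suml ler_sum// => k _.
  rewrite normrZ mulrC ler_wpM2l//.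
  exact: (le_sum_term (F := fun j => `|y j - v j|)).
have half : c * A * (e + `|D|) <= 2^-1.
  have p : 0 < 1 + c * A by rewrite ltr_wpDr// mulr_ge0.
  rewrite (@le_trans _ _ ((1 + c * A) * ((4 * (1 + c * A))^-1 + (4 * (1 + c * A))^-1)))//.
    by rewrite ler_pM ?mulr_ge0 ?addr_ge0// ?lerD// lerDr.
  rewrite invfM -mulrDr mulrC -mulrA mulrDl mulVf ?gt_eqF//; lra.
have DB : `|D| <= 2 * B * e.
  have : `|D| <= c * A * (e + `|D|) * `|D| + B * e.
    by rewrite -[X in `|X| <= _](subrK (\sum_k (y k - v k) *: (g k *m invmx F)))
      (le_trans (ler_normD _ _))// lerD.
  have : c * A * (e + `|D|) * `|D| <= 2^-1 * `|D| by rewrite ler_wpM2r.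
  by move=> h1 h2; rewrite -mulrA; lra.
rewrite (le_trans lin)// (@le_trans _ _ (c * A * (e + 2 * B * e) * (2 * B * e)))//.
  by rewrite ler_pM ?mulr_ge0 ?addr_ge0// ler_wpM2l ?mulr_ge0// lerD2l.
by rewrite le_eqVlt; apply/orP; left; apply/eqP; ring.
Qed.

End CriticalPoint.

(** * Relative entropy and relabelings *)

Section FiniteSums.
Context {R : realType}.

Lemma cvg_finsum (I : finType) {T : Type} (F : set_system T) {FF : Filter F}
    (f : I -> T -> R) (l : I -> R) :
  (forall i, f i t @[t --> F] --> l i) ->
  \sum_i f i t @[t --> F] --> \sum_i l i.
Proof.
move=> fl; rewrite -fct_sumE.
apply: (big_ind2 (fun (g : T -> R) (m : R) => g t @[t --> F] --> m)) => //.
- exact: cvg_cst.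
- by move=> g m g' m' gm gm'; exact: cvgD.
Qed.

Lemma is_derive_finsum (I : finType) (V : normedModType R) (f : I -> V -> R)
    (df : I -> R) x v :
  (forall i, is_derive x v (f i) (df i)) ->
  is_derive x v (fun t => \sum_i f i t) (\sum_i df i).
Proof.
move=> fd; rewrite -fct_sumE.
apply: (big_ind2 (fun (g : V -> R) (m : R) => is_derive x v g m)) => //.
  exact: (is_derive_cst (0 : R) x v).
by move=> g m g' m' gm gm'; exact: is_deriveD.
Qed.

End FiniteSums.

Section RelativeEntropy.
Context {R : realType}.

(** The difference is the relative entropy of Poisson(v) with respect to
    Poisson(r); its sign is that of [expR x - 1 - x] at [x = ln r - ln v]. *)
Lemma poisson_entropy_ge0 (v r : R) : 0 < v -> 0 < r ->
  0 <= (v * ln v - v) - (v * ln r - r).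
Proof.
move=> v0 r0; have := expR_ge1Dx (ln r - ln v).
rewrite expRB !lnK// ler_pdivlMr//; lra.
Qed.

Lemma poisson_entropy_gt0 (v r : R) : 0 < v -> 0 < r -> r != v ->
  0 < (v * ln v - v) - (v * ln r - r).
Proof.
move=> v0 r0 rv; have : ln r - ln v != 0.
  by rewrite subr_eq0; apply: contra rv => /eqP/ln_inj ->.
move=> /expR_gt1Dx; rewrite expRB !lnK// ltr_pdivlMr//; lra.
Qed.

End RelativeEntropy.

Section EuclideanNorm.
Context {R : realType} {n : nat}.
Implicit Types x : 'rV[R]_n.

Lemma norm_le_enorm x : `|x| <= enorm x.
Proof.
apply: norm_le_entry => [|i]; first exact: sqrtr_ge0.
rewrite -sqrtr_sqr ler_sqrt; last first.
  by rewrite /dot sumr_ge0// => j _; rewrite -expr2 sqr_ge0.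
rewrite /dot; under eq_bigr do rewrite -expr2.
by apply: (le_sum_term (F := fun i => x 0 i ^+ 2)) => j; exact: sqr_ge0.
Qed.

Lemma enorm_le_norm x : enorm x <= Num.sqrt n%:R * `|x|.
Proof.
rewrite -[X in _ * X]normr_id -sqrtr_sqr -sqrtrM// ler_sqrt; last first.
  by rewrite mulr_ge0// exprn_ge0.
rewrite /dot -[X in X%:R]card_ord -sumr_const mulr_suml ler_sum// => i _.
by rewrite mul1r -expr2 -real_normK ?num_real// lerXn2r ?nnegrE ?entry_le_norm.
Qed.

End EuclideanNorm.

Section Relabeling.
Context {R : realType} {d M Kx Ky : nat} (S : @frame_model R d M Kx Ky).
Implicit Types (t : 'rV[R]_(M * d)) (s : 'S_M).

Lemma relabelE s t i j :
  relabel s t 0 (mxvec_index i j) = t 0 (mxvec_index (s i) j).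
Proof. by rewrite /relabel mxvecE mxE -mxvecE vec_mxK. Qed.

Lemma eq_mxvec_index t t' :
  (forall i j, t 0 (mxvec_index i j) = t' 0 (mxvec_index i j)) -> t = t'.
Proof. by move=> tt'; apply/rowP => k; case/mxvec_indexP: k. Qed.

Lemma relabelK s : cancel (relabel s : 'rV[R]_(M * d) -> _) (relabel s^-1%g).
Proof. by move=> t; apply: eq_mxvec_index => i j; rewrite !relabelE permKV. Qed.

Lemma relabelVK s : cancel (relabel s^-1%g : 'rV[R]_(M * d) -> _) (relabel s).
Proof. by move=> t; apply: eq_mxvec_index => i j; rewrite !relabelE permK. Qed.

Lemma relabelB s t t' : relabel s (t - t') = relabel s t - relabel s t'.
Proof. by apply: eq_mxvec_index => i j; rewrite !mxE !relabelE !mxE. Qed.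

Lemma enorm_relabel s t : enorm (relabel s t) = enorm t.
Proof.
have dotE t' : dot t' t' = \sum_i \sum_j t' 0 (mxvec_index i j) ^+ 2.
  rewrite pair_big /dot (reindex _ (curry_mxvec_bij M d))/=.
  by apply: eq_bigr => -[i j] _; rewrite expr2.
congr Num.sqrt; rewrite !dotE [RHS](reindex_inj (@perm_inj _ s))/=.
by apply: eq_bigr => i _; apply: eq_bigr => j _; rewrite relabelE.
Qed.

Lemma Theta_relabel s t : Theta S t -> Theta S (relabel s t).
Proof.
have E m : emitter (relabel s t) m = emitter t (s m).
  by apply/rowP => j; rewrite !mxE relabelE.
move=> [fov sep]; split=> [m|m m' mm']; rewrite !E//; apply: sep.
by apply: contra mm' => /eqP/perm_inj ->.
Qed.

Lemma undetectableV s : undetectable S s -> undetectable S s^-1%g.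
Proof.
move=> us t tT k; rewrite -[in RHS](relabelVK s t) us//.
exact: Theta_relabel.
Qed.

(** Relabelings are isometries, so an estimate near a relabeling of [t0] could
    be relabeled to come near [t0]; matched labels forbid this unless it
    already was near [t0]. *)
Lemma labels_matched_near s t0 t : undetectable S s -> labels_matched S t0 t ->
  enorm (t - t0) <= enorm (t - relabel s t0).
Proof.
move=> us /(_ _ (undetectableV us)) /le_trans; apply.
by rewrite -[in leLHS](relabelK s t0) -relabelB enorm_relabel.
Qed.

End Relabeling.

(** * Consistency of the maximizer *)

Section HellingerExpansion.
Context {R : realType} {n : nat}.

(** An expansion of [sqrt p] at [t] with an error of order one in the distance is
    enough for the continuity of [sqrt p], hence of [p]. *)
Lemma hellinger_continuous (A : set 'rV[R]_n) (p : 'rV[R]_n -> R) t s r :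
  0 < r -> (forall t', 0 <= p t') ->
  (forall t', A t' -> enorm (t' - t) < r ->
    (Num.sqrt (p t') - Num.sqrt (p t) - 2^-1 * dot (t' - t) s * Num.sqrt (p t))
      ^+ 2 <= enorm (t' - t) ^+ 2) ->
  p t' @[t' --> within A (nbhs t)] --> p t.
Proof.
move=> r0 p0 H.
suff sqrt_cvg : Num.sqrt (p t') @[t' --> within A (nbhs t)] --> Num.sqrt (p t).
  rewrite -(sqr_sqrtr (p0 t)).
  under eq_fun do rewrite -(sqr_sqrtr (p0 _)).
  by rewrite expr2; under eq_fun do rewrite expr2; exact: cvgM.
set q := Num.sqrt (p t); have q0 : 0 <= q by exact: sqrtr_ge0.
pose B1 : R := Num.sqrt n%:R.
have B10 : 0 <= B1 by exact: sqrtr_ge0.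
pose B : R := B1 + n%:R * `|s| * q.
have B0 : 0 <= B by rewrite addr_ge0 ?mulr_ge0.
have bd t' : A t' -> enorm (t' - t) < r ->
    `|Num.sqrt (p t') - q| <= B * `|t' - t|.
  move=> At' t'r; have := H t' At' t'r.
  rewrite -/q; set D := t' - t; set u := Num.sqrt (p t').
  move=> /ler_wsqrtr; rewrite !sqrtr_sqr => Hu.
  have De : `|enorm D| <= B1 * `|D|.
    by rewrite ger0_norm ?sqrtr_ge0// enorm_le_norm.
  rewrite -[X in `|X|](subrK (2^-1 * dot D s * q)).
  rewrite (le_trans (ler_normD _ _))// /B mulrDl lerD//.
    exact: le_trans Hu De.
  rewrite normrM (ger0_norm q0) mulrAC ler_wpM2r// normrM.
  rewrite (@le_trans _ _ `|dot D s|)//.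
    by rewrite ler_piMl// ger0_norm ?invr_ge0// invf_le1// ler1n.
  by rewrite (le_trans (norm_dot_le _ _))// -mulrA (mulrC `|D|).
apply/cvgrPdist_lt => e e0; rewrite near_withinE.
near=> t' => At'; rewrite distrC.
have tt' : `|t' - t| < Num.min (e / (1 + B)) (r / (1 + B1)).
  rewrite distrC; near: t'; apply: cvgr_dist_lt => //.
  by rewrite lt_min !divr_gt0// ltr_wpDr.
move: tt'; rewrite lt_min => /andP[te tr].
rewrite (le_lt_trans (bd t' At' _))//.
  rewrite (le_lt_trans (enorm_le_norm _))// -/B1.
  move: tr; rewrite ltr_pdivlMr ?ltr_wpDr//; apply: le_lt_trans.
  by rewrite mulrC ler_wpM2l// lerDr.
move: te; rewrite ltr_pdivlMr ?ltr_wpDr//; apply: le_lt_trans.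
by rewrite mulrC ler_wpM2l// lerDr.
Unshelve. all: by end_near. Qed.

End HellingerExpansion.

Section RateContinuity.
Context {R : realType} {d M Kx Ky : nat} (S : @frame_model R d M Kx Ky).
Local Notation pixel := ('I_Kx * 'I_Ky)%type.
Local Notation param := ('rV[R]_(M * d)).
Local Notation frame := {ffun pixel -> nat}.
Hypothesis rate_gt0 : forall k t, Theta S t -> 0 < rate S k t.

Definition unit_frame (k : pixel) : frame := [ffun j => (j == k) : nat].
Definition zero_frame : frame := [ffun=> 0%N].

Lemma frame_pmf_zero t : Theta S t ->
  frame_pmf S t zero_frame = expR (- \sum_k rate S k t).
Proof.
move=> tT; rewrite -sumrN expR_sum; apply: eq_bigr => k _.
by rewrite /poisson_pmf rate_gt0// ffunE expr0 fact0 invr1 !mul1r.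
Qed.

Lemma frame_pmf_unit t k : Theta S t ->
  frame_pmf S t (unit_frame k) = rate S k t * frame_pmf S t zero_frame.
Proof.
move=> tT; rewrite /frame_pmf (bigD1 k)//= [in RHS](bigD1 k)//= mulrA.
congr (_ * _).
  rewrite /poisson_pmf rate_gt0// !ffunE eqxx expr1 expr0 fact0.
  by rewrite [1%N`!]factS fact0 !invr1 mulr1 !mul1r.
apply: eq_bigr => j /negbTE jk.
by rewrite /poisson_pmf rate_gt0// !ffunE jk.
Qed.

(** Each term of the series in the definition of differentiability in quadratic
    mean is bounded by the sum, so the expansion holds frame by frame. *)
Lemma dqm_pmf_continuous t z : Theta S t -> dqm_at S t ->
  frame_pmf S t' z @[t' --> within (Theta S) (nbhs t)] --> frame_pmf S t z.
Proof.
move=> tT [score /(_ 1 ltr01)[r r0 H]].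
apply: (@hellinger_continuous _ _ (Theta S) ((frame_pmf S)^~ z) t (score z) r) => //.
  by move=> t'; rewrite prodr_ge0// => k _; exact: poisson_pmf_ge0.
move=> t' t'T t'r; have := H t' t'T t'r; rewrite mul1r => Hs.
rewrite -lee_fin; apply: le_trans Hs; apply: esum_ge; exists [set z].
  by split => //; exact: finite_set1.
by rewrite fsbig_set1.
Qed.

(** Either smoothness hypothesis makes the rates continuous on [Theta]. In the
    quadratic-mean case the probabilities of the empty frame and of a single
    count are continuous, and the rate is their ratio. *)
Lemma rate_continuous k t : (forall k, Ck 3 (Theta S) (rate S k)) \/ dqm S ->
  Theta S t ->
  rate S k t' @[t' --> within (Theta S) (nbhs t)] --> rate S k t.
Proof.
move=> [C3|hq] tT.
  have [U [g [_ TU [gU _] gE]]] := C3 k.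
  have : g t' @[t' --> within (Theta S) (nbhs t)] --> g t.
    by apply: cvg_within_filter; exact/gU/TU.
  rewrite gE//; apply: cvg_trans; apply: near_eq_cvg; rewrite near_withinE; near=> t' => t'T.
  by rewrite gE.
have p0 t' : 0 < expR (- \sum_k rate S k t') by exact: expR_gt0.
have E t' : Theta S t' ->
    frame_pmf S t' (unit_frame k) / frame_pmf S t' zero_frame = rate S k t'.
  by move=> t'T; rewrite frame_pmf_unit// frame_pmf_zero// mulfK// gt_eqF.
rewrite -(E t tT).
have : frame_pmf S t' (unit_frame k) / frame_pmf S t' zero_frame
    @[t' --> within (Theta S) (nbhs t)] -->
    frame_pmf S t (unit_frame k) / frame_pmf S t zero_frame.
  apply: cvgM; first exact: dqm_pmf_continuous (hq t tT).
  apply: cvgV; last exact: dqm_pmf_continuous (hq t tT).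
  by rewrite frame_pmf_zero// gt_eqF.
apply: cvg_trans; apply: near_eq_cvg; rewrite near_withinE.
by near=> t' => t'T; exact: E.
Unshelve. all: by end_near. Qed.

End RateContinuity.

Section MeanLogLikelihood.
Context {R : realType} {d M Kx Ky : nat} (S : @frame_model R d M Kx Ky).
Local Notation pixel := ('I_Kx * 'I_Ky)%type.
Local Notation param := ('rV[R]_(M * d)).
Variable t0 : param.
Hypothesis Theta_t0 : Theta S t0.
Hypothesis rate_gt0 : forall k t, Theta S t -> 0 < rate S k t.

(** The log-likelihood of [N] frames divided by [N] depends on the frames only
    through the vector [y] of pixelwise mean counts. *)
Definition mean_loglik (y : pixel -> R) (t : param) : R :=
  \sum_k (y k * ln (rate S k t) - rate S k t).

Definition mean_argmax (y : pixel -> R) (t : param) : Prop :=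
  Theta S t /\ forall t', Theta S t' -> mean_loglik y t' <= mean_loglik y t.

Let v k := rate S k t0.

(** By compactness it suffices to exclude estimates near each other point [x]
    of [Theta]. If the rates at [x] are not those at [t0], the relative entropy
    rules [x] out; otherwise [x] is an undetectable relabeling of [t0]. *)
Lemma mean_argmax_consistent (e : R) : 0 < e ->
  compact (Theta S) -> identifiable_up_to_relabeling S t0 ->
  (forall k t, Theta S t ->
     rate S k t' @[t' --> within (Theta S) (nbhs t)] --> rate S k t) ->
  exists2 dl : R, 0 < dl & forall y t, \sum_k `|y k - v k| <= dl ->
    mean_argmax y t -> labels_matched S t0 t -> `|t - t0| <= e.
Proof.
move=> e0 /compact_near_coveringP cT idT rc.
pose Q (dl : R) t := Theta S t -> forall y, \sum_k `|y k - v k| <= dl ->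
  mean_argmax y t -> labels_matched S t0 t -> `|t - t0| <= e.
suff : \forall dl \near 0^'+, Theta S `<=` Q dl.
  move=> H; near (0 : R)^'+ => dl; exists dl => // y t yd am lm.
  have Hd : Theta S `<=` Q dl by near: dl.
  exact: (Hd _ am.1 am.1 _ yd am lm).
apply: cT => x xT.
have [E|] := pselect (forall k, rate S k x = rate S k t0).
  have [s us xs] := idT x xT E.
  pose A : R := Num.sqrt (M * d)%:R.
  have A0 : 0 < 1 + A by rewrite ltr_wpDr// sqrtr_ge0.
  near=> t dl => _ y _ _ lm.
  rewrite (le_trans (norm_le_enorm _))// (le_trans (labels_matched_near us lm))//.
  rewrite -xs (le_trans (enorm_le_norm _))// -/A.
  have : `|t - x| < e / (1 + A).
    by rewrite distrC; near: t; apply: cvgr_dist_lt => //; rewrite divr_gt0.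
  rewrite ltr_pdivlMr// => /ltW; apply: le_trans.
  by rewrite mulrC ler_wpM2l// lerDr.
move=> /existsNP[k0 /eqP k0x].
pose D t := mean_loglik v t0 - mean_loglik v t.
have Dx : 0 < D x.
  rewrite /D /mean_loglik -sumrB (bigD1 k0)//= ltr_wpDr//.
    by rewrite sumr_ge0// => k _; rewrite poisson_entropy_ge0 ?rate_gt0.
  by rewrite poisson_entropy_gt0 ?rate_gt0.
have lnc k : ln (rate S k t) @[t --> within (Theta S) (nbhs x)] --> ln (rate S k x).
  apply: (cvg_comp (rate S k) (@ln R)); first exact: rc.
  exact: (continuous_ln (rate_gt0 k xT)).
have Dc : D t @[t --> within (Theta S) (nbhs x)] --> D x.
  apply: cvgB; first exact: cvg_cst.
  apply: cvg_finsum => k; apply: cvgB; last exact: rc.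
  by apply: cvgM => //; exact: cvg_cst.
pose G t := \sum_k `|ln (rate S k t) - ln (rate S k x)|.
have Gc : G t @[t --> within (Theta S) (nbhs x)] --> (0 : R).
  rewrite -[X in _ --> X](_ : G x = 0); last first.
    by rewrite /G big1// => k _; rewrite subrr normr0.
  by apply: cvg_finsum => k; apply: cvg_norm; apply: cvgB => //; exact: cvg_cst.
pose H := \sum_k `|ln (rate S k t0) - ln (rate S k x)| + 1.
have H0 : 0 < H by rewrite ltr_wpDl// sumr_ge0.
have Dn : \forall t \near within (Theta S) (nbhs x), D x / 2 < D t.
  by apply: (cvgr_gt (D x)) => //; rewrite ltr_pdivrMr// ltr_pMr// ltr1n.
have Gn : \forall t \near within (Theta S) (nbhs x), G t < 1.
  exact: (cvgr_lt 0).
rewrite near_withinE in Dn; rewrite near_withinE in Gn.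
near=> t dl.
have Dt' : Theta S t -> D x / 2 < D t by near: t; exact: Dn.
have Gt' : Theta S t -> G t < 1 by near: t; exact: Gn.
have dlH : dl * H < D x / 2.
  by rewrite -ltr_pdivlMr//; near: dl; apply: nbhs_right_lt; rewrite !divr_gt0.
move=> tT; have Dt := Dt' tT; have Gt := Gt' tT.
move=> y yd [_ /(_ _ Theta_t0) am] lm; exfalso.
have E : mean_loglik y t0 - mean_loglik y t =
    D t + \sum_k (y k - v k) * (ln (rate S k t0) - ln (rate S k t)).
  have term (a b l0 l r0 r : R) : (a * l0 - r0) - (a * l - r) =
      (b * l0 - r0 - (b * l - r)) + (a - b) * (l0 - l) by ring.
  by rewrite /D /mean_loglik -!sumrB -big_split; apply: eq_bigr => k _ /=; exact: term.
have : `|\sum_k (y k - v k) * (ln (rate S k t0) - ln (rate S k t))| <= dl * H.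
  rewrite (le_trans (ler_norm_sum _ _ _))// (@le_trans _ _ (\sum_k `|y k - v k| * H))//.
    rewrite ler_sum// => k _; rewrite normrM ler_wpM2l//.
    rewrite -[X in `|X|](subrKA (ln (rate S k x))) (le_trans (ler_normD _ _))//.
    rewrite lerD//.
      exact: (le_sum_term (F := fun k => `|ln (rate S k t0) - ln (rate S k x)|)).
    rewrite distrC (le_trans _ (ltW Gt))//.
    exact: (le_sum_term (F := fun k => `|ln (rate S k t) - ln (rate S k x)|)).
  by rewrite -mulr_suml ler_wpM2r// ltW.
rewrite ler_norml => /andP[lb _]; move: am; rewrite -subr_le0 E.
apply/negP; rewrite -ltNge (lt_le_trans _ (lerD (lexx (D t)) lb))// subr_gt0.
exact: lt_trans Dt.
Unshelve. all: by end_near. Qed.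

End MeanLogLikelihood.

(** * Linearization of the maximizer *)

Lemma subrACA (V : zmodType) (a b c e : V) :
  (a - b) - (c - e) = (a - c) - (b - e).
Proof. by rewrite !opprD !opprK addrACA. Qed.

Section Estimator.
Context {R : realType} {d M Kx Ky : nat} (S : @frame_model R d M Kx Ky).
Local Notation pixel := ('I_Kx * 'I_Ky)%type.
Local Notation param := ('rV[R]_(M * d)).
Local Notation frame := {ffun pixel -> nat}.
Variable t0 : param.
Hypothesis Theta_t0 : (Theta S)° t0.
Hypothesis rate_gt0 : forall k t, Theta S t -> 0 < rate S k t.

Let v k := rate S k t0.
Let h k t : R := ln (rate S k t).
Let g k : param := gradient (h k) t0.

(** This is how a hypothesis on the log-likelihoods of frames becomes one on
    the rates, pixel by pixel. *)
Lemma log_rate_loglik1 k :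
  h k = loglik1 S (unit_frame k) \- loglik1 S (@zero_frame Kx Ky).
Proof.
apply/funext => t; rewrite /loglik1 /= -sumrB (bigD1 k)//= !ffunE eqxx big1.
  by rewrite addr0 mul1r mul0r sub0r opprK subrK.
by move=> j /negbTE jk; rewrite !ffunE jk subrr.
Qed.

(** Evaluated at the empty frame and at the frames with a single count, the
    domination hypothesis controls the logarithm of each rate. *)
Lemma log_rate_expansion {dT} {T : measurableType dT} (P : probability T R)
    (V : pixel -> {RV P >-> nat}) :
  third_derivatives_dominated S t0 V ->
  exists r C : R, [/\ 0 < r, 0 <= C,
    forall t, `|t - t0| <= r -> Theta S t &
    forall k t, `|t - t0| <= r -> [/\ forall i, derivable (h k) t (basis i),
      `|gradient (h k) t - g k| <= C * `|t - t0| &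
      `|h k t - h k t0 - dot (g k) (t - t0)| <= C * `|t - t0| ^+ 2]].
Proof.
move=> [U [W [Ut0 _ UW]]].
have /nbhs_ballP[e /= e0 eU] : nbhs t0 (U `&` Theta S) by exact: filterI.
have r0 : 0 < e / 2 by rewrite divr_gt0.
have rU t : `|t - t0| <= e / 2 -> U t /\ Theta S t.
  move=> tr; apply: eU; rewrite -ball_normE /ball_/= distrC.
  by rewrite (le_lt_trans tr)// ltr_pdivrMr// ltr_pMr// ltr1n.
have Hz z := gradient_expansion r0 (fun t i j k tr =>
  UW z t (rU t tr).1 i j k).
pose C z := s2val (cid2 (Hz z)).
have C0 z : 0 <= C z := s2valP (cid2 (Hz z)).
have HC z := s2valP' (cid2 (Hz z)).
exists (e / 2), (\sum_k C (unit_frame k) + C (@zero_frame Kx Ky)).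
split => //.
- by rewrite addr_ge0// sumr_ge0.
- by move=> t /rU[].
move=> k t tr.
have t0r : `|t0 - t0| <= e / 2 by rewrite subrr normr0 ltW.
set a := unit_frame k; set b := @zero_frame Kx Ky.
have CC (x : R) : 0 <= x -> C a * x + C b * x <=
    (\sum_k C (unit_frame k) + C (@zero_frame Kx Ky)) * x.
  move=> x0; rewrite -mulrDl ler_wpM2r// lerD2r.
  exact: (le_sum_term (F := fun k => C (unit_frame k))).
have gradB x : `|x - t0| <= e / 2 -> gradient (h k) x =
    gradient (loglik1 S a) x - gradient (loglik1 S b) x.
  move=> xr; have [da _ _] := HC a x xr; have [db _ _] := HC b x xr.
  by apply/rowP => i; rewrite !mxE log_rate_loglik1 /partial deriveB.
have [da ga ea] := HC a t tr; have [db gb eb] := HC b t tr.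
split.
- by move=> i; rewrite log_rate_loglik1; exact: derivableB.
- rewrite /g !gradB//.
  by rewrite subrACA (le_trans (ler_normB _ _))// (le_trans (lerD ga gb))// CC.
rewrite /g !gradB//.
have dotBl (x y z : param) : dot (x - y) z = dot x z - dot y z.
  by rewrite /dot -sumrB; apply: eq_bigr => i _; rewrite !mxE mulrBl.
rewrite dotBl log_rate_loglik1 /= (subrACA (loglik1 S a t)).
by rewrite (subrACA (_ - _)) (le_trans (ler_normB _ _))// (le_trans (lerD ea eb))// CC// exprn_ge0.
Qed.

Hypothesis h_expansion : exists r C : R, [/\ 0 < r, 0 <= C,
    forall t, `|t - t0| <= r -> Theta S t &
    forall k t, `|t - t0| <= r -> [/\ forall i, derivable (h k) t (basis i),
      `|gradient (h k) t - g k| <= C * `|t - t0| &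
      `|h k t - h k t0 - dot (g k) (t - t0)| <= C * `|t - t0| ^+ 2]].

Let near_ball (r : R) t i : `|t - t0| < r ->
  exists2 e : R, 0 < e & forall u : R, `|u| < e -> `|t + u *: basis i - t0| <= r.
Proof.
move=> tr; exists (r - `|t - t0|) => [|u ue]; first by rewrite subr_gt0.
rewrite addrAC (le_trans (ler_normD _ _))// -lerBrDl (le_trans _ (ltW ue))//.
rewrite normrZ ler_piMr// norm_le_entry// => j.
by rewrite !mxE eqxx/=; case: eqP => _; rewrite ?normr1 ?normr0.
Qed.

(** Along each axis the mean log-likelihood is a function of one variable with
    an interior maximum, so its derivative vanishes. *)
Lemma score_argmax (r C : R) (y : pixel -> R) t :
  (forall t, `|t - t0| <= r -> Theta S t) ->
  (forall k t, `|t - t0| <= r -> forall i, derivable (h k) t (basis i)) ->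
  `|t - t0| < r -> mean_argmax S y t ->
  \sum_k (y k - expR (h k t)) *: gradient (h k) t = 0.
Proof.
move=> rT dh tr [tT am]; apply/rowP => i; rewrite summxE mxE.
under eq_bigr do rewrite !mxE.
have [e e0 eb] := near_ball i tr.
pose q k (u : R) := h k (t + u *: basis i).
have dq k (u : R) : `|u| < e -> is_derive u 1 (q k) (partial i (h k) (t + u *: basis i)).
  by move=> ue; apply: is_derive_line; apply: dh; exact: eb.
pose phi (u : R) := \sum_k (y k * q k u - expR (q k u)).
have dphi (u : R) : `|u| < e -> is_derive u 1 phi
    (\sum_k (y k * partial i (h k) (t + u *: basis i) -
       expR (q k u) * partial i (h k) (t + u *: basis i))).
  move=> ue; apply: is_derive_finsum => k; apply: is_deriveB.
    have := is_deriveZ (y k) (dq k u ue); exact.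
  exact: (is_derive1_comp (is_derive_expR _) (dq k u ue)).
have phiE (u : R) : `|u| < e -> phi u = mean_loglik S y (t + u *: basis i).
  move=> ue; rewrite /phi /mean_loglik; apply: eq_bigr => k _.
  by rewrite /q /h lnK// posrE rate_gt0//; apply: rT; exact: eb.
have itve (u : R) : u \in `]- e, e[ -> `|u| < e.
  by rewrite in_itv/= ltr_norml.
have e00 : `|0 : R| < e by rewrite normr0.
have : is_derive (0 : R) 1 phi 0.
  apply: (@derive1_at_max _ phi (- e) e).
  - by rewrite ge0_cp// ltW.
  - by move=> u /itve ue; have ? := dphi u ue; exact: ex_derive.
  - by rewrite in_itv/= oppr_lt0 e0.
  - move=> u /itve ue; rewrite (phiE u ue) (phiE 0 e00) scale0r addr0.
    by apply: am; apply: rT; exact: eb.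
move=> /(@derive_val _ _ _ _ _ _ _) z; have := dphi 0 e00.
move=> /(@derive_val _ _ _ _ _ _ _); rewrite z => {}z.
rewrite [RHS]z; apply: eq_bigr => k _.
by rewrite /q scale0r addr0 mulrBl.
Qed.

(** Since the rate is the exponential of the log-rate, its partial derivatives
    carry a factor [v k], and two such factors meet the weight [(v k)^-1]. *)
Lemma fisher_log_rate : fisher S t0 = \sum_k v k *: ((g k)^T *m g k).
Proof.
have [r [C [r0 _ rT hk]]] := h_expansion.
have t0r : `|t0 - t0| < r by rewrite subrr normr0.
have dr k i : partial i (rate S k) t0 = v k * partial i (h k) t0.
  have [e e0 eb] := near_ball i t0r.
  have d0 : is_derive (0 : R) 1 (fun u => expR (h k (t0 + u *: basis i)))
      (expR (h k (t0 + 0 *: basis i)) * partial i (h k) (t0 + 0 *: basis i)).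
    apply: (is_derive1_comp (is_derive_expR _)); apply: is_derive_line.
    by have [|+ _ _] := hk k (t0 + 0 *: basis i); [apply: eb; rewrite normr0|exact].
  have : is_derive (0 : R) 1 (fun u => rate S k (t0 + u *: basis i))
      (v k * partial i (h k) t0).
    have hK : expR (h k t0) = v k.
      by rewrite lnK// posrE rate_gt0//; apply: rT; exact: ltW.
    move: d0; rewrite scale0r addr0 hK.
    have nb : \forall u \near (0 : R), `|u| < e by apply: nbhs0_lt.
    apply: near_eq_is_derive; apply: filterS nb => u ue.
    by rewrite /h lnK// posrE rate_gt0//; apply: rT; exact: eb.
  by move=> /(@derive_val _ _ _ _ _ _ _) <-; rewrite /partial derive_lineE.
apply/matrixP => i j; rewrite !mxE summxE; apply: eq_bigr => k _.
rewrite !dr !mxE big_ord1 !mxE -/(v k).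
have vk : v k != 0 by rewrite gt_eqF ?rate_gt0//; apply: rT; exact: ltW.
by rewrite -mulrA mulKf// mulrCA.
Qed.

(** Far from [v] the bound is trivial because [Theta] is bounded; near [v] the
    estimate is a critical point close to [t0]. *)
Lemma mean_argmax_linearization :
  compact (Theta S) -> identifiable_up_to_relabeling S t0 ->
  (forall k t, Theta S t ->
     rate S k t' @[t' --> within (Theta S) (nbhs t)] --> rate S k t) ->
  posdef (fisher S t0) ->
  exists2 C : R, 0 <= C & forall y t, mean_argmax S y t -> labels_matched S t0 t ->
    `|t - t0 - \sum_k (y k - v k) *: (g k *m invmx (fisher S t0))| <=
      C * (\sum_k `|y k - v k|) ^+ 2.
Proof.
move=> cT idT rc pF.
have [r [C [r0 C0 rT hk]]] := h_expansion.
have tT : Theta S t0 by exact: interior_subset.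
have vE k : expR (h k t0) = v k by rewrite lnK// posrE rate_gt0.
have FE : fisher S t0 = \sum_k expR (h k t0) *: ((g k)^T *m g k).
  by rewrite fisher_log_rate; apply: eq_bigr => k _; rewrite vE.
have [C' [rho [C'0 rho0 rhor lin]]] := @critical_point_linearization _ _ _ h t0 r C r0 C0
  (fun k t tr => let: And3 _ a b := hk k t tr in conj a b) (eq_ind _ posdef pF _ FE).
have [dl dl0 cons] := mean_argmax_consistent tT rate_gt0 (divr_gt0 rho0 (ltr0n R 2))
  cT idT rc.
have [D0 [_ HD]] := compact_bounded cT.
pose D : R := `|D0| + 1.
have DT t : Theta S t -> `|t| <= D.
  by apply: HD; rewrite (le_lt_trans (ler_norm _))// ltrDl.
have DD : 0 <= D by rewrite addr_ge0.
pose B : R := \sum_k `|g k *m invmx (fisher S t0)|.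
have B0 : 0 <= B by rewrite sumr_ge0.
pose e : R := Num.min dl rho.
have e0 : 0 < e by rewrite lt_min dl0.
exists (C' + ((D + D) / e ^+ 2 + B / e)) => [|y t am lm].
  by rewrite !addr_ge0 ?divr_ge0 ?addr_ge0 ?exprn_ge0// ltW.
set E := \sum_k `|y k - v k|.
have E0 : 0 <= E by rewrite sumr_ge0.
have [Ee|eE] := leP E e.
  rewrite mulrDl (@le_trans _ _ (C' * E ^+ 2))//; last first.
    by rewrite lerDl mulr_ge0 ?exprn_ge0// !addr_ge0 ?divr_ge0 ?addr_ge0 ?exprn_ge0// ltW.
  have tr : `|t - t0| <= rho / 2.
    by apply: cons am lm; rewrite (le_trans Ee)// ge_min lexx.
  have tr' : `|t - t0| < rho.
    by rewrite (le_lt_trans tr)// ltr_pdivrMr// ltr_pMr// ltr1n.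
  have sc : \sum_k (y k - expR (h k t)) *: gradient (h k) t = 0.
    apply: (score_argmax (r := r)) => //; last exact: lt_le_trans tr' rhor.
    by move=> k u ur i; have [] := hk k u ur.
  have EE : \sum_k `|y k - expR (h k t0)| = E.
    by apply: eq_bigr => k _; rewrite vE.
  have := lin t y (ltW tr'); rewrite EE -FE => /(_ _ sc).
  under eq_bigr do rewrite vE.
  by apply; rewrite (le_trans Ee)// ge_min lexx orbT.
rewrite mulrDl (@le_trans _ _ (((D + D) / e ^+ 2 + B / e) * E ^+ 2))//; last first.
  by rewrite lerDr mulr_ge0// exprn_ge0.
rewrite (le_trans (ler_normB _ _))// mulrDl lerD//.
  rewrite (le_trans (ler_normB _ _))//.
  rewrite (le_trans (lerD (DT _ am.1) (DT _ tT)))// mulrAC ler_pdivlMr ?exprn_gt0//.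
  by rewrite ler_wpM2l ?addr_ge0// lerXn2r ?nnegrE// ltW.
rewrite (@le_trans _ _ (B * E))//.
  rewrite (le_trans (ler_norm_sum _ _ _))// mulr_suml ler_sum// => k _.
  rewrite normrZ mulrC ler_wpM2l//.
  exact: (le_sum_term (F := fun j => `|y j - v j|)).
rewrite -mulrA ler_wpM2l// mulrC ler_pdivlMr// expr2 ler_wpM2l//.
exact: ltW.
Qed.

(** By [fisher_log_rate] the sum is [F^-1 F F^-1]. It is the covariance of the
    linear term for one frame, a Poisson count having variance [v k]. *)
Lemma linearization_covariance : posdef (fisher S t0) ->
  \sum_k v k *: ((g k *m invmx (fisher S t0))^T *m (g k *m invmx (fisher S t0))) =
  invmx (fisher S t0).
Proof.
move=> pF; have uF := posdef_unitmx pF.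
have sF : (invmx (fisher S t0))^T = invmx (fisher S t0).
  by rewrite trmx_inv pF.1.
set I := invmx (fisher S t0) in sF *.
transitivity (I *m fisher S t0 *m I); last by rewrite mulVmx// mul1mx.
rewrite fisher_log_rate mulmx_sumr mulmx_suml.
by apply: eq_bigr => k _; rewrite trmx_mul sF -scalemxAr -scalemxAl !mulmxA.
Qed.

End Estimator.

(** * Averages over random translations *)

Section BoundedIntegrals.
Context {d} {T : measurableType d} {R : realType} (P : probability T R).
Implicit Types f g : T -> R.

Definition bounded_measurable f : Prop :=
  measurable_fun [set: T] f /\ exists C : R, forall x, `|f x| <= C.

Lemma bounded_measurable_integrable f : bounded_measurable f ->
  P.-integrable [set: T] (EFin \o f).
Proof.
move=> [mf [C fC]]; apply: measurable_bounded_integrable => //.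
  by rewrite (le_lt_trans (probability_le1 _ _))// ltry.
exists C; split; first exact: num_real.
by move=> M CM x _ /=; rewrite (le_trans (fC x))// ltW.
Qed.

Lemma bounded_measurableB f g : bounded_measurable f -> bounded_measurable g ->
  bounded_measurable (fun x => f x - g x).
Proof.
move=> [mf [C fC]] [mg [D gD]]; split; first exact: measurable_funB.
by exists (C + D) => x; rewrite (le_trans (ler_normB _ _))// lerD.
Qed.

Lemma Rintegral_boundedB f g : bounded_measurable f -> bounded_measurable g ->
  \int[P]_x (f x - g x) = \int[P]_x f x - \int[P]_x g x.
Proof.
by move=> bf bg; rewrite RintegralB//; exact: bounded_measurable_integrable.
Qed.

Lemma Rintegral_boundedZ c f : bounded_measurable f ->
  \int[P]_x (c * f x) = c * \int[P]_x f x.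
Proof.
by move=> bf; rewrite RintegralZl//; exact: bounded_measurable_integrable.
Qed.

Lemma Rintegral_prob_cst (c : R) : \int[P]_x c = c.
Proof. rewrite Rintegral_cst//.
rewrite (_ : fine _ = fine (1%E : \bar R)) ?mulr1//; congr fine.
exact: probability_setT. Qed.

Lemma norm_Rintegral_le f g : P.-integrable [set: T] (EFin \o f) ->
  P.-integrable [set: T] (EFin \o g) -> (forall x, `|f x| <= g x) ->
  `|\int[P]_x f x| <= \int[P]_x g x.
Proof.
move=> fi gi fg; rewrite (le_trans (le_normr_Rintegral _ fi))//.
by apply: le_Rintegral => //; exact: integrable_norm.
Qed.

Lemma norm_Rintegral_le_cst f (C : R) : measurable_fun [set: T] f ->
  (forall x, `|f x| <= C) -> `|\int[P]_x f x| <= C.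
Proof.
move=> mf fC; rewrite -[leRHS]Rintegral_prob_cst; apply: norm_Rintegral_le => //.
  by apply: bounded_measurable_integrable; split => //; exists C.
by apply: bounded_measurable_integrable; split => //; exists `|C|.
Qed.

End BoundedIntegrals.

Section UniformlyContinuous.
Context {R : realType} {n : nat}.
Implicit Types (f g : 'rV[R]_n -> R) (x y L : 'rV[R]_n).

(** Bounded uniformly continuous functions: averaging over random
    translations preserves this class without any dominated convergence. *)
Definition buc f : Prop :=
  (exists C : R, forall x, `|f x| <= C) /\
  forall e : R, 0 < e -> exists2 dl : R, 0 < dl &
    forall x y, `|x - y| < dl -> `|f x - f y| <= e.

Lemma bucB f g : buc f -> buc g -> buc (fun x => f x - g x).
Proof.
move=> [[C fC] fu] [[D gD] gu]; split.
  by exists (C + D) => x; rewrite (le_trans (ler_normB _ _))// lerD.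
move=> e e0; have e20 : 0 < e / 2 by rewrite divr_gt0.
have [d1 d10 f1] := fu _ e20; have [d2 d20 g2] := gu _ e20.
exists (Num.min d1 d2); first by rewrite lt_min d10.
move=> x y; rewrite lt_min => /andP[xy1 xy2].
rewrite (_ : _ - _ = (f x - f y) - (g x - g y)); last by ring.
by rewrite (le_trans (ler_normB _ _))// (splitr e) lerD ?f1 ?g2.
Qed.

Lemma bucZ (c : R) f : buc f -> buc (fun x => c * f x).
Proof.
move=> [[C fC] fu]; split.
  by exists (`|c| * C) => x; rewrite normrM ler_wpM2l.
move=> e e0; have c0 : 0 < 1 + `|c| by rewrite ltr_wpDr.
have [dl dl0 fd] := fu _ (divr_gt0 e0 c0).
exists dl => // x y /fd; rewrite ler_pdivlMr// -mulrBr normrM; apply: le_trans.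
by rewrite mulrC ler_wpM2l// lerDr.
Qed.

Lemma buc_shift L f : buc f -> buc (fun x => f (x + L)).
Proof.
move=> [[C fC] fu]; split; first by exists C.
move=> e /fu[dl dl0 fd]; exists dl => // x y xy.
by apply: fd; rewrite opprD addrACA subrr addr0.
Qed.

Lemma buc_continuous_line f x L : buc f -> continuous (fun r : R => f (x + r *: L)).
Proof.
move=> [_ fu] r; apply/cvgrPdist_le => e e0; have [dl dl0 fd] := fu _ e0.
have L0 : 0 < 1 + `|L| by rewrite ltr_wpDr.
near=> r'; apply: fd; rewrite opprD addrACA subrr add0r -scalerBl normrZ.
have : `|r - r'| < dl / (1 + `|L|).
  by near: r'; apply: cvgr_dist_lt => //; exact: divr_gt0.
rewrite ltr_pdivlMr//; apply: le_lt_trans.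
by rewrite ler_wpM2l// lerDr.
Unshelve. all: by end_near. Qed.

Section Average.
Context {d} {T : measurableType d} (P : probability T R) (xi : T -> R).
Hypothesis mxi : measurable_fun [set: T] xi.

Definition average L f x : R := \int[P]_w f (x + xi w *: L).

Lemma bounded_measurable_shift f x L : buc f ->
  bounded_measurable (fun w => f (x + xi w *: L)).
Proof.
move=> bf; split; last by have [[C fC] _] := bf; exists C.
apply: (measurableT_comp (f := fun r : R => f (x + r *: L))) => //.
by apply: continuous_measurable_fun; exact: buc_continuous_line.
Qed.

Lemma averageB L f g x : buc f -> buc g ->
  average L (fun y => f y - g y) x = average L f x - average L g x.
Proof.
by move=> bf bg; rewrite /average Rintegral_boundedB//; exact: bounded_measurable_shift.
Qed.

Lemma averageZ L c f x : buc f ->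
  average L (fun y => c * f y) x = c * average L f x.
Proof.
by move=> bf; rewrite /average Rintegral_boundedZ//; exact: bounded_measurable_shift.
Qed.

Lemma norm_average_le L f (C : R) x : buc f -> (forall y, `|f y| <= C) ->
  `|average L f x| <= C.
Proof.
move=> bf fC; apply: norm_Rintegral_le_cst => //.
exact: (bounded_measurable_shift x L bf).1.
Qed.

Lemma average_shift L f x y :
  average L f (x + y) = average L (fun z => f (z + y)) x.
Proof. by apply: eq_Rintegral => w _; rewrite addrAC. Qed.

Lemma buc_average L f : buc f -> buc (average L f).
Proof.
move=> bf; have [[C fC] fu] := bf; split.
  by exists C => x; exact: norm_average_le.
move=> e /fu[dl dl0 fd]; exists dl => // x y xy.
have -> : average L f x = average L (fun z => f (z + (x - y))) y.
  by rewrite -average_shift addrC subrK.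
rewrite -averageB//; last exact: buc_shift.
apply: norm_average_le => [|z].
  by apply: bucB => //; exact: buc_shift.
by apply: fd; rewrite addrC addKr.
Qed.

End Average.

(** A third-order Taylor bound along the direction [L]; the coefficients [a]
    and [b] play the part of the first two derivatives along [L]. In this form
    the bound passes to averages by integrating it. *)
Definition taylor3 L (C : R) f : Prop :=
  exists a b, [/\ buc a, buc b &
    forall x (s : R), `|f (x + s *: L) - f x - s * a x - s ^+ 2 / 2 * b x| <=
      C * `|s| ^+ 3].

Lemma taylor3_average {d} {T : measurableType d} (P : probability T R)
    (xi : T -> R) L L' C f : measurable_fun [set: T] xi ->
  buc f -> taylor3 L C f -> taylor3 L C (average P xi L' f).
Proof.
move=> mxi bf [a [b [ba bb H]]].
exists (average P xi L' a), (average P xi L' b); split.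
- exact: buc_average.
- exact: buc_average.
move=> x s; have bs := buc_shift (s *: L) bf.
have b1 := bucB bs bf.
have b2 := bucB b1 (bucZ s ba).
have b3 := bucB b2 (bucZ (s ^+ 2 / 2) bb).
rewrite average_shift -!(averageZ P mxi)// -(averageB P mxi _ _ bs)//.
rewrite -(averageB P mxi _ _ b1 (bucZ s ba)).
rewrite -(averageB P mxi _ _ b2 (bucZ (s ^+ 2 / 2) bb)).
exact: norm_average_le.
Qed.

(** The Lindeberg step: a centered average with variance [v] and small third
    moment acts like [f + v/2 f''], whatever its law. *)
Lemma average_expansion {d} {T : measurableType d} (P : probability T R)
    (xi : T -> R) L C f (v m : R) : measurable_fun [set: T] xi -> buc f ->
  0 <= C ->
  P.-integrable [set: T] (EFin \o xi) ->
  P.-integrable [set: T] (EFin \o (fun w => xi w ^+ 2)) ->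
  P.-integrable [set: T] (EFin \o (fun w => `|xi w| ^+ 3)) ->
  \int[P]_w xi w = 0 -> \int[P]_w (xi w ^+ 2) = v ->
  \int[P]_w (`|xi w| ^+ 3) <= m ->
  forall a b, (forall x (s : R),
    `|f (x + s *: L) - f x - s * a x - s ^+ 2 / 2 * b x| <= C * `|s| ^+ 3) ->
  forall x, `|average P xi L f x - f x - v / 2 * b x| <= C * m.
Proof.
move=> mxi bf C0 i1 i2 i3 e1 e2 e3 a b H x.
have bfx : bounded_measurable (fun w => f (x + xi w *: L)).
  exact: bounded_measurable_shift.
have bcst : bounded_measurable (fun _ : T => f x).
  by split => //; exists `|f x|.
have ifx : P.-integrable [set: T] (EFin \o (fun w => f (x + xi w *: L) - f x)).
  apply: bounded_measurable_integrable; exact: bounded_measurableB.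
have ia : P.-integrable [set: T] (EFin \o (fun w => xi w * a x)).
  have := integrableZr measurableT (a x) i1; exact.
have ib : P.-integrable [set: T] (EFin \o (fun w => xi w ^+ 2 * (b x / 2))).
  have := integrableZr measurableT (b x / 2) i2; exact.
have iab : P.-integrable [set: T] (EFin \o (fun w => f (x + xi w *: L) - f x - xi w * a x)).
  have := integrableB measurableT ifx ia; exact.
have -> : average P xi L f x - f x - v / 2 * b x =
  \int[P]_w (f (x + xi w *: L) - f x - xi w * a x - xi w ^+ 2 * (b x / 2)).
  rewrite RintegralB// RintegralB// RintegralZr// e1 mul0r subr0.
  rewrite RintegralZr// e2 Rintegral_boundedB// Rintegral_prob_cst.
  by rewrite mulrAC mulrA.
have i3C : P.-integrable [set: T] (EFin \o (fun w => C * `|xi w| ^+ 3)).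
  have := integrableZl measurableT C i3; exact.
apply: (@le_trans _ _ (\int[P]_w (C * `|xi w| ^+ 3))); last first.
  by rewrite RintegralZl// ler_wpM2l.
apply: norm_Rintegral_le => // [|w].
  have := integrableB measurableT iab ib; exact.
by have := H x (xi w); rewrite mulrAC mulrA.
Qed.

End UniformlyContinuous.

(** * Smoothing along a direction *)

Section UniformSmoothing.
Context {R : realType}.
Local Notation mu := (@lebesgue_measure R).

Lemma Rintegral_uniform (a b : R) (ab : a < b) (f : R -> R) :
  bounded_measurable (f : measurableTypeR R -> R) ->
  \int[uniform_prob ab]_u f u = (b - a)^-1 * \int[mu]_(u in `[a, b]) f u.
Proof.
move=> bf; have [mf [C fC]] := bf.
have i1 : (uniform_prob ab).-integrable [set: measurableTypeR R] (EFin \o f).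
  exact: bounded_measurable_integrable.
have ic c : mu.-integrable `[a, b] (EFin \o (fun _ : R => c)).
  apply: continuous_compact_integrable; first exact: segment_compact.
  by apply: continuous_subspaceT => x; exact: cst_continuous.
have iL : mu.-integrable `[a, b] (EFin \o f).
  apply: (le_integrable _ _ _ (ic C)) => //.
    by apply/measurable_EFinP; exact: measurable_funTS.
  by move=> x _ /=; rewrite lee_fin (le_trans (fC x))// ler_norm.
have C0 : 0 <= C by exact: le_trans (fC 0).
have : \int[uniform_prob ab]_u (f u + C) =
    (b - a)^-1 * \int[mu]_(u in `[a, b]) (f u + C).
  rewrite /Rintegral integral_uniform; last 2 first.
  - by apply/measurable_EFinP; exact: measurable_funD.
  - by move=> x; rewrite lee_fin -lerBlDr sub0r; have := fC x; rewrite ler_norml => /andP[].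
  rewrite fineM//.
  by apply: integrable_fin_num => //; have := @integrableD _ _ _ mu _ _ _ _ iL (ic C); exact.
rewrite RintegralD//; last first.
  by apply: bounded_measurable_integrable; split => //; exists `|C|.
rewrite (RintegralD _ iL (ic C))// Rintegral_prob_cst Rintegral_cst//.
rewrite [X in C * X](_ : _ = b - a); last first.
  transitivity (fine (mu `[a, b]%classic)) => //.
  by rewrite lebesgue_measure_itv/= lte_fin ab.
rewrite mulrDr (mulrCA _ C) mulVf ?mulr1.
  by move/addIr.
by rewrite subr_eq0 gt_eqF.
Qed.

(** Averaging over a segment trades the derivative of the average for a
    difference quotient, by the fundamental theorem of calculus. *)
Lemma is_derive_uniform (sg : R) (sg0 : 0 < sg) (f : R -> R) (s0 : R) :
  continuous f -> (exists C : R, forall x, `|f x| <= C) ->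
  is_derive s0 1 (fun s => \int[uniform_prob sg0]_u f (s + u))
    (sg^-1 * (f (s0 + sg) - f s0)).
Proof.
move=> cf [C fC].
pose a := s0 - 1; pose F (s : R) := \int[mu]_(t in `[a, s]) f t.
have dF (s : R) : a < s -> is_derive s 1 F (f s).
  move=> sa; have ss1 : s < s + 1 by rewrite ltrDl.
  have cpt : mu.-integrable `[a, s + 1] (EFin \o f).
    apply: continuous_compact_integrable; first exact: segment_compact.
    exact: continuous_subspaceT.
  have [dF <-] := continuous_FTC1_closed ss1 cpt sa (cf s).
  by rewrite derive1E; exact: derivableP.
have dFs (c s : R) : a < s + c -> is_derive s 1 (fun u => F (u + c)) (f (s + c)).
  move=> sa; rewrite -[f _]mulr1; apply: (@is_derive1_comp _ F (fun u => u + c)).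
    exact: dF.
  by rewrite -[X in is_derive _ _ _ X]addr0; apply: is_deriveD.
have E (s : R) : a < s -> \int[uniform_prob sg0]_u f (s + u) =
    sg^-1 * (F (s + sg) - F s).
  move=> sa; rewrite Rintegral_uniform; last first.
    split; last by exists C.
    apply: (measurableT_comp (f := f) (g := fun u : measurableTypeR R => s + u)).
      exact: continuous_measurable_fun.
    exact: measurable_funD.
  rewrite subr0; congr (_ * _).
  pose G (u : R) := F (u + s).
  have dG (u : R) : 0 <= u -> is_derive u 1 G (f (u + s)).
    by move=> u0; apply: dFs; rewrite (lt_le_trans sa)// lerDr.
  have cG (u : R) : 0 <= u -> {for u, continuous G}.
    move=> u0; apply: differentiable_continuous.
    by apply/derivable1_diffP; have ? := dG u u0; exact: ex_derive.
  rewrite /Rintegral (@continuous_FTC2 _ (fun u => f (s + u)) G)//=.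
  - by rewrite /G add0r (addrC sg).
  - apply: continuous_subspaceT => u; apply: continuous_comp; last exact: cf.
    by apply: cvgD; [exact: cvg_cst|exact: cvg_id].
  - split.
    + move=> u; rewrite in_itv/= => /andP[u0 _]; have ? := dG u (ltW u0).
      exact: ex_derive.
    + by apply: cvg_at_right_filter; exact: cG.
    + by apply: cvg_at_left_filter; apply: cG; exact: ltW.
  - move=> u; rewrite in_itv/= => /andP[u0 _]; rewrite derive1E.
    by have ? := dG u (ltW u0); rewrite derive_val addrC.
have a0 : a < s0 by rewrite ltrBlDr ltrDl.
apply: (@near_eq_is_derive _ _ _ (fun s => sg^-1 * (F (s + sg) - F s))).
  have na : \forall s \near s0, a < s.
    exact: lt_nbhsr.
  by apply: filterS na => s /E.
have d1 := dFs sg s0 (lt_trans a0 (ltr_pwDr sg0 (lexx _))).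
have d2 := dF s0 a0.
exact: is_deriveZ.
Qed.

End UniformSmoothing.

Section Smoothing.
Context {R : realType} {n : nat}.

Lemma is_derive_mulr (c t : R) : is_derive t 1 (fun u : R => u * c) c.
Proof.
have h := is_deriveZ c (is_derive_id t (1 : R)).
rewrite (_ : (fun u : R => u * c) = (fun u : R => c *: u)); last first.
  by apply/funext => u; rewrite mulrC.
by apply: is_derive_eq h _; rewrite -[_ *: _]/(_ * _) mulr1.
Qed.

Lemma is_derive_half_sqr (c t : R) :
  is_derive t 1 (fun u : R => u ^+ 2 / 2 * c) (t * c).
Proof.
have h := is_deriveM (is_derive_id t (1 : R)) (is_derive_mulr (c / 2) t).
rewrite (_ : (fun u : R => u ^+ 2 / 2 * c) =
  (fun u : R => u) * (fun u : R => u * (c / 2))); last first.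
  by apply/funext => u; rewrite -[RHS]/(u * (u * (c / 2))); field.
by apply: is_derive_eq h _; rewrite -[_ *: _]/(_ * _) -[X in _ + X]/(_ * _); field.
Qed.

Lemma taylor3_bound (F a b c : R -> R) (C : R) :
  (forall t : R, is_derive t 1 F (a t)) -> (forall t : R, is_derive t 1 a (b t)) ->
  (forall t : R, is_derive t 1 b (c t)) -> (forall t, `|c t| <= C) ->
  forall s, `|F s - F 0 - s * a 0 - s ^+ 2 / 2 * b 0| <= C * `|s| ^+ 3.
Proof.
move=> dF da db cC.
have C0 : 0 <= C by exact: le_trans (cC 0).
have B u : `|b u - b 0| <= C * `|u|.
  by apply: (real_increment_le (dg := c)) => t _; split.
have A u : `|a u - a 0 - u * b 0| <= C * `|u| ^+ 2.
  pose g t := a t - t * b 0.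
  have -> : a u - a 0 - u * b 0 = g u - g 0 by rewrite /g; ring.
  rewrite expr2 mulrA; apply: (real_increment_le (dg := fun t => b t - b 0)).
  move=> t tu; split.
    by have h1 := da t; have h2 := is_derive_mulr (b 0) t; exact: is_deriveB.
  by rewrite (le_trans (B t))// ler_wpM2l.
move=> s; pose g t := F t - t * a 0 - t ^+ 2 / 2 * b 0.
have -> : F s - F 0 - s * a 0 - s ^+ 2 / 2 * b 0 = g s - g 0 by rewrite /g; field.
rewrite exprSr mulrA.
apply: (real_increment_le (dg := fun t => a t - a 0 - t * b 0)) => t ts; split.
  have h1 := dF t; have h2 := is_derive_mulr (a 0) t.
  have h3 := is_derive_half_sqr (b 0) t.
  have h12 := is_deriveB h1 h2.
  exact: is_deriveB.
by rewrite (le_trans (A t))// ler_wpM2l// lerXn2r ?nnegrE.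
Qed.

Implicit Types (f g : 'rV[R]_n -> R) (x L : 'rV[R]_n).

Definition line_derivative L f f' : Prop :=
  forall x (s : R), is_derive s 1 (fun u : R => f (x + u *: L)) (f' (x + s *: L)).

Definition difference_quotient L (sg : R) f x : R :=
  sg^-1 * (f (x + sg *: L) - f x).

Lemma buc_difference_quotient L sg f : buc f -> buc (difference_quotient L sg f).
Proof. by move=> bf; apply: bucZ; apply: bucB => //; exact: buc_shift. Qed.

Lemma line_derivative_difference_quotient L sg f f' :
  line_derivative L f f' ->
  line_derivative L (difference_quotient L sg f) (difference_quotient L sg f').
Proof.
move=> ff' x s.
have d1 : is_derive s 1 (fun u : R => f (x + u *: L + sg *: L))
    (f' (x + s *: L + sg *: L)).
  have := ff' (x + sg *: L) s; rewrite addrAC.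
  by under [in X in X -> _]eq_fun do rewrite addrAC.
have d2 := ff' x s.
exact: is_deriveZ.
Qed.

Variables (sg : R) (sg0 : 0 < sg).

Definition segment_average L f : 'rV[R]_n -> R :=
  average (uniform_prob sg0) (id : measurableTypeR R -> R) L f.

Lemma buc_segment_average L f : buc f -> buc (segment_average L f).
Proof. exact: buc_average. Qed.

Lemma line_derivative_segment_average L f : buc f ->
  line_derivative L (segment_average L f) (difference_quotient L sg f).
Proof.
move=> bf x s; rewrite /difference_quotient -addrA -scalerDl.
have [fb _] := bf.
have fxb : exists C : R, forall u : R, `|f (x + u *: L)| <= C.
  by case: fb => C fC; exists C.
have H := is_derive_uniform sg0 s (buc_continuous_line (x := x) (L := L) bf) fxb.
rewrite (_ : (fun u : R => segment_average L f (x + u *: L)) =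
  fun u => \int[uniform_prob sg0]_w f (x + (u + w) *: L))//.
by apply/funext => u; apply: eq_Rintegral => w _; rewrite scalerDl addrA.
Qed.

(** Three averagings along [L] give three derivatives along [L]. *)
Lemma taylor3_segment_average L f : buc f ->
  exists2 C : R, 0 <= C &
    taylor3 L C (segment_average L (segment_average L (segment_average L f))).
Proof.
move=> bf; set f1 := segment_average L f; set f2 := segment_average L f1.
pose D := difference_quotient L sg.
have bf1 : buc f1 by exact: buc_segment_average.
have bf2 : buc f2 by exact: buc_segment_average.
have bD g : buc g -> buc (D g) by exact: buc_difference_quotient.
have d0 : line_derivative L (segment_average L f2) (D f2).
  exact: line_derivative_segment_average.
have d1 : line_derivative L (D f2) (D (D f1)).
  apply: line_derivative_difference_quotient.
  exact: line_derivative_segment_average.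
have d2 : line_derivative L (D (D f1)) (D (D (D f))).
  do 2!apply: line_derivative_difference_quotient.
  exact: line_derivative_segment_average.
have [[C fC] _] := bD _ (bD _ (bD _ bf)).
have C0 : 0 <= C by exact: le_trans (fC 0).
exists C => //.
exists (D f2), (D (D f1)); split; [exact: bD|exact: bD (bD _ bf1)|].
move=> x s.
have x0 : x + (0 : R) *: L = x by rewrite scale0r addr0.
rewrite -[in X in _ - X - _ - _]x0 -[in X in _ - s * X]x0 -[in X in _ / 2 * X]x0.
exact: (taylor3_bound (d0 x) (d1 x) (d2 x) (fun t => fC (x + t *: L)) s).
Qed.

Lemma segment_average_near L f (dl e : R) : sg * `|L| < dl -> buc f ->
  (forall x y, `|x - y| < dl -> `|f x - f y| <= e) ->
  forall x, `|segment_average L f x - f x| <= e.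
Proof.
move=> sgL bf fd x; rewrite /segment_average /average.
have bx : bounded_measurable (fun w : measurableTypeR R => f (x + w *: L)).
  exact: (@bounded_measurable_shift _ _ _ _ (id : measurableTypeR R -> R)).
have bc : bounded_measurable (fun w : measurableTypeR R => f x).
  by split => //; exists `|f x|.
rewrite -[X in _ - X](Rintegral_prob_cst (uniform_prob sg0)) -Rintegral_boundedB//.
have bB := bounded_measurableB bx bc.
rewrite Rintegral_uniform// subr0 normrM ger0_norm ?invr_ge0 ?(ltW sg0)//.
rewrite ler_pdivrMl//.
have ic c : (@lebesgue_measure R).-integrable `[0, sg] (EFin \o (fun _ : R => c)).
  apply: continuous_compact_integrable; first exact: segment_compact.
  by apply: continuous_subspaceT => y; exact: cst_continuous.
have [mf [C fC]] := bB.
have iL : (@lebesgue_measure R).-integrable `[0, sg]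
    (EFin \o (fun w : R => f (x + w *: L) - f x)).
  apply: (le_integrable _ _ _ (ic C)) => //.
    by apply/measurable_EFinP; exact: measurable_funTS.
  by move=> y _ /=; rewrite lee_fin (le_trans (fC y))// ler_norm.
apply: (le_trans (le_normr_Rintegral _ iL)) => //.
apply: (@le_trans _ _ (\int[@lebesgue_measure R]_(u in `[0, sg]) e)).
  apply: le_Rintegral => //; first exact: (integrable_norm iL).
  move=> u; rewrite /= in_itv/= => /andP[u0 us]; apply: fd.
  rewrite addrC addKr normrZ ger0_norm// (le_lt_trans _ sgL)//.
  by rewrite ler_wpM2r.
rewrite Rintegral_cst// (_ : fine _ = sg) 1?mulrC//.
transitivity (fine ((@lebesgue_measure R) `[0, sg]%classic)) => //.
by rewrite lebesgue_measure_itv/= lte_fin sg0 /= ?subr0 ?addr0 ?oppr0 ?addr0.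
Qed.

End Smoothing.

(** * Lindeberg replacement *)

Section Lindeberg.
Context {R : realType} {n : nat}.
Implicit Types (f g : 'rV[R]_n -> R) (x L : 'rV[R]_n).

Lemma taylor3_le L (C C' : R) f : C <= C' -> taylor3 L C f -> taylor3 L C' f.
Proof.
move=> CC' [a [b [ba bb H]]]; exists a, b; split => // x s.
by rewrite (le_trans (H x s))// ler_wpM2r// exprn_ge0.
Qed.

(** What Lindeberg's argument needs to know about a summand [xi]; only [v] and
    [m] survive in the error bound. *)
Definition centered_step {d} {T : measurableType d} (P : probability T R)
    (xi : T -> R) (v m : R) : Prop :=
  [/\ measurable_fun [set: T] xi,
      [/\ P.-integrable [set: T] (EFin \o xi),
          P.-integrable [set: T] (EFin \o (fun w => xi w ^+ 2)) &
          P.-integrable [set: T] (EFin \o (fun w => `|xi w| ^+ 3))],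
      \int[P]_w xi w = 0, \int[P]_w (xi w ^+ 2) = v &
      \int[P]_w (`|xi w| ^+ 3) <= m].

(** The main terms in [average_expansion] depend on the law of the summand only
    through its variance, so they cancel in the difference. *)
Lemma average_replacement {d d'} {T : measurableType d} {T' : measurableType d'}
    (P : probability T R) (Q : probability T' R) xi eta (v m m' C : R) L f x :
  centered_step P xi v m -> centered_step Q eta v m' -> buc f -> 0 <= C ->
  taylor3 L C f ->
  `|average P xi L f x - average Q eta L f x| <= C * (m + m').
Proof.
move=> [mx [i1 i2 i3] e1 e2 e3] [mx' [i1' i2' i3'] e1' e2' e3'] bf C0 [a [b [ba bb H]]].
have := average_expansion mx bf C0 i1 i2 i3 e1 e2 e3 H x.
have := average_expansion mx' bf C0 i1' i2' i3' e1' e2' e3' H x.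
rewrite -[v / 2 * b x]/(v / 2 * b x) mulrDr => h1 h2.
rewrite (_ : _ - _ = (average P xi L f x - f x - v / 2 * b x) -
  (average Q eta L f x - f x - v / 2 * b x)); last by ring.
by rewrite (le_trans (ler_normB _ _))// lerD.
Qed.

(** Smooth along one direction at a time by three short segment averages.
    Averaging along a further direction preserves the Taylor bounds
    already obtained ([taylor3_average]). *)
Lemma smooth_approximation (K : eqType) (L : K -> 'rV[R]_n) (ks : seq K) f (e : R) :
  buc f -> 0 < e -> exists g (C : R), [/\ 0 <= C, buc g,
    forall k, k \in ks -> taylor3 (L k) C g & forall x, `|g x - f x| <= e].
Proof.
have tri (c p q r s u : R) : `|p - q| <= c / 6 -> `|q - r| <= c / 6 ->
    `|r - s| <= c / 6 -> `|s - u| <= c / 2 -> `|p - u| <= c.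
  rewrite !ler_norml => /andP[? ?] /andP[? ?] /andP[? ?] /andP[? ?].
  by apply/andP; split; lra.
elim: ks e => [|k ks IH] e bf e0.
  by exists f, 0; split => // x; rewrite subrr normr0 ltW.
have [g [C [C0 bg tg gf]]] := IH (e / 2) bf (divr_gt0 e0 (ltr0n R 2)).
have [_ /(_ (e / 6))] := bg; rewrite divr_gt0// => /(_ isT)[dl dl0 gu].
pose sg := dl / (1 + `|L k|).
have L0 : 0 < 1 + `|L k| by rewrite ltr_wpDr.
have sg0 : 0 < sg by rewrite divr_gt0.
have sgL : sg * `|L k| < dl.
  rewrite /sg mulrAC ltr_pdivrMr// ltr_pM2l//; lra.
pose A := segment_average sg0 (L k).
have bA h : buc h -> buc (A h) by exact: buc_segment_average.
have A1 y : `|A g y - g y| <= e / 6 by exact: segment_average_near sgL bg gu y.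
have AB h h' : buc h -> buc h' -> (forall y, `|h y - h' y| <= e / 6) ->
    forall y, `|A h y - A h' y| <= e / 6.
  move=> bh bh' hh y; rewrite /A /segment_average -averageB//.
  by apply: norm_average_le => //; exact: bucB.
have A2 := AB _ _ (bA _ bg) bg A1.
have A3 := AB _ _ (bA _ (bA _ bg)) (bA _ bg) A2.
have [C' C'0 tA] := taylor3_segment_average sg0 (L k) bg.
exists (A (A (A g))), (C + C'); split.
- by rewrite addr_ge0.
- exact: bA (bA _ (bA _ bg)).
- move=> k'; rewrite inE => /predU1P[->|k'ks].
    by apply: taylor3_le tA; rewrite lerDr.
  apply: (@taylor3_le _ C); first by rewrite lerDl.
  have t1 := taylor3_average (uniform_prob sg0) (L k) (@measurable_id _ _ _) bg (tg _ k'ks).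
  have t2 := taylor3_average (uniform_prob sg0) (L k) (@measurable_id _ _ _) (bA _ bg) t1.
  exact: (taylor3_average (uniform_prob sg0) (L k) (@measurable_id _ _ _)
    (bA _ (bA _ bg)) t2).
by move=> y; exact: tri (A3 y) (A2 y) (A1 y) (gf y).
Qed.

Section Iteration.
Context {d} {T : measurableType d} {K : eqType}.
Variables (P : K -> probability T R) (xi : K -> T -> R) (L : K -> 'rV[R]_n).

Definition iter_average (ks : seq K) f : 'rV[R]_n -> R :=
  foldr (fun k g => average (P k) (xi k) (L k) g) f ks.

Hypothesis mxi : forall k, measurable_fun [set: T] (xi k).

Lemma buc_iter_average ks f : buc f -> buc (iter_average ks f).
Proof. by move=> bf; elim: ks => //= k ks IH; exact: buc_average. Qed.

Lemma taylor3_iter_average ks L' C f : buc f -> taylor3 L' C f ->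
  taylor3 L' C (iter_average ks f).
Proof.
move=> bf tf; elim: ks => //= k ks IH.
by apply: taylor3_average => //; exact: buc_iter_average.
Qed.

End Iteration.

(** Replace the summands one at a time. The averages inside the one being
    replaced preserve the Taylor bound of the test function, and those outside
    it are contractions for the sup norm, so the errors add up. *)
Lemma iter_average_replacement {d d'} {T : measurableType d}
    {T' : measurableType d'} {K : eqType} (P : K -> probability T R)
    (Q : K -> probability T' R) xi eta (L : K -> 'rV[R]_n)
    (v : K -> R) (m C : R) (ks : seq K) f :
  (forall k, centered_step (P k) (xi k) (v k) m) ->
  (forall k, centered_step (Q k) (eta k) (v k) m) ->
  buc f -> 0 <= C -> (forall k, k \in ks -> taylor3 (L k) C f) ->
  forall x, `|iter_average P xi L ks f x - iter_average Q eta L ks f x| <=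
    (size ks)%:R * (C * (m + m)).
Proof.
move=> sP sQ bf C0 tf.
have mxi k : measurable_fun [set: T] (xi k) by have [] := sP k.
have meta k : measurable_fun [set: T'] (eta k) by have [] := sQ k.
elim: ks tf => [|k ks IH] tf x /=; first by rewrite subrr normr0 mul0r.
have bP := buc_iter_average P L mxi ks bf.
have bQ := buc_iter_average Q L meta ks bf.
rewrite -(subrKA (average (P k) (xi k) (L k) (iter_average Q eta L ks f) x)).
rewrite -natr1 mulrDl mul1r (le_trans (ler_normD _ _))// lerD//.
  rewrite -averageB//; apply: norm_average_le => //; first exact: bucB.
  by apply: IH => k' k'ks; apply: tf; rewrite inE k'ks orbT.
apply: average_replacement (sP k) (sQ k) bQ C0 _.
apply: taylor3_iter_average => //.
by apply: tf; rewrite inE eqxx.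
Qed.

End Lindeberg.

(** * Gaussian densities and their convolution *)

Lemma normal_probN {R : realType} (m c : R) :
  normal_prob m (- c) = normal_prob m c.
Proof.
apply/funext => B; rewrite /normal_prob; apply: eq_integral => x _.
congr EFin; rewrite /normal_pdf oppr_eq0; case: ifP => // _.
by rewrite /normal_peak /normal_fun !sqrrN.
Qed.

#[local] Opaque normal_prob normal_pdf.

Section GaussianDensity.
Context {R : realType}.
Local Notation mu := (@lebesgue_measure R).
Local Notation mR := (measurableTypeR R).

Definition affine (c m z : R) : R := c * z + m.

Lemma measurable_affine c m : measurable_fun [set: mR] (affine c m : mR -> mR).
Proof. by apply: measurable_funD => //; exact: measurable_funM. Qed.

Let affine_image c m : {measure set mR -> \bar R} :=
  measure_function_pushforward__canonical__measure_function_Measure mu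
    (measurable_affine c m).

(** The rescaled image measure agrees with the Lebesgue measure on half-open
    intervals, and these determine it. *)
Lemma lebesgue_measure_affine (c m : R) (A : set R) : c != 0 -> measurable A ->
  (`|c|%:E * mu (affine c m @^-1` A))%E = mu A.
Proof.
move=> c0 mA.
pose nu := mscale (NngNum (normr_ge0 c)) (affine_image c m).
suff -> : mu A = nu A by [].
apply: lebesgue_measure_unique => // _ [[x y] _ <-].
rewrite -[RHS]/(`|c|%:E * mu (affine c m @^-1` `]x, y]))%E.
have [cn|cp] := ltP c 0.
  have -> : affine c m @^-1` `]x, y] = `[(y - m) / c, (x - m) / c[%classic.
    apply/seteqP; split=> z /=; rewrite /affine !in_itv/= -ltrBlDr -lerBrDr;
      by rewrite ler_ndivrMr// ltr_ndivlMr// [z * c]mulrC andbC.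
  rewrite !lebesgue_measure_itv/= !lte_fin ltr_nM2r ?invr_lt0// ltrD2r.
  case: ifPn => xy; last by rewrite mule0.
  by rewrite -!EFinD -EFinM; congr EFin; rewrite ltr0_norm//; field.
have {}cp : 0 < c by rewrite lt_neqAle eq_sym c0.
have -> : affine c m @^-1` `]x, y] = `](x - m) / c, (y - m) / c]%classic.
  apply/seteqP; split=> z /=; rewrite /affine !in_itv/= -ltrBlDr -lerBrDr;
    by rewrite ler_pdivlMr// ltr_pdivrMr// [z * c]mulrC.
rewrite !lebesgue_measure_itv/= !lte_fin ltr_pM2r ?invr_gt0// ltrD2r.
case: ifPn => xy; last by rewrite mule0.
by rewrite -!EFinD -EFinM; congr EFin; rewrite gtr0_norm//; field.
Qed.

Lemma ge0_integral_affine (c m : R) (F : R -> \bar R) : c != 0 ->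
  measurable_fun [set: R] F -> (forall x, 0 <= F x)%E ->
  (`|c|%:E * \int[mu]_z F (affine c m z) = \int[mu]_z F z)%E.
Proof.
move=> c0 mF F0.
pose nu := mscale (NngNum (normr_ge0 c)) (affine_image c m).
transitivity (\int[nu]_z F z)%E.
  rewrite ge0_integral_mscale//=; congr (_ * _)%E.
  by rewrite ge0_integral_pushforward//; exact: measurable_affine.
by apply: eq_measure_integral => A mA _; exact: lebesgue_measure_affine.
Qed.

Lemma normal_peakE (s : R) : normal_peak s = `|s|^-1 * (Num.sqrt (pi *+ 2))^-1.
Proof.
by rewrite /normal_peak -mulrnAr sqrtrM ?sqr_ge0// sqrtr_sqr invfM.
Qed.

Lemma normal_pdf_standard (c m z : R) : c != 0 ->
  `|c| * normal_pdf m c (affine c m z) = normal_pdf 0 1 z.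
Proof.
move=> c0; rewrite /affine !normal_pdfE ?oner_neq0// !normal_peakE normr1 invr1 mul1r.
rewrite !mulrA mulfV ?normr_eq0// mul1r; congr (_ * expR _).
by rewrite addrK subr0; field.
Qed.

(** The density equals the Radon-Nikodym derivative almost everywhere, and the
    integral against the latter is the change of variables formula. *)
Lemma ge0_integral_normal (m s : R) (f : R -> \bar R) :
  measurable_fun [set: R] f -> (forall x, 0 <= f x)%E ->
  (\int[normal_prob m s]_x f x = \int[mu]_x (f x * (normal_pdf m s x)%:E))%E.
Proof.
move=> mf f0.
have dom := normal_prob_dominates m s.
rewrite -(Radon_Nikodym_SigmaFinite.change_of_variables dom)//=.
have ip : mu.-integrable [set: mR] (fun x => (normal_pdf m s x)%:E) by exact: integrable_normal_pdf.
apply: ge0_ae_eq_integral => //.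
- apply: emeasurable_funM => //.
  exact: measurable_int (Radon_Nikodym_SigmaFinite.f_integrable dom).
- by apply: emeasurable_funM => //; exact: measurable_int ip.
- by move=> x _; rewrite mule_ge0// Radon_Nikodym_SigmaFinite.f_ge0.
- by move=> x _; rewrite mule_ge0// lee_fin normal_pdf_ge0.
apply: ae_eqe_mul2l; apply: integral_ae_eq => //.
- exact: Radon_Nikodym_SigmaFinite.f_integrable.
- exact: measurable_int ip.
- by move=> E _ mE; rewrite -Radon_Nikodym_SigmaFinite.f_integral.
Qed.

(** Both sides are Lebesgue integrals against a density, and the affine change
    of variables turns one density into the other. *)
Lemma ge0_integral_normal_affine (m c : R) (f : R -> \bar R) : c != 0 ->
  measurable_fun [set: R] f -> (forall x, 0 <= f x)%E ->
  (\int[normal_prob 0 1]_z f (affine c m z) = \int[normal_prob m c]_x f x)%E.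
Proof.
move=> c0 mf f0.
have mpdf (a b : R) : measurable_fun [set: R] (fun x => (normal_pdf a b x)%:E).
  by apply/measurable_EFinP; exact: measurable_normal_pdf.
have ma : measurable_fun [set: R] (affine c m : R -> R) := measurable_affine c m.
apply/esym; apply: (eq_trans (@ge0_integral_normal m c f mf f0)); apply/esym.
apply: (eq_trans (@ge0_integral_normal 0 1 (f \o affine c m)
  (measurableT_comp mf ma) (fun x => f0 _))).
have mF : measurable_fun [set: R] (fun x => f x * (normal_pdf m c x)%:E)%E.
  exact: emeasurable_funM.
have F0 x : (0 <= f x * (normal_pdf m c x)%:E)%E.
  by rewrite mule_ge0// lee_fin normal_pdf_ge0.
rewrite -(@ge0_integral_affine c m _ c0 mF F0).
rewrite -ge0_integralZl//; last exact: (measurableT_comp mF ma).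
by apply: eq_integral => z _ /=; rewrite muleCA -EFinM normal_pdf_standard.
Qed.

Lemma normal_prob_affine (m c : R) (B : set R) : c != 0 -> measurable B ->
  normal_prob 0 1 (affine c m @^-1` B) = normal_prob m c B.
Proof.
move=> c0 mB.
have ma : measurable_fun [set: R] (affine c m : R -> R) := measurable_affine c m.
have mBp : measurable (affine c m @^-1` B).
  by rewrite -[X in measurable X]setTI; exact: ma.
have E (P : probability mR R) (A : set R) : measurable A ->
    P A = (\int[P]_x (\1_A x)%:E)%E.
  by move=> mA; rewrite integral_indic// setIT.
transitivity (\int[normal_prob 0 1]_x (\1_(affine c m @^-1` B) x : R)%:E)%E.
  exact: (E (normal_prob 0 1)).
transitivity (\int[normal_prob m c]_x (\1_B x : R)%:E)%E; last first.
  by rewrite -(E (normal_prob m c)).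
have mi : measurable_fun [set: R] (EFin \o (\1_B : R -> R)).
  by apply/measurable_EFinP; exact: measurable_indic.
have i0 x : (0 <= (EFin \o (\1_B : R -> R)) x)%E by rewrite lee_fin.
exact: (@ge0_integral_normal_affine m c (EFin \o (\1_B : R -> R)) c0 mi i0).
Qed.

Lemma normal_prob_abs (m c : R) : normal_prob m `|c| = normal_prob m c.
Proof.
by have [c0|c0] := leP 0 c; [rewrite ger0_norm|rewrite (ltr0_norm c0) normal_probN].
Qed.

(** Completing the square in [w]. In terms of random variables, with [W] standard
    normal and [U] normal with mean [b * W], the right-hand side is the marginal
    density of [U] times the conditional density of [W] given [U]. *)
Lemma normal_pdf_convolution (a b u w : R) : a != 0 ->
  normal_pdf (b * w) a u * normal_pdf 0 1 w =
  normal_pdf 0 (Num.sqrt (a ^+ 2 + b ^+ 2)) u *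
  normal_pdf (b / (a ^+ 2 + b ^+ 2) * u) (a / Num.sqrt (a ^+ 2 + b ^+ 2)) w.
Proof.
move=> a0; set t := Num.sqrt _.
have p : 0 < a ^+ 2 + b ^+ 2.
  by rewrite ltr_pwDl ?sqr_ge0// exprn_even_gt0.
have t0 : t != 0 by rewrite gt_eqF// sqrtr_gt0.
have tE : t ^+ 2 = a ^+ 2 + b ^+ 2 by rewrite sqr_sqrtr// ltW.
have at0 : a / t != 0 by rewrite mulf_neq0// invr_eq0.
rewrite !normal_pdfE ?oner_neq0// mulrACA -expRD [RHS]mulrACA -expRD.
congr (_ * expR _).
  rewrite !normal_peakE normr1 invr1 mul1r normrM normfV invfM invrK.
  have gen (x y k : R) : y != 0 -> x * k * k = y^-1 * k * (x * y * k).
    by move=> y0; field.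
  by apply: gen; rewrite normr_eq0.
rewrite exprMn exprVn tE !subr0; field.
by rewrite a0 gt_eqF.
Qed.

End GaussianDensity.

Lemma integral_prob_cst {d} {T : measurableType d} {R : realType}
  (P : probability T R) (c : \bar R) : (\int[P]_x c)%E = c.
Proof.
rewrite [LHS](integral_cst P measurableT c) -[RHS]mule1; congr (_ * _)%E.
exact: probability_setT.
Qed.

Section GaussianConvolution.
Context {R : realType}.
Local Notation mu := (@lebesgue_measure R).
Local Notation N01 := (@normal_prob R 0 1).

Lemma normal_pdf_center (m s x : R) :
  s != 0 -> normal_pdf m s x = normal_pdf 0 s (x - m).
Proof. by move=> s0; rewrite !normal_pdfE// /normal_fun subr0. Qed.

Lemma ge0_integral_normal_scale (c : R) (f : R -> \bar R) :
  measurable_fun [set: R] f -> (forall x, 0 <= f x)%E ->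
  (\int[N01]_z f (`|c| * z)%R = \int[N01]_z f (c * z)%R)%E.
Proof.
move=> mf f0; have [->|c0] := eqVneq c 0; first by rewrite normr0.
have H a : a != 0 -> (\int[N01]_z f (a * z)%R = \int[normal_prob 0 a]_x f x)%E.
  move=> a0; rewrite -(@ge0_integral_normal_affine R 0 a f a0 mf f0).
  by apply: eq_integral => z _; rewrite /affine addr0.
rewrite (H `|c|); last by rewrite normr_eq0.
rewrite (H c c0); apply: eq_measure_integral => A _ _.
exact: (congr1 (fun P => P A) (normal_prob_abs 0 c)).
Qed.

(** By [normal_pdf_convolution] the joint density of the sum and of the second
    variable factors, and after exchanging the integrals the second factor has
    total mass one. *)
Lemma ge0_normal_convolution (a b : R) (f : R -> \bar R) :
  measurable_fun [set: R] f -> (forall x, 0 <= f x)%E ->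
  (\int[N01]_w \int[N01]_z f (a * z + b * w)%R =
   \int[N01]_z f (Num.sqrt (a ^+ 2 + b ^+ 2) * z)%R)%E.
Proof.
move=> mf f0; have [a0|a0] := eqVneq a 0.
  rewrite a0 expr0n/= add0r sqrtr_sqr ge0_integral_normal_scale//.
  apply: eq_integral => w _.
  under eq_integral do rewrite mul0r add0r.
  exact: integral_prob_cst.
set t := Num.sqrt _.
have p : 0 < a ^+ 2 + b ^+ 2.
  by rewrite ltr_pwDl ?sqr_ge0// exprn_even_gt0.
have t0 : t != 0 by rewrite gt_eqF// sqrtr_gt0.
have at0 : a / t != 0 by rewrite mulf_neq0// invr_eq0.
have mpdf (m s : R) : measurable_fun [set: R] (fun x => (normal_pdf m s x)%:E).
  by apply/measurable_EFinP; exact: measurable_normal_pdf.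
have pdf0 (m s x : R) : (0 <= (normal_pdf m s x)%:E)%E.
  by rewrite lee_fin normal_pdf_ge0.
have inner w : (\int[N01]_z f (a * z + b * w)%R =
    \int[mu]_u (f u * (normal_pdf (b * w) a u)%:E))%E.
  rewrite -(@ge0_integral_normal R (b * w) a f mf f0).
  exact: (@ge0_integral_normal_affine R (b * w) a f a0 mf f0).
pose F (q : R * R) : \bar R := (f q.1 * (normal_pdf 0 t q.1)%:E *
  (normal_pdf (b / (a ^+ 2 + b ^+ 2) * q.1) (a / t) q.2)%:E)%E.
have F0 q : (0 <= F q)%E by rewrite !mule_ge0.
have mF : measurable_fun [set: R * R] F.
  apply: emeasurable_funM.
    apply: emeasurable_funM.
      exact: (measurableT_comp mf measurable_fst).
    exact: (measurableT_comp (mpdf 0 t) measurable_fst).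
  under eq_fun do rewrite normal_pdf_center//.
  apply: (measurableT_comp (mpdf 0 (a / t))); apply: measurable_funB => //.
  exact: measurable_funM.
have FE u w : F (u, w) =
    (f u * (normal_pdf (b * w) a u)%:E * (normal_pdf 0 1 w)%:E)%E.
  by rewrite /F /= -!muleA -!EFinM (normal_pdf_convolution b u w a0).
have mG : measurable_fun [set: R]
    (fun w => \int[mu]_u (f u * (normal_pdf (b * w) a u)%:E))%E.
  have mG2 : measurable_fun [set: R * R]
      (fun q : R * R => (f q.1 * (normal_pdf (b * q.2) a q.1)%:E)%E).
    apply: emeasurable_funM; first exact: (measurableT_comp mf measurable_fst).
    under eq_fun do rewrite normal_pdf_center//.
    apply: (measurableT_comp (mpdf 0 a)); apply: measurable_funB => //.
    exact: measurable_funM.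
  apply: (@measurable_fun_fubini_tonelli_G _ _ _ _ R mu _ mG2).
  by move=> q; rewrite mule_ge0.
transitivity (\int[mu]_w \int[mu]_u F (u, w))%E.
  under eq_integral do rewrite inner.
  apply: (eq_trans (@ge0_integral_normal R 0 1 _ mG _)) => [w|].
    by apply: integral_ge0 => u _; rewrite mule_ge0.
  apply: eq_integral => w _; apply/esym.
  under eq_integral do rewrite FE.
  apply: ge0_integralZr; [exact: measurableT| | |exact: pdf0].
    by apply: emeasurable_funM; [exact: mf|exact: mpdf].
  by move=> u _; rewrite mule_ge0.
rewrite -(@fubini_tonelli _ _ _ _ R mu mu F mF F0).
transitivity (\int[mu]_u (f u * (normal_pdf 0 t u)%:E))%E.
  apply: eq_integral => u _; rewrite /F /= ge0_integralZl//.
  - by rewrite integral_normal_pdf mule1.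
  - exact: mpdf.
  - by rewrite mule_ge0.
rewrite -(@ge0_integral_normal R 0 t f mf f0).
rewrite -(@ge0_integral_normal_affine R 0 t f t0 mf f0).
by apply: eq_integral => z _; rewrite /affine addr0.
Qed.

End GaussianConvolution.

(** * Moments of the standard normal law *)

Section GaussianMoments.
Context {R : realType}.
Local Notation mu := (@lebesgue_measure R).
Local Notation N01 := (@normal_prob R 0 1).
Local Notation sqrt2pi := (Num.sqrt ((pi : R) *+ 2)).

Lemma normal_pdf_centered (s z : R) : s != 0 ->
  normal_pdf 0 s z = `|s|^-1 * sqrt2pi^-1 * expR (- (z ^+ 2 / (s ^+ 2 *+ 2))).
Proof. by move=> s0; rewrite normal_pdfE// normal_peakE /normal_fun subr0 mulNr. Qed.

Let measurable_poly (f : R -> R) : continuous f -> measurable_fun [set: R] f.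
Proof. exact: continuous_measurable_fun. Qed.

(** The function [z ^+ 4] is absorbed by half of the exponent, which leaves a
    multiple of the normal density of variance 2. *)
Lemma normal_moment4_integrable :
  N01.-integrable [set: measurableTypeR R] (EFin \o (fun z : R => z ^+ 4)).
Proof.
have mf : measurable_fun [set: R] (fun z : R => z ^+ 4) by exact: measurable_funX.
have mE : measurable_fun [set: R] (EFin \o (fun z : R => z ^+ 4)).
  exact/measurable_EFinP.
apply/integrableP; split; first exact: mE.
under eq_integral do rewrite /= ger0_norm ?exprn_even_ge0//.
have z0 (z : R) : (0%:E <= (z ^+ 4)%:E)%E by rewrite lee_fin exprn_even_ge0.
rewrite (@ge0_integral_normal R 0 1 _ mE z0).
pose s : R := Num.sqrt 2.
have s0 : 0 < s by rewrite sqrtr_gt0.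
apply: (@le_lt_trans _ _ (\int[mu]_z ((32 * s)%:E * (normal_pdf 0 s z)%:E))%E).
  apply: ge0_le_integral => //.
  - by move=> z _; apply: mule_ge0; [exact: z0|rewrite lee_fin normal_pdf_ge0].
  - apply: emeasurable_funM => //.
    by apply/measurable_EFinP; exact: measurable_normal_pdf.
  - apply: emeasurable_funM => //.
    by apply/measurable_EFinP; exact: measurable_normal_pdf.
  move=> z _; rewrite -!EFinM lee_fin !normal_pdf_centered ?oner_neq0 ?gt_eqF//.
  rewrite normr1 invr1 mul1r (gtr0_norm s0).
  have -> : z ^+ 2 / (1 ^+ 2 *+ 2) = z ^+ 2 / (s ^+ 2 *+ 2) + z ^+ 2 / (s ^+ 2 *+ 2).
    by rewrite sqr_sqrtr//; field.
  rewrite opprD expRD; set x := z ^+ 2 / (s ^+ 2 *+ 2).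
  have x0 : 0 <= x.
    by rewrite divr_ge0 ?sqr_ge0// mulrn_wge0// sqr_ge0.
  have zx : z ^+ 4 = 16 * x ^+ 2.
    by rewrite /x sqr_sqrtr//; field.
  have ex : z ^+ 4 * expR (- x) <= 32.
    rewrite expRN ler_pdivrMr ?expR_gt0// zx.
    have := expR_ge1Dxn 1 x0; rewrite (_ : 2`!%:R = 2 :> R)//; lra.
  rewrite (_ : z ^+ 4 * _ = z ^+ 4 * expR (- x) * (sqrt2pi^-1 * expR (- x))); last by ring.
  rewrite (_ : 32 * s * _ = 32 * (sqrt2pi^-1 * expR (- x))); last first.
    by rewrite -!mulrA mulVKf ?gt_eqF.
  by rewrite ler_wpM2r// mulr_ge0 ?expR_ge0// invr_ge0 sqrtr_ge0.
rewrite ge0_integralZl//.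
- by rewrite integral_normal_pdf mule1 ltry.
- by apply/measurable_EFinP; exact: measurable_normal_pdf.
- by move=> z _; rewrite lee_fin normal_pdf_ge0.
- by rewrite lee_fin mulr_ge0// ltW.
Qed.

Lemma normal_moment_integrable (f : R -> R) : continuous f ->
  (forall z, `|f z| <= 1 + z ^+ 4) ->
  N01.-integrable [set: measurableTypeR R] (EFin \o f).
Proof.
move=> cf fz.
have i1 : N01.-integrable [set: measurableTypeR R] (EFin \o (fun z : R => 1 + z ^+ 4)).
  have ic : N01.-integrable [set: measurableTypeR R] (EFin \o (fun _ : R => 1)).
    by apply: bounded_measurable_integrable; split => //; exists 1 => _; rewrite normr1.
  have := integrableD measurableT ic normal_moment4_integrable; exact.
apply: le_integrable i1 => //.
  by apply/measurable_EFinP; exact: measurable_poly.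
by move=> z _ /=; rewrite lee_fin (le_trans (fz z))// ler_norm.
Qed.

Lemma norm_le_quartic (z : R) : `|z| <= 1 + z ^+ 4.
Proof.
rewrite -[z ^+ 4](_ : `|z| ^+ 4 = _); last first.
  by rewrite -normrX ger0_norm// exprn_even_ge0.
have : 0 <= `|z| by []; set x := `|z| => x0.
have h1 := sqr_ge0 (x ^+ 2 - 2^-1); have h2 := sqr_ge0 (x - 2^-1).
rewrite (_ : x ^+ 4 = (x ^+ 2) ^+ 2); last by rewrite -exprM.
nra.
Qed.

(** The standard normal law is invariant under [z |-> - z]. *)
Lemma normal_mean0 : \int[N01]_z (z : R) = 0.
Proof.
have opp0 (x : R) : x = - x -> x = 0 by move=> h; lra.
have i1 : N01.-integrable [set: measurableTypeR R] (EFin \o (id : R -> R)).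
  by apply: normal_moment_integrable norm_le_quartic => z; exact: cvg_id.
pose phi : measurableTypeR R -> measurableTypeR R := affine (-1) 0.
have phiE (z : R) : phi z = - z by rewrite /phi /affine addr0 mulN1r.
have mphi : measurable_fun [set: measurableTypeR R] phi by exact: measurable_affine.
have i2 : N01.-integrable [set: measurableTypeR R] ((EFin \o (id : R -> R)) \o phi).
  apply: (@normal_moment_integrable (affine (-1) 0)) => z.
    apply: cvgD; last exact: cvg_cst.
    by apply: cvgM; [exact: cvg_cst|exact: cvg_id].
  by rewrite -[affine _ _ _]/(phi z) phiE normrN norm_le_quartic.
have E : (\int[N01]_z (EFin \o (id : R -> R)) z = \int[N01]_z ((EFin \o (id : R -> R)) \o phi) z)%E.
  have mid : measurable_fun [set: measurableTypeR R] (EFin \o (id : R -> R)).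
    by apply/measurable_EFinP; exact: measurable_id.
  apply: (eq_trans _ (integral_pushforward mphi mid i2 measurableT)).
  apply: eq_measure_integral => A mA _; rewrite /pushforward.
  by have := normal_prob_affine 0 (_ : (-1 : R) != 0) mA; rewrite oppr_eq0 oner_neq0 normal_probN => /(_ isT).
have : \int[N01]_z (z : R) = - \int[N01]_z (z : R).
  rewrite {1}/Rintegral E -mulN1r -RintegralZl//; congr fine.
  by apply: eq_integral => z _ /=; rewrite phiE mulN1r.
exact: opp0.
Qed.

Lemma expRN_quadratic_bounds (x : R) : 0 <= x ->
  x - x ^+ 2 <= 1 - expR (- x) <= x.
Proof.
move=> x0; have e1 := expR_ge1Dx (- x); apply/andP; split; last lra.
have e2 := expR_ge1Dx (x / 2).
have e3 : (1 + x / 2) ^+ 2 <= expR x.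
  rewrite (_ : expR x = expR (x / 2) ^+ 2); last first.
    by rewrite -expRM_natl; congr expR; field.
  rewrite lerXn2r// nnegrE; first lra.
  exact: expR_ge0.
have e4 : expR (- x) <= 1 - x + x ^+ 2.
  rewrite -(ler_pM2r (expR_gt0 x)) expRN mulVf ?gt_eqF ?expR_gt0//.
  have A0 : 0 <= 1 - x + x ^+ 2 by nra.
  rewrite (@le_trans _ _ ((1 - x + x ^+ 2) * (1 + x / 2) ^+ 2))//; last first.
    by rewrite ler_wpM2l.
  rewrite -subr_ge0 (_ : _ - 1 = x ^+ 2 / 4 + x ^+ 3 * 3 / 4 + x ^+ 4 / 4).
    by rewrite !addr_ge0 ?divr_ge0 ?mulr_ge0 ?exprn_ge0.
  by field.
lra.
Qed.

(** The integral of [expR (- c z^2)] against the standard normal law is known in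
    closed form, since the product of the densities is again Gaussian. Its
    derivative at [c = 0] gives the variance; [expRN_quadratic_bounds] and the
    fourth moment make this derivative explicit. *)
Lemma normal_variance1 : \int[N01]_z ((z : R) ^+ 2) = 1.
Proof.
have c2 : continuous (fun z : R => z ^+ 2) by exact: exprn_continuous.
have b2 (z : R) : `|z ^+ 2| <= 1 + z ^+ 4.
  rewrite ger0_norm ?sqr_ge0// (_ : z ^+ 4 = (z ^+ 2) ^+ 2); last by rewrite -exprM.
  have := sqr_ge0 z; have := sqr_ge0 (z ^+ 2 - 1); nra.
have i2 := normal_moment_integrable c2 b2.
have i4 := normal_moment4_integrable.
set s2 := \int[N01]_z _; pose s4 := \int[N01]_z ((z : R) ^+ 4).
have s20 : 0 <= s2 by apply: Rintegral_ge0 => z _; exact: sqr_ge0.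
have s40 : 0 <= s4 by apply: Rintegral_ge0 => z _; rewrite exprn_even_ge0.
(* Here [c = (1 - sg) * q] is [(sg^-2 - 1) / 2], so that [expR (- c z^2)] times
   the standard density is [sg] times the density of standard deviation [sg]. *)
have key (sg q : R) : 0 < sg -> sg < 1 -> q = (1 + sg) / (2 * sg ^+ 2) ->
    q * s2 - (1 - sg) * q ^+ 2 * s4 <= 1 <= q * s2.
  move=> sg0 sg1 qE; pose c := (1 - sg) * q.
  have q0 : 0 < q by rewrite qE divr_gt0 ?mulr_gt0 ?exprn_gt0//; lra.
  have c0 : 0 <= c by rewrite mulr_ge0// ?ltW//; lra.
  have bnd (z : R) := expRN_quadratic_bounds (mulr_ge0 c0 (sqr_ge0 z)).
  have me : measurable_fun [set: R] (fun z : R => expR (- (c * z ^+ 2))).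
    apply: measurableT_comp => //; apply: measurableT_comp => //.
    by apply: measurable_funM => //; exact: measurable_funX.
  have be : bounded_measurable (fun z : measurableTypeR R => expR (- (c * z ^+ 2))).
    split; first exact: me.
    exists 1 => z; rewrite ger0_norm ?expR_ge0// -expR0 ler_expR oppr_le0.
    by rewrite mulr_ge0 ?sqr_ge0.
  have ie := bounded_measurable_integrable N01 be.
  have Ie : \int[N01]_z expR (- (c * (z : R) ^+ 2)) = sg.
    have mE : measurable_fun [set: R] (EFin \o (fun z : R => expR (- (c * z ^+ 2)))).
      exact/measurable_EFinP.
    have E0 z : (0%:E <= (EFin \o (fun z : R => expR (- (c * z ^+ 2)))) z)%E.
      by rewrite lee_fin expR_ge0.
    rewrite /Rintegral (@ge0_integral_normal R 0 1 _ mE E0).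
    have -> : sg = fine (sg%:E * \int[mu]_z (normal_pdf 0 sg z)%:E)%E.
      by rewrite integral_normal_pdf mule1.
    have Z : (\int[mu]_z (sg%:E * (normal_pdf 0 sg z)%:E) =
        sg%:E * \int[mu]_z (normal_pdf 0 sg z)%:E)%E.
      apply: ge0_integralZl; first exact: measurableT.
      - by apply/measurable_EFinP; exact: measurable_normal_pdf.
      - by move=> z _; rewrite lee_fin normal_pdf_ge0.
      - by rewrite lee_fin ltW.
    rewrite -Z.
    congr fine; apply: eq_integral => z _ /=; rewrite -!EFinM; congr EFin.
    rewrite !normal_pdf_centered ?oner_neq0 ?gt_eqF// normr1 invr1 mul1r.
    rewrite mulrCA -expRD (gtr0_norm sg0) !mulrA mulfV ?gt_eqF// mul1r.
    congr (_ * expR _); rewrite /c qE; field.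
    by rewrite gt_eqF.
  have I1 : \int[N01]_z (1 - expR (- (c * (z : R) ^+ 2))) = 1 - sg.
    rewrite Rintegral_boundedB// ?Rintegral_prob_cst ?Ie//.
    by split => //; exists 1 => _; rewrite normr1.
  have i1e : N01.-integrable [set: measurableTypeR R]
      (EFin \o (fun z : R => 1 - expR (- (c * z ^+ 2)))).
    apply: bounded_measurable_integrable; apply: bounded_measurableB => //.
    by split => //; exists 1 => _; rewrite normr1.
  have ic2 : N01.-integrable [set: measurableTypeR R] (EFin \o (fun z : R => c * z ^+ 2)).
    have := integrableZl measurableT c i2; exact.
  have ic4 : N01.-integrable [set: measurableTypeR R] (EFin \o (fun z : R => c ^+ 2 * z ^+ 4)).
    have := integrableZl measurableT (c ^+ 2) i4; exact.
  have iB : N01.-integrable [set: measurableTypeR R]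
      (EFin \o (fun z : R => c * z ^+ 2 - c ^+ 2 * z ^+ 4)).
    have := integrableB measurableT ic2 ic4; exact.
  have up : 1 - sg <= c * s2.
    rewrite -I1 -RintegralZl//; apply: le_Rintegral => // z _.
    by have /andP[] := bnd z.
  have lo : c * s2 - c ^+ 2 * s4 <= 1 - sg.
    rewrite -I1 -[c * s2]RintegralZl// -[c ^+ 2 * s4]RintegralZl// -RintegralB//.
    apply: le_Rintegral => // z _.
    by have /andP[+ _] := bnd z; rewrite exprMn -exprM.
  have p1 : 0 < 1 - sg by lra.
  apply/andP; split; rewrite -(ler_pM2l p1) mulr1.
    by apply: le_trans lo; rewrite /c; rewrite le_eqVlt; apply/orP; left; apply/eqP; ring.
  by rewrite mulrA.
have near1 (e : R) : 0 < e -> e <= 2^-1 -> `|s2 - 1| <= e * (6 + 16 * s4).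
  move=> e0 e1; pose q := (1 + (1 - e)) / (2 * (1 - e) ^+ 2).
  have := key (1 - e) q ltac:(lra) ltac:(lra) erefl.
  rewrite subKr => /andP[k1 k2].
  have sg0 : 0 < 1 - e by lra.
  have qE : q * (2 * (1 - e) ^+ 2) = 2 - e.
    by rewrite /q mulfVK; [ring|rewrite mulf_neq0 ?expf_neq0 ?gt_eqF].
  have q1 : 1 <= q.
    rewrite -(ler_pM2r (_ : 0 < 2 * (1 - e) ^+ 2)) ?qE ?mulr_gt0 ?exprn_gt0//.
    nra.
  have q2 : q <= 1 + 6 * e.
    rewrite -(ler_pM2r (_ : 0 < 2 * (1 - e) ^+ 2)) ?qE ?mulr_gt0 ?exprn_gt0//.
    nra.
  have q4 : q <= 4 by lra.
  have qq : q ^+ 2 <= 16 by nra.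
  rewrite ler_norml; apply/andP; split.
    have : 1 <= s2 + 6 * e * s2 by nra.
    have := mulr_ge0 (ltW e0) s40.
    by have [h|h] := leP 1 s2; nra.
  have : (e * q ^+ 2) * s4 <= (e * 16) * s4 by rewrite ler_wpM2r// ler_wpM2l// ltW.
  have : s2 <= q * s2 by rewrite ler_peMl.
  nra.
apply/eqP; rewrite -subr_eq0 -normr_eq0; apply/eqP.
set x := `|s2 - 1| in near1 *.
have x0 : 0 <= x := normr_ge0 _.
have k0 : 0 < 6 + 16 * s4 by rewrite ltr_wpDr// mulr_ge0.
apply/eqP; rewrite eq_le x0 andbT leNgt; apply/negP => xp.
pose e := Num.min 2^-1 (x / (2 * (6 + 16 * s4))).
have e0 : 0 < e by rewrite lt_min invr_gt0 ltr0n/= divr_gt0// mulr_gt0.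
have := near1 e e0; rewrite ge_min lexx => /(_ isT).
apply/negP; rewrite -ltNge (@le_lt_trans _ _ (x / 2))//; last by lra.
rewrite -ler_pdivlMr// (@le_trans _ _ (x / (2 * (6 + 16 * s4))))//.
  by rewrite ge_min lexx orbT.
by rewrite invfM mulrA.
Qed.

Lemma normal_centered_step (c : R) :
  centered_step N01 (fun z : measurableTypeR R => c * z) (c ^+ 2)
    (`|c| ^+ 3 * \int[N01]_z `|z : R| ^+ 3).
Proof.
have c3 : continuous (fun z : R => `|z| ^+ 3).
  move=> z; apply: (cvg_comp (fun z : R => `|z|) (fun x : R => x ^+ 3)).
    by apply: cvg_norm; exact: cvg_id.
  exact: exprn_continuous.
have b3 (z : R) : `| `|z| ^+ 3| <= 1 + z ^+ 4.
  rewrite ger0_norm ?exprn_ge0//.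
  rewrite -[z ^+ 4](_ : `|z| ^+ 4 = _); last first.
    by rewrite -normrX ger0_norm// exprn_even_ge0.
  have : 0 <= `|z| by []; set x := `|z| => x0.
  rewrite (exprS x 3).
  have [x1|x1] := leP x 1.
    by rewrite (@le_trans _ _ 1) ?exprn_ile1// lerDl mulr_ge0// exprn_ge0.
  by rewrite (@le_trans _ _ (x * x ^+ 3)) ?lerDr// ler_peMl ?exprn_ge0// ltW.
have i1 : N01.-integrable [set: measurableTypeR R] (EFin \o (id : R -> R)).
  by apply: normal_moment_integrable norm_le_quartic => z; exact: cvg_id.
have c2 : continuous (fun z : R => z ^+ 2) by exact: exprn_continuous.
have b2 (z : R) : `|z ^+ 2| <= 1 + z ^+ 4.
  rewrite ger0_norm ?sqr_ge0// (_ : z ^+ 4 = (z ^+ 2) ^+ 2); last by rewrite -exprM.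
  have := sqr_ge0 z; have := sqr_ge0 (z ^+ 2 - 1); nra.
have i2 := normal_moment_integrable c2 b2.
have i3 := normal_moment_integrable c3 b3.
have e2 : (fun z : R => (c * z) ^+ 2) = (fun z => c ^+ 2 * z ^+ 2).
  by apply/funext => z; rewrite exprMn.
have e3 : (fun z : R => `|c * z| ^+ 3) = (fun z => `|c| ^+ 3 * `|z| ^+ 3).
  by apply/funext => z; rewrite normrM exprMn.
split.
- exact: measurable_funM.
- split; first by have := integrableZl measurableT c i1; exact.
    by rewrite e2; have := integrableZl measurableT (c ^+ 2) i2; exact.
  by rewrite e3; have := integrableZl measurableT (`|c| ^+ 3) i3; exact.
- by rewrite RintegralZl// normal_mean0 mulr0.
- by rewrite e2 RintegralZl// normal_variance1 mulr1.
- by rewrite e3 RintegralZl.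
Qed.

End GaussianMoments.

(** * Borel measurability of vectors *)

Section BorelVectors.
Context {R : realType} {n : nat}.
Implicit Types (x : 'rV[R]_n).

(** Every open set is a countable union of boxes with rational centers and
    sides, so measurability can be tested one coordinate at a time. *)
Lemma measurable_coordinates {d} {T : measurableType d} (X : T -> 'rV[R]_n) :
  (forall i, measurable_fun [set: T] (fun w => X w 0 i)) ->
  measurable_fun [set: T] (X : T -> borel_rV R n).
Proof.
move=> mX.
apply: (@measurability _ _ T (borel_rV R n) setT X (@open 'rV[R]_n) erefl).
move=> _ [U oU <-]; rewrite setTI.
pose box (c : 'rV[rat]_n * nat) : set 'rV[R]_n :=
  [set x | forall i, `|x 0 i - ratr (c.1 0 i)| < c.2.+1%:R^-1].
pose A c := if pselect (box c `<=` U) then X @^-1` box c else set0.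
rewrite (_ : X @^-1` U = \bigcup_c A c); last first.
  apply/seteqP; split => [w Uw|w [c _]]; last first.
    by rewrite /A; case: pselect => // cU; exact: cU.
  have /nbhs_ballP[e /= e0 eU] : nbhs (X w) U by exact: open_nbhs_nbhs.
  have e20 : 0 < e / 2 / 2 by rewrite !divr_gt0.
  have [m] := ltr_add_invr e20; rewrite add0r => me.
  have m0 : (0 : R) < m.+1%:R^-1 by rewrite invr_gt0.
  have /choice[q qP] i : exists q : rat, `|X w 0 i - ratr q| < m.+1%:R^-1.
    set s : R := m.+1%:R^-1 in m0 *.
    have [|q] := @rat_in_itvoo R (X w 0 i - s) (X w 0 i + s); first by lra.
    rewrite in_itv/= => /andP[q1 q2]; exists q.
    by rewrite ltr_norml; apply/andP; split; lra.
  exists (\row_i q i, m) => //; rewrite /A; case: pselect => [bU|[]].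
    by move=> i /=; rewrite mxE.
  move=> y yb; apply: eU; rewrite -ball_normE /ball_ /=.
  apply: (@le_lt_trans _ _ (e / 2)); last by lra.
  apply: norm_le_entry => [|i]; first by lra.
  have := yb i; rewrite /= mxE => yi; rewrite !mxE.
  rewrite (_ : _ - _ = (X w 0 i - ratr (q i)) - (y 0 i - ratr (q i))); last by ring.
  by rewrite (le_trans (ler_normB _ _))// ltW// (splitr (e / 2)) ltrD// (lt_trans _ me).
apply: countable_bigcupT_measurable; first exact: countableP.
move=> c; rewrite /A; case: (pselect (box c `<=` U)) => [cU|cU]; last exact: measurable0.
rewrite (_ : X @^-1` box c = \bigcap_(i in [set: 'I_n])
    (fun w => `|X w 0 i - ratr (c.1 0 i)|) @^-1` `]-oo, c.2.+1%:R^-1[%classic); last first.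
  apply/seteqP; split => w /= H i; first by move=> _; rewrite /= in_itv/=; exact: H.
  by have := H i I; rewrite /= in_itv.
apply: fin_bigcap_measurable => // i _.
rewrite -[X in measurable X]setTI.
have mN : measurable_fun [set: T] (fun w => `|X w 0 i - ratr (c.1 0 i)|).
  apply: (measurableT_comp (@normr_measurable R setT)).
  exact: measurable_funB.
exact: mN.
Qed.

Lemma continuous_borel_measurable (f : 'rV[R]_n -> R) : continuous f ->
  measurable_fun [set: borel_rV R n] (f : borel_rV R n -> R).
Proof.
move=> /continuousP cf.
apply: (measurability _ (RGenOpens.measurableE R)) => _ [_ [a [b ->]] <-].
rewrite setTI; apply: sub_sigma_algebra; apply: cf; exact: interval_open.
Qed.

Lemma measurable_coordinate i :
  measurable_fun [set: borel_rV R n] (fun x : borel_rV R n => (x : 'rV[R]_n) 0 i).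
Proof.
apply: (@continuous_borel_measurable (fun x => x 0 i)); exact: coord_continuous.
Qed.

End BorelVectors.

(** * Gaussian vectors *)

Section IteratedIntegral.
Context {d} {T : measurableType d} {R : realType} (P : probability T R)
  {K X : Type} (step : K -> T -> X -> X).

(** The expectation of [f] after a chain of independent random steps. It takes
    extended-real values so that nonnegative measurable functions, and not only
    bounded ones, can be integrated by Tonelli. *)
Definition iter_integral (ks : seq K) (f : X -> \bar R) : X -> \bar R :=
  foldr (fun k g x => \int[P]_w g (step k w x))%E f ks.

Lemma iter_integral_ge0 ks f : (forall x, 0 <= f x)%E ->
  forall x, (0 <= iter_integral ks f x)%E.
Proof.
by move=> f0; elim: ks => //= k ks IH x; apply: integral_ge0 => w _; exact: IH.
Qed.

End IteratedIntegral.

Section IteratedAverage.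
Context {d} {T : measurableType d} {R : realType} (P : probability T R)
  {n : nat} {K : eqType} (xi : K -> T -> R) (L : K -> 'rV[R]_n).
Hypothesis mxi : forall k, measurable_fun [set: T] (xi k).

Definition translation (k : K) (w : T) (x : 'rV[R]_n) : 'rV[R]_n := x + xi k w *: L k.

Lemma iter_integral_average ks f x : buc f -> 
  iter_integral P translation ks (EFin \o f) x =
  (iter_average (fun=> P) xi L ks f x)%:E.
Proof.
move=> bf; elim: ks x => //= k ks IH x; under eq_integral do rewrite IH.
rewrite /average /Rintegral fineK//; apply: (@integrable_fin_num _ _ _ P) => //.
apply: bounded_measurable_integrable.
by apply: bounded_measurable_shift => //; exact: buc_iter_average.
Qed.

End IteratedAverage.

Section GaussianVector.
Context {R : realType} {n : nat}.
Local Notation mR := (measurableTypeR R).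
Local Notation N01 := (@normal_prob R 0 1).
Implicit Types (L : seq 'rV[R]_n) (a x m : 'rV[R]_n).

Definition gaussian_integral L := iter_integral N01
  (translation (fun (_ : 'rV[R]_n) (z : mR) => z) (@id 'rV[R]_n)) L.

Lemma measurable_shift x : measurable_fun [set: borel_rV R n]
  ((fun y => x + y) : borel_rV R n -> borel_rV R n).
Proof.
apply: measurable_coordinates => i; under eq_fun do rewrite mxE.
by apply: measurable_funD => //; exact: measurable_coordinate.
Qed.

(** The law of a sum of independent Gaussian vectors carried by the lines
    spanned by [L], built by adding one direction at a time. *)
Lemma gaussian_sum_exists L : exists Q : probability (borel_rV R n) R,
  forall f : borel_rV R n -> \bar R,
    measurable_fun [set: borel_rV R n] f -> (forall x, 0 <= f x)%E ->
    forall x, (\int[Q]_y f (x + y)%R = gaussian_integral L f x)%E.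
Proof.
elim: L => [|l L [Q HQ]].
  exists (@dirac _ _ (0 : borel_rV R n) R) => f mf f0 x.
  rewrite integral_dirac//; last exact: (measurableT_comp mf (measurable_shift x)).
  by rewrite diracT mul1e addr0.
pose X (p : mR * borel_rV R n) : borel_rV R n := (p.2 : 'rV[R]_n) + p.1 *: l.
have mX : measurable_fun [set: mR * borel_rV R n] X.
  apply: measurable_coordinates => i; rewrite /X; under eq_fun do rewrite !mxE.
  apply: measurable_funD.
    exact: (measurableT_comp (measurable_coordinate i) measurable_snd).
  by apply: measurable_funM => //; exact: measurable_fst.
exists (distribution (N01 \x Q)%E (mfun_Sub (mem_set mX))) => f mf f0 x.
have mfx := measurableT_comp mf (measurable_shift x).
rewrite ge0_integral_distribution//.
rewrite (fubini_tonelli1 (fun p => f (x + X p)) (measurableT_comp mfx mX))//.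
apply: eq_integral => z _; rewrite /fubini_F.
apply: (eq_trans _ (HQ f mf f0 (x + z *: l))); apply: eq_integral => y _.
have E (u v : 'rV[R]_n) : x + (v + u) = x + u + v by rewrite addrA addrAC.
exact: (congr1 f (E _ _)).
Qed.

(** By [ge0_normal_convolution], each direction adds the square of its component
    along [a] to the variance of the linear form. *)
Lemma gaussian_integral_dot L a (h : R -> \bar R) x :
  measurable_fun [set: R] h -> (forall u, 0 <= h u)%E ->
  (gaussian_integral L (fun y => h (dot a y)) x =
  \int[N01]_z h (Num.sqrt (\sum_(l <- L) dot a l ^+ 2) * z + dot a x)%R)%E.
Proof.
move=> mh h0; elim: L x => [|l L IH] x.
  rewrite big_nil sqrtr0; under eq_integral do rewrite mul0r add0r.
  by rewrite integral_prob_cst.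
rewrite /gaussian_integral/=.
under eq_integral => z _ do
  rewrite -[iter_integral _ _ _ _ _]/(gaussian_integral _ _ _) IH /translation dotDr dotZr.
have mhx : measurable_fun [set: R] (fun u : R => h (u + dot a x)).
  by apply: (measurableT_comp mh); exact: measurable_funD.
have := ge0_normal_convolution (Num.sqrt (\sum_(l <- L) dot a l ^+ 2)) (dot a l)
  mhx (fun u => h0 _).
rewrite sqr_sqrtr ?sumr_ge0// => [E|i _]; last exact: sqr_ge0.
rewrite big_cons [_ ^+ 2 + _]addrC -E; apply: eq_integral => w _.
by apply: eq_integral => z _; rewrite (mulrC w) addrA (addrAC _ (dot a x)).
Qed.

Lemma outer_sum_form L a :
  (a *m (\sum_(l <- L) l^T *m l) *m a^T) 0 0 = \sum_(l <- L) dot a l ^+ 2.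
Proof.
rewrite mulmx_sumr mulmx_suml summxE; apply: eq_bigr => l _.
rewrite mulmx_outer -scalemxAl mxE expr2 [in LHS]mxE; congr (_ * _).
  by apply: eq_bigr => i _; rewrite mulrC.
by apply: eq_bigr => i _; rewrite mxE mulrC.
Qed.

(** The law of a linear form follows from [gaussian_integral_dot] applied to an
    indicator function; when the variance is zero the integrand is constant. *)
Lemma gaussian_vector L m : exists2 G : probability (borel_rV R n) R,
  is_gaussian G m (\sum_(l <- L) l^T *m l) &
  forall f : borel_rV R n -> \bar R,
    measurable_fun [set: borel_rV R n] f -> (forall x, 0 <= f x)%E ->
    (\int[G]_y f y = gaussian_integral L f m)%E.
Proof.
have [Q HQ] := gaussian_sum_exists L.
pose G := distribution Q (mfun_Sub (mem_set (measurable_shift m))).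
have HG (f : borel_rV R n -> \bar R) :
    measurable_fun [set: borel_rV R n] f -> (forall x, 0 <= f x)%E ->
    (\int[G]_y f y = gaussian_integral L f m)%E.
  by move=> mf f0; rewrite ge0_integral_distribution// -HQ.
exists G => // a B mB var; rewrite {}/var outer_sum_form.
set s2 := \sum_(_ <- _) _.
have s20 : 0 <= s2 by apply: sumr_ge0 => l _; exact: sqr_ge0.
have mD : measurable_fun [set: borel_rV R n] (fun y : borel_rV R n => dot a y).
  apply: measurable_sum => i; apply: measurable_funM => //.
  exact: measurable_coordinate.
have mI : measurable_fun [set: R] (fun u : R => (\1_B u : R)%:E).
  by apply/measurable_EFinP.
have mDB : measurable ([set x : 'rV[R]_n | B (dot a x)] : set (borel_rV R n)).
  by rewrite -[X in measurable X]setTI; exact: mD.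
transitivity (\int[G]_x (\1_B (dot a x) : R)%:E)%E.
  apply/esym; apply: (eq_trans (integral_indic G measurableT mDB)).
  by rewrite setIT.
rewrite HG; last 2 first.
- exact: (measurableT_comp mI mD).
- by move=> x; rewrite lee_fin.
rewrite (@gaussian_integral_dot L a (fun u => (\1_B u : R)%:E))//.
case: ifPn => [/eqP s0|s0].
  rewrite -/s2 s0 sqrtr0; under eq_integral do rewrite mul0r add0r.
  by rewrite integral_prob_cst.
have t0 : Num.sqrt s2 != 0 by rewrite sqrtr_eq0 -ltNge lt_def s0.
rewrite (@ge0_integral_normal_affine R (dot a m) (Num.sqrt s2) (fun u => (\1_B u : R)%:E) t0)//.
by rewrite integral_indic// setIT.
Qed.

End GaussianVector.

(** * Independent counts *)

Section CountableGluing.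
Context {d} {T : measurableType d} {R : realType} (P : probability T R)
  (N : T -> nat) (mN : measurable_fun [set: T] N).

Lemma measurable_fiber (j : nat) : measurable (N @^-1` [set j]).
Proof. by rewrite -[X in measurable X]setTI; exact: mN. Qed.

(** A random quantity that selects among countably many measurable functions is
    measurable; this is what makes arbitrary functions of counts measurable. *)
Lemma measurable_glue (F : nat -> T -> \bar R) :
  (forall j, measurable_fun [set: T] (F j)) ->
  measurable_fun [set: T] (fun w => F (N w) w).
Proof.
move=> mF _ B mB; rewrite setTI.
rewrite (_ : _ @^-1` B = \bigcup_j (N @^-1` [set j] `&` F j @^-1` B)); last first.
  by apply/seteqP; split => [w Bw|w [j _ [/= <-]]]; first by exists (N w).
apply: bigcupT_measurable => j; apply: measurableI; first exact: measurable_fiber.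
by rewrite -[X in measurable X]setTI; exact: mF.
Qed.

Lemma ge0_integral_fibers (D : set T) (F : nat -> T -> \bar R) : measurable D ->
  (forall j, measurable_fun [set: T] (F j)) -> (forall j w, 0 <= F j w)%E ->
  (\int[P]_(w in D) F (N w) w =
   \sum_(j <oo) \int[P]_(w in D `&` N @^-1` [set j]) F j w)%E.
Proof.
move=> mD mF F0; pose E j := D `&` N @^-1` [set j].
have DE : D = \bigcup_j E j.
  by apply/seteqP; split => [w Dw|w [j _ []]]//; exists (N w).
rewrite {1}DE ge0_integral_bigcup//.
- apply: eq_eseriesr => j _; apply: eq_integral => w.
  by move=> /set_mem[_ /= ->].
- by move=> j; apply: measurableI => //; exact: measurable_fiber.
- by apply: measurable_funTS; exact: measurable_glue.
- by move=> i j _ _ [w [[_ /= <-] [_ /= <-]]].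
Qed.

Lemma ge0_integral_count (F : nat -> \bar R) : (forall j, 0 <= F j)%E ->
  (\int[P]_w F (N w) = \sum_(j <oo) (F j * P (N @^-1` [set j])))%E.
Proof.
move=> F0; rewrite (@ge0_integral_fibers setT (fun j _ => F j))//.
apply: eq_eseriesr => j _; rewrite integral_cst ?setTI//.
exact: measurable_fiber.
Qed.

End CountableGluing.

Section IndependentCounts.
Context {d} {T : measurableType d} {R : realType} (P : probability T R)
  {I : eqType} (V : I -> T -> nat) {X : Type} (step : I -> nat -> X -> X).
Hypothesis mV : forall i, measurable_fun [set: T] (V i).
Hypothesis iV : mutually_independent P V.

Definition run (s : seq I) (w : T) (x : X) : X :=
  foldl (fun y i => step i (V i w) y) x s.

Lemma measurable_run s (f : X -> \bar R) x :
  measurable_fun [set: T] (fun w => f (run s w x)).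
Proof.
elim: s x => [|i s IH] x; first by rewrite /run /=; exact: measurable_cst.
exact: (@measurable_glue _ _ _ _ (mV i) (fun j w => f (run s w (step i j x)))).
Qed.

Let event (e : seq I) (A : I -> set nat) := \bigcap_(i in [set` e]) V i @^-1` A i.

Let event_cons e A i j : i \notin e ->
  event e A `&` V i @^-1` [set j] =
  event (i :: e) (fun i' => if i' == i then [set j] else A i').
Proof.
move=> ie; apply/seteqP; split => [w [Ew Vw] i'|w Ew].
  rewrite /= inE; case: eqP => [-> _|_ /= i'e]; [exact: Vw|exact: Ew].
split.
  move=> i' /= i'e; have := Ew i'; rewrite /= inE i'e orbT => /(_ isT).
  by case: eqP => // i'i; rewrite -i'i i'e in ie.
by have := Ew i; rewrite /= inE eqxx => /(_ isT).
Qed.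

Let measurable_event e A : measurable (event e A).
Proof.
apply: fin_bigcap_measurable => // i _.
by rewrite -[X in measurable X]setTI; exact: mV.
Qed.

Let event_prob e A i j : uniq (i :: e) ->
  P (event e A `&` V i @^-1` [set j]) = (P (event e A) * P (V i @^-1` [set j]))%E.
Proof.
move=> ue; have /andP[ie ue'] := ue.
rewrite event_cons// /event !iV// big_cons eqxx muleC EFinM fineK; last first.
  by apply: fin_num_measure; exact: measurable_fiber.
congr (_ * _%:E)%E; apply: eq_big_seq => i' i'e.
by case: eqP => // i'i; rewrite -i'i i'e in ie.
Qed.

(* The induction carries an event on counts that do not occur in [s]: splitting
   over the values [j] of the first count adds the event that it equals [j],
   and the product rule factors its probability out. *)
Let independent_iter_event (f : X -> \bar R) s e A x : (forall y, 0 <= f y)%E ->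
  uniq (s ++ e) -> (\int[P]_(w in event e A) f (run s w x) =
  P (event e A) * iter_integral P (fun i w => step i (V i w)) s f x)%E.
Proof.
move=> f0; elim: s e A x => [|i s IH] e A x ue /=.
  by rewrite integral_cst// muleC.
have ie : i \notin e.
  by move: ue; rewrite /= mem_cat negb_or => /andP[/andP[]].
have ue' : uniq (i :: e).
  by rewrite /= ie; move: ue; rewrite /= cat_uniq => /andP[_ /and3P[]].
have ue'' : uniq (s ++ i :: e).
  by rewrite -(cat1s i e) uniq_catCA.
rewrite (@ge0_integral_fibers _ _ _ P _ (mV i) (event e A)
  (fun j w => f (run s w (step i j x))))//; last first.
  by move=> j; exact: measurable_run.
under eq_eseriesr => j _.
  rewrite event_cons// IH// -event_cons// event_prob//.
  rewrite -muleA (muleC (P (V i @^-1` _))).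
  over.
rewrite /= -(fineK (fin_num_measure P _ (measurable_event e A))) nneseriesZl.
  congr (_ * _)%E; apply/esym.
  apply: (@ge0_integral_count _ _ _ P _ (mV i)
    (fun j => iter_integral P (fun i w => step i (V i w)) s f (step i j x))).
  by move=> j; exact: iter_integral_ge0.
by move=> j _; apply: mule_ge0 => //; exact: iter_integral_ge0.
Qed.

(** The special case of the sure event, that is, of no condition on the counts. *)
Lemma independent_iter_integral (f : X -> \bar R) s x : (forall y, 0 <= f y)%E ->
  uniq s -> (\int[P]_w f (run s w x) =
  iter_integral P (fun i w => step i (V i w)) s f x)%E.
Proof.
move=> f0 us; have := @independent_iter_event f s [::] (fun=> setT) x f0.
rewrite cats0 => /(_ us); rewrite /event set_nil bigcap_set0 => ->.
by rewrite -[RHS]mul1e; congr (_ * _)%E; exact: probability_setT.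
Qed.

End IndependentCounts.

(** * Moments of the Poisson law *)

Section PoissonMoments.
Context {d} {T : measurableType d} {R : realType} (P : probability T R)
  (N : T -> nat) (v : R).
Hypothesis mN : measurable_fun [set: T] N.
Hypothesis v0 : 0 < v.
Hypothesis poissonN : forall A : set nat, P (N @^-1` A) = poisson_prob v 0 A.

Let fiber (j : nat) : P (N @^-1` [set j]) = (poisson_pmf v j)%:E.
Proof. by rewrite poissonN /poisson_prob v0 esum_set1// lee_fin poisson_pmf_ge0. Qed.

Lemma ge0_integral_poisson (F : nat -> \bar R) : (forall j, 0 <= F j)%E ->
  (\int[P]_w F (N w) = \sum_(j <oo) F j * (poisson_pmf v j)%:E)%E.
Proof.
move=> F0; rewrite (ge0_integral_count P mN F0).
by apply: eq_eseriesr => j _; rewrite fiber.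
Qed.

(** Termwise, [j] times the mass of [j] is [v] times the mass of [j - 1]. With
    [g] a power this expresses each moment by lower ones. *)
Lemma poisson_stein (g : nat -> R) : (forall j, 0 <= g j) ->
  (\int[P]_w ((N w)%:R * g (N w))%:E = v%:E * \int[P]_w (g (N w).+1)%:E)%E.
Proof.
move=> g0.
rewrite (@ge0_integral_poisson (fun j => (j%:R * g j)%:E)); last first.
  by move=> j; rewrite lee_fin mulr_ge0.
rewrite (@ge0_integral_poisson (fun j => (g j.+1)%:E)); last first.
  by move=> j; rewrite lee_fin.
rewrite -nneseriesZl; last by move=> j _; rewrite -EFinM lee_fin mulr_ge0// poisson_pmf_ge0.
rewrite nneseries_recl//; last first.
  by move=> j _; rewrite -EFinM lee_fin !mulr_ge0// poisson_pmf_ge0.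
rewrite mul0r mul0e add0e -(nneseries_addn 1); last first.
  by move=> j; rewrite -EFinM lee_fin !mulr_ge0// poisson_pmf_ge0.
apply: eq_eseriesr => j _; rewrite addn1 -!EFinM; congr EFin.
rewrite /poisson_pmf v0 factS natrM exprS invfM.
have j0 : (j.+1%:R : R) != 0 by rewrite pnatr_eq0.
by move: j0; set a : R := j.+1%:R; set f : R := (j`!)%:R^-1; move: a f => a f a0; field.
Qed.

Let mF (F : nat -> R) : measurable_fun [set: T] (F \o N).
Proof. by apply: measurableT_comp. Qed.

Let mE (F : nat -> R) : measurable_fun [set: T] (fun w => (F (N w))%:E).
Proof. exact/measurable_EFinP/mF. Qed.

Let int1 : (\int[P]_w 1%:E = 1 :> \bar R)%E.
Proof. exact: integral_prob_cst. Qed.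

Let intD (F G : nat -> R) : (forall j, 0 <= F j) -> (forall j, 0 <= G j) ->
  (\int[P]_w (F (N w) + G (N w))%:E =
   \int[P]_w (F (N w))%:E + \int[P]_w (G (N w))%:E)%E.
Proof.
move=> F0 G0; under eq_integral do rewrite EFinD.
by rewrite ge0_integralD// => w _; rewrite lee_fin.
Qed.

Let moment1 : (\int[P]_w ((N w)%:R)%:E = v%:E)%E.
Proof.
have := @poisson_stein (fun=> 1) (fun=> ler01); rewrite int1 mule1 => <-.
by apply: eq_integral => w _; rewrite mulr1.
Qed.

Let moment2 : (\int[P]_w ((N w)%:R ^+ 2)%:E = (v * (v + 1))%:E)%E.
Proof.
under eq_integral do rewrite expr2.
rewrite (@poisson_stein (fun j => j%:R))//.
under eq_integral do rewrite -natr1.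
by rewrite (@intD (fun j => j%:R) (fun=> 1))// moment1 int1 -EFinD.
Qed.

Let moment3 : (\int[P]_w ((N w)%:R ^+ 3)%:E < +oo)%E.
Proof.
under eq_integral do rewrite exprS.
rewrite (@poisson_stein (fun j => j%:R ^+ 2)); last by move=> j; rewrite exprn_ge0.
have E w : (((N w).+1%:R ^+ 2)%:E = ((N w)%:R ^+ 2 + ((N w)%:R + ((N w)%:R + 1)))%:E :> \bar R)%E.
  by congr EFin; rewrite -natr1; ring.
under eq_integral do rewrite E.
rewrite (@intD (fun j => j%:R ^+ 2) (fun j => j%:R + (j%:R + 1)));
  try by move=> j; rewrite ?addr_ge0 ?exprn_ge0.
rewrite moment2 (@intD (fun j => j%:R) (fun j => j%:R + 1));
  try by move=> j; rewrite ?addr_ge0.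
rewrite (@intD (fun j => j%:R) (fun=> 1))// moment1 int1.
by rewrite -!EFinD -EFinM ltry.
Qed.

Lemma poisson_integrable (F : nat -> R) (a b : R) : 
  (forall j, `|F j| <= a * j%:R ^+ 3 + b) ->
  P.-integrable [set: T] (EFin \o (F \o N)).
Proof.
move=> Fab.
have i3 : P.-integrable [set: T] (EFin \o (fun w => (N w)%:R ^+ 3)).
  apply/integrableP; split; first exact: (mE (fun j => j%:R ^+ 3)).
  rewrite (eq_integral (fun w => ((N w)%:R ^+ 3)%:E)) => [//|w _].
  by rewrite /= ger0_norm ?exprn_ge0.
have ic : P.-integrable [set: T] (EFin \o (fun _ : T => b)).
  by apply: bounded_measurable_integrable; split => //; exists `|b|.
have i3a : P.-integrable [set: T] (EFin \o (fun w => a * (N w)%:R ^+ 3)).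
  have := integrableZl measurableT a i3; exact.
have iab : P.-integrable [set: T] (EFin \o (fun w => a * (N w)%:R ^+ 3 + b)).
  have := integrableD measurableT i3a ic; exact.
apply: le_integrable iab => //; first exact: mE.
by move=> w _ /=; rewrite lee_fin (le_trans (Fab _))// ler_norm.
Qed.

Lemma poisson_centered_step (h : R) :
  centered_step P (fun w => h * ((N w)%:R - v)) (h ^+ 2 * v)
    (`|h| ^+ 3 * \int[P]_w `|(N w)%:R - v| ^+ 3).
Proof.
have nat1 (j : nat) : (j%:R : R) <= j%:R ^+ 3.
  by case: j => [|j]; rewrite ?exprn_ge0// ler_eXnr// ler1n.
have nat2 (j : nat) : (j%:R : R) ^+ 2 <= j%:R ^+ 3.
  by case: j => [|j]; [rewrite !expr0n|rewrite ler_weXn2l// ler1n].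
have i1 : P.-integrable [set: T] (EFin \o (fun w => (N w)%:R)).
  by apply: (@poisson_integrable (fun j => j%:R) 1 0) => j; rewrite mul1r addr0 ger0_norm.
have i2 : P.-integrable [set: T] (EFin \o (fun w => (N w)%:R ^+ 2)).
  by apply: (@poisson_integrable (fun j => j%:R ^+ 2) 1 0) => j; rewrite mul1r addr0 ger0_norm// exprn_ge0.
have ic1 : P.-integrable [set: T] (EFin \o (fun w => (N w)%:R - v)).
  apply: (@poisson_integrable (fun j => j%:R - v) 1 v) => j.
  rewrite mul1r (le_trans (ler_normB _ _))// lerD//; last by rewrite gtr0_norm.
  by rewrite ger0_norm.
have ic2 : P.-integrable [set: T] (EFin \o (fun w => ((N w)%:R - v) ^+ 2)).
  apply: (@poisson_integrable (fun j => (j%:R - v) ^+ 2) 2 (2 * v ^+ 2)) => j.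
  rewrite ger0_norm ?sqr_ge0//; have := nat2 j.
  have := sqr_ge0 ((j%:R : R) + v); nra.
have ic3 : P.-integrable [set: T] (EFin \o (fun w => `|(N w)%:R - v| ^+ 3)).
  apply: (@poisson_integrable (fun j => `|j%:R - v| ^+ 3) 4 (4 * v ^+ 3)) => j.
  rewrite ger0_norm ?exprn_ge0//.
  have : `|j%:R - v| <= j%:R + v.
    by rewrite (le_trans (ler_normB _ _))// (gtr0_norm v0) ger0_norm.
  have : 0 <= `|j%:R - v| by []; have : (0 : R) <= j%:R by [].
  set a : R := j%:R; set y := `|_| => a0 y0 ya.
  apply: (@le_trans _ _ ((a + v) ^+ 3)); first by rewrite lerXn2r// nnegrE addr_ge0// ltW.
  rewrite -subr_ge0 (_ : _ - _ = 3 * (a + v) * (a - v) ^+ 2); last by ring.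
  by rewrite mulr_ge0 ?sqr_ge0// mulr_ge0// addr_ge0// ltW.
have e2 : (fun w => (h * ((N w)%:R - v)) ^+ 2) = (fun w => h ^+ 2 * ((N w)%:R - v) ^+ 2).
  by apply/funext => w; rewrite exprMn.
have e3 : (fun w => `|h * ((N w)%:R - v)| ^+ 3) = (fun w => `|h| ^+ 3 * `|(N w)%:R - v| ^+ 3).
  by apply/funext => w; rewrite normrM exprMn.
have E1 : \int[P]_w (N w)%:R = v by rewrite /Rintegral moment1.
have E2 : \int[P]_w ((N w)%:R ^+ 2) = v * (v + 1) by rewrite /Rintegral moment2.
have C1 : \int[P]_w ((N w)%:R - v) = 0.
  have icst : P.-integrable [set: T] (EFin \o (fun _ : T => v)).
    by apply: bounded_measurable_integrable; split => //; exists `|v|.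
  by rewrite RintegralB// E1 Rintegral_prob_cst subrr.
split.
- exact: (mF (fun j => h * (j%:R - v))).
- split; first by have := integrableZl measurableT h ic1; exact.
    by rewrite e2; have := integrableZl measurableT (h ^+ 2) ic2; exact.
  by rewrite e3; have := integrableZl measurableT (`|h| ^+ 3) ic3; exact.
- by rewrite RintegralZl// C1 mulr0.
- rewrite e2 RintegralZl//; congr (_ * _).
  rewrite (_ : \int[P]_w _ = \int[P]_w ((N w)%:R ^+ 2 - 2 * v * ((N w)%:R - v) - v ^+ 2)); last first.
    by apply: eq_Rintegral => w _; ring.
  have icc : P.-integrable [set: T] (EFin \o (fun _ : T => v ^+ 2)).
    by apply: bounded_measurable_integrable; split => //; exists `|v ^+ 2|.
  have icv : P.-integrable [set: T] (EFin \o (fun w => 2 * v * ((N w)%:R - v))).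
    have := integrableZl measurableT (2 * v) ic1; exact.
  have icm : P.-integrable [set: T] (EFin \o (fun w => (N w)%:R ^+ 2 - 2 * v * ((N w)%:R - v))).
    have := integrableB measurableT i2 icv; exact.
  rewrite RintegralB// RintegralB// RintegralZl// C1 E2 Rintegral_prob_cst; ring.
- by rewrite e3 RintegralZl.
Qed.

End PoissonMoments.

(** * Merging Gaussian averages *)

Section AverageIdentities.
Context {R : realType} {n : nat}.
Local Notation mR := (measurableTypeR R).
Local Notation N01 := (@normal_prob R 0 1).
Implicit Types (f g : 'rV[R]_n -> R) (x L : 'rV[R]_n).

Lemma bucD_cst f (c : R) : buc f -> buc (fun x => f x + c).
Proof.
move=> [[C fC] fu]; split.
  by exists (C + `|c|) => x; rewrite (le_trans (ler_normD _ _))// lerD.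
move=> e /fu[dl dl0 fd]; exists dl => // x y /fd.
by rewrite opprD addrACA subrr addr0.
Qed.

Lemma averageD_cst {d} {T : measurableType d} (P : probability T R) (xi : T -> R)
    L f c x : measurable_fun [set: T] xi -> buc f ->
  average P xi L (fun y => f y + c) x = average P xi L f x + c.
Proof.
move=> mxi bf; rewrite /average.
have E w : f (x + xi w *: L) + c = f (x + xi w *: L) - - c by rewrite opprK.
under eq_Rintegral do rewrite E.
rewrite Rintegral_boundedB ?Rintegral_prob_cst ?opprK//.
  exact: bounded_measurable_shift.
by split => //; exists `|- c|.
Qed.

Lemma iter_averageD_cst {d} {T : measurableType d} {K : eqType}
    (P : K -> probability T R) (xi : K -> T -> R) (L : K -> 'rV[R]_n) ks f (c : R) x :
  (forall k, measurable_fun [set: T] (xi k)) -> buc f ->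
  iter_average P xi L ks (fun y => f y + c) x = iter_average P xi L ks f x + c.
Proof.
move=> mxi bf; elim: ks x => //= k ks IH x.
rewrite -averageD_cst//; last exact: buc_iter_average.
by apply: eq_Rintegral => w _; exact: IH.
Qed.

Lemma RintegralD_cst {d} {T : measurableType d} (P : probability T R) (h : T -> R)
    c : bounded_measurable h -> \int[P]_w (h w + c) = \int[P]_w h w + c.
Proof.
move=> bh; have E w : h w + c = h w - - c by rewrite opprK.
under eq_Rintegral do rewrite E.
rewrite Rintegral_boundedB ?Rintegral_prob_cst ?opprK//.
by split => //; exists `|- c|.
Qed.

(** Two functionals that commute with the addition of constants agree as soon
    as they agree on nonnegative functions, where extended-real integration
    applies. *)
Lemma agree_ge0 (A B : ('rV[R]_n -> R) -> R) :
  (forall f c, buc f -> A (fun y => f y + c) = A f + c) ->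
  (forall f c, buc f -> B (fun y => f y + c) = B f + c) ->
  (forall f, buc f -> (forall x, 0 <= f x) -> A f = B f) ->
  forall f, buc f -> A f = B f.
Proof.
move=> AD BD AB f bf; have [[C fC] _] := bf.
apply: (@addIr _ C); rewrite -AD// -BD//; apply: AB; first exact: bucD_cst.
by move=> x; have := fC x; rewrite ler_norml => /andP[]; lra.
Qed.

Lemma average_EFin {d} {T : measurableType d} (P : probability T R) (xi : T -> R)
    L f x : measurable_fun [set: T] xi -> buc f ->
  ((average P xi L f x)%:E = \int[P]_w (f (x + xi w *: L)%R)%:E)%E.
Proof.
move=> mxi bf; rewrite /average /Rintegral fineK//.
apply: (@integrable_fin_num _ _ _ P) => //.
by apply: bounded_measurable_integrable; exact: bounded_measurable_shift.
Qed.

Let mscale (c : R) : measurable_fun [set: mR] (fun z : mR => c * z : R).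
Proof. exact: measurable_funM. Qed.

(** Two successive Gaussian translations along one line make a single one whose
    variance is the sum, by [ge0_normal_convolution]. *)
Lemma average_normal_add (a b : R) L f x : buc f ->
  average N01 (fun z : mR => a * z) L (average N01 (fun z : mR => b * z) L f) x =
  average N01 (fun z : mR => Num.sqrt (a ^+ 2 + b ^+ 2) * z) L f x.
Proof.
pose Aa g := average N01 (fun z : mR => a * z) L g.
pose Ab g := average N01 (fun z : mR => b * z) L g.
pose Ac g := average N01 (fun z : mR => Num.sqrt (a ^+ 2 + b ^+ 2) * z) L g.
move=> bf; apply: (@agree_ge0 (fun g => Aa (Ab g) x) (fun g => Ac g x)) bf.
- move=> g c bg; rewrite /Aa -averageD_cst//; last exact: buc_average.
  by congr average; apply/funext => y; rewrite -averageD_cst.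
- by move=> g c bg; rewrite /Ac averageD_cst.
move=> g bg g0; apply: EFin_inj; rewrite /Aa /Ac !average_EFin//; last exact: buc_average.
under eq_integral do rewrite /Ab average_EFin//.
pose F (u : R) := (g (x + u *: L))%:E.
have mF : measurable_fun [set: R] F.
  by apply/measurable_EFinP; apply: continuous_measurable_fun; exact: buc_continuous_line.
have := ge0_normal_convolution b a mF (fun u => _ : (0 <= F u)%E).
rewrite addrC => <- => [|u]; last by rewrite lee_fin.
by apply: eq_integral => w _; apply: eq_integral => z _; rewrite /F [(b * z + _)%R]addrC scalerDl addrA.
Qed.

Lemma average_scale0 {d} {T : measurableType d} (P : probability T R) (xi : T -> R)
  L f x : average P (fun w => 0 * xi w) L f x = f x.
Proof.
rewrite /average; under eq_Rintegral do rewrite mul0r scale0r addr0.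
exact: Rintegral_prob_cst.
Qed.

(** Variances add: the [size s] equal Gaussian summands carried by each direction
    merge into one by [average_normal_add]. *)
Lemma iter_average_normal_merge (K : eqType) (c : K -> R) (L : K -> 'rV[R]_n)
    (ks : seq K) (s : seq nat) f x : buc f ->
  iter_average (fun=> N01) (fun (b : nat * K) (z : mR) => c b.2 * z) (L \o snd)
    [seq (i, k) | k <- ks, i <- s] f x =
  iter_average (fun=> N01)
    (fun k (z : mR) => Num.sqrt ((size s)%:R * c k ^+ 2) * z) L ks f x.
Proof.
move=> bf; elim: ks x => [//|k ks IH] x; rewrite /=.
rewrite [iter_average _ _ _ ks f](_ : _ =
  iter_average (fun=> N01) (fun (b : nat * K) (z : mR) => c b.2 * z) (L \o snd)
    [seq (i, k) | k <- ks, i <- s] f); last by apply/funext => y; rewrite IH.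
rewrite /iter_average foldr_cat -!/(iter_average _ _ _ _ _).
set g := iter_average _ _ _ _ f.
have bg : buc g by apply: buc_iter_average => // b; exact: mscale.
clearbody g; elim: s x {IH} => [|i s IHs] x /=.
  by rewrite mul0r sqrtr0 average_scale0.
rewrite [iter_average _ _ _ (map _ s) g](_ : _ = average N01
  (fun z : mR => Num.sqrt ((size s)%:R * c k ^+ 2) * z) (L k) g); last first.
  by apply/funext => y; exact: IHs.
have E : c k ^+ 2 + Num.sqrt ((size s)%:R * c k ^+ 2) ^+ 2 = (size s).+1%:R * c k ^+ 2.
  by rewrite (sqr_sqrtr (mulr_ge0 (ler0n _ _) (sqr_ge0 _))) -natr1; ring.
by apply: (eq_trans (average_normal_add _ _ _ _ bg)); rewrite E.
Qed.

Lemma buc_continuous f : buc f -> continuous f.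
Proof.
move=> [_ fu] x; apply/(@cvgrPdist_le _ _ _ (nbhs x) (nbhs_filter x)) => e /fu[dl dl0 fd].
apply/nbhs_ballP; exists dl => //= y; rewrite -ball_normE /ball_ /= => xy.
exact: fd.
Qed.

Lemma buc_bounded_measurable f : buc f ->
  bounded_measurable (f : borel_rV R n -> R).
Proof.
move=> bf; split; last by have [] := bf.
by apply: continuous_borel_measurable; exact: buc_continuous.
Qed.

Lemma gaussian_law_average (G : probability (borel_rV R n) R) (Ls : seq 'rV[R]_n) m :
  (forall f : borel_rV R n -> \bar R, measurable_fun [set: borel_rV R n] f ->
    (forall x, 0 <= f x)%E -> (\int[G]_y f y = gaussian_integral Ls f m)%E) ->
  forall f, buc f -> \int[G]_y f y =
    iter_average (fun=> N01) (fun (_ : 'rV[R]_n) (z : mR) => z) id Ls f m.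
Proof.
move=> HG; apply: agree_ge0.
- move=> f c bf; exact: RintegralD_cst (buc_bounded_measurable bf).
- by move=> f c bf; rewrite iter_averageD_cst// => k; exact: measurable_id.
move=> f bf f0; apply: EFin_inj.
have mf := (buc_bounded_measurable bf).1.
rewrite /Rintegral fineK; last first.
  apply: (@integrable_fin_num _ _ _ G) => //.
  by apply: bounded_measurable_integrable; exact: buc_bounded_measurable.
rewrite HG//; last exact/measurable_EFinP.
have := @iter_integral_average _ _ R N01 n _ (fun (_ : 'rV[R]_n) (z : mR) => z)
  id (fun=> @measurable_id _ _ _) Ls f m bf; exact.
Qed.

End AverageIdentities.

(** * Lipschitz test functions *)

Section LipschitzApproximation.
Context {R : realType} {n : nat}.
Implicit Types (x y : 'rV[R]_n).
Variables (f : 'rV[R]_n -> R) (C : R).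
Hypothesis fC : forall x, `|f x| <= C.

Let values (m : nat) x : set R := [set f y + m%:R * `|x - y| | y in setT].

(** The largest [m]-Lipschitz function below [f]. *)
Definition lipschitz_minorant (m : nat) x : R := inf (values m x).

Let values_lb m x : lbound (values m x) (- C).
Proof.
move=> _ [y _ <-]; have := fC y; rewrite ler_norml => /andP[h _].
by rewrite (le_trans h)// lerDl mulr_ge0.
Qed.

Lemma lipschitz_minorant_le m x y : lipschitz_minorant m x <= f y + m%:R * `|x - y|.
Proof. by apply: ge_inf; [exists (- C); exact: values_lb|exists y]. Qed.

Lemma le_lipschitz_minorant m x c : (forall y, c <= f y + m%:R * `|x - y|) ->
  c <= lipschitz_minorant m x.
Proof.
move=> H; apply: lb_le_inf; first by exists (f x + m%:R * `|x - x|), x.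
by move=> _ [y _ <-].
Qed.

Lemma lipschitz_minorant_ge m x : - C <= lipschitz_minorant m x.
Proof. by apply: le_lipschitz_minorant => y; apply: values_lb; exists y. Qed.

Lemma lipschitz_minorant_below m x : lipschitz_minorant m x <= f x.
Proof. by have := lipschitz_minorant_le m x x; rewrite subrr normr0 mulr0 addr0. Qed.

Lemma norm_lipschitz_minorant m x : `|lipschitz_minorant m x| <= C.
Proof.
rewrite ler_norml lipschitz_minorant_ge (le_trans (lipschitz_minorant_below m x))//.
exact: le_trans (ler_norm _) (fC x).
Qed.

Lemma buc_lipschitz_minorant m : buc (lipschitz_minorant m).
Proof.
split; first by exists C => x; exact: norm_lipschitz_minorant.
have half x x' : lipschitz_minorant m x - m%:R * `|x - x'| <= lipschitz_minorant m x'.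
  apply: le_lipschitz_minorant => y; rewrite lerBlDr.
  rewrite (le_trans (lipschitz_minorant_le m x y))// -addrA lerD2l -mulrDr ler_wpM2l//.
  by rewrite [leRHS]addrC -(subrKA x' x (- y)) ler_normD.
move=> e e0; have m0 : (0 : R) < 1 + m%:R by rewrite ltr_wpDr.
exists (e / (1 + m%:R)); first by rewrite divr_gt0.
move=> x y; rewrite ltr_pdivlMr// => xy.
have xe : m%:R * `|x - y| <= e.
  by rewrite (le_trans _ (ltW xy))// mulrC ler_wpM2l// lerDr.
have h1 := half x y; have h2 := half y x; rewrite (distrC y) in h2.
by rewrite ler_norml; apply/andP; split; lra.
Qed.

(** Once [m] exceeds [2 C / dl], the points farther than [dl] from [x] do not
    lower the infimum below [f x], and the nearer ones do by at most [e]. *)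
Lemma cvg_lipschitz_minorant x : {for x, continuous f} ->
  lipschitz_minorant m x @[m --> \oo] --> f x.
Proof.
move=> cf; apply/cvgrPdist_le => e e0.
have C0 : 0 <= C by exact: le_trans (fC x).
have /nbhs_ballP[dl /= dl0 H] :
    nbhs x [set y | `|f x - f y| <= e] by move/(@cvgrPdist_le _ _ _ (nbhs x) (nbhs_filter x)): cf => /(_ _ e0).
near=> m; rewrite ger0_norm ?subr_ge0 ?lipschitz_minorant_below//.
rewrite lerBlDr -lerBlDl; apply: le_lipschitz_minorant => y.
have [xy|xy] := ltP `|x - y| dl.
  have : `|f x - f y| <= e by apply: H; rewrite -ball_normE.
  rewrite ler_norml => /andP[_ h]; have : 0 <= m%:R * `|x - y| by rewrite mulr_ge0.
  lra.
have mC : 2 * C / dl <= m%:R by near: m; exact: nbhs_infty_ger.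
have : 2 * C <= m%:R * `|x - y|.
  by rewrite ler_pdivrMr// in mC; rewrite (le_trans mC)// ler_wpM2l.
have := fC x; have := fC y; rewrite !ler_norml => /andP[? ?] /andP[? ?].
lra.
Unshelve. all: by end_near. Qed.

End LipschitzApproximation.

Lemma Rintegral_bounded_cvg {d} {T : measurableType d} {R : realType}
    (P : probability T R) (fm : nat -> T -> R) (f : T -> R) (C : R) :
  (forall m, measurable_fun [set: T] (fm m)) -> measurable_fun [set: T] f ->
  (forall m x, `|fm m x| <= C) -> (forall x, fm m x @[m --> \oo] --> f x) ->
  \int[P]_x fm m x @[m --> \oo] --> \int[P]_x f x.
Proof.
move=> mfm mf fC cf.
have iC : P.-integrable [set: T] (EFin \o (fun _ : T => C)).
  by apply: bounded_measurable_integrable; split => //; exists `|C|.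
have mfmE m : measurable_fun [set: T] (fun x => (fm m x)%:E) by exact/measurable_EFinP.
have mfE : measurable_fun [set: T] (fun x => (f x)%:E) by exact/measurable_EFinP.
have [fi _ H] : [/\ P.-integrable [set: T] (fun x => (f x)%:E),
    (\int[P]_x `|(fm m x)%:E - (f x)%:E| @[m --> \oo] --> 0)%E &
    (\int[P]_x (fm m x)%:E @[m --> \oo] --> \int[P]_x (f x)%:E)%E].
  apply: (dominated_convergence measurableT mfmE mfE _ iC).
    by apply: aeW => x _; apply: cvg_EFin; [exact: nearW|exact: cf].
  by apply: aeW => x m _ /=; rewrite lee_fin.
by apply: fine_cvg; rewrite fineK//; exact: integrable_fin_num fi.
Qed.

Section Portmanteau.
Context {d} {T : measurableType d} {R : realType} (P : probability T R) {n : nat}.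
Variables (X : nat -> T -> 'rV[R]_n) (G : probability (borel_rV R n) R).
Hypothesis mX : forall N, random_vector (X N).

Lemma random_vector_bounded_measurable N (f : 'rV[R]_n -> R) : bounded_continuous f ->
  bounded_measurable (fun w => f (X N w)).
Proof.
move=> [cf [C fC]]; split; last by exists C.
exact: (measurableT_comp (continuous_borel_measurable cf) (mX N)).
Qed.

Lemma bounded_continuous_measurable (f : 'rV[R]_n -> R) : bounded_continuous f ->
  bounded_measurable (f : borel_rV R n -> R).
Proof.
by move=> [cf fC]; split => //; exact: continuous_borel_measurable.
Qed.

Lemma buc_bounded_continuous (f : 'rV[R]_n -> R) : buc f -> bounded_continuous f.
Proof. by move=> bf; split; [exact: buc_continuous|have [] := bf]. Qed.

(** Bounded uniformly continuous test functions suffice: a bounded continuous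
    function is the pointwise limit of Lipschitz functions below it. *)
Lemma cvg_in_distribution_buc :
  (forall f : 'rV[R]_n -> R, buc f -> \int[P]_w f (X N w) @[N --> \oo] --> \int[G]_x f x) ->
  cvg_in_distribution P X G.
Proof.
move=> H.
have half (f : 'rV[R]_n -> R) (e : R) : bounded_continuous f -> 0 < e ->
    \forall N \near \oo, \int[G]_x f x - e <= \int[P]_w f (X N w).
  move=> bcf e0; have [cf [C fC]] := bcf.
  pose fm := lipschitz_minorant f.
  have bfm m : buc (fm m) by exact: buc_lipschitz_minorant fC m.
  have mfm m := bounded_continuous_measurable (buc_bounded_continuous (bfm m)).
  have cvgG : \int[G]_x fm m x @[m --> \oo] --> \int[G]_x f x.
    exact: (@Rintegral_bounded_cvg _ _ R G fm f C (fun m => (mfm m).1)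
      (bounded_continuous_measurable bcf).1
      (fun m x => norm_lipschitz_minorant fC m x)
      (fun x => cvg_lipschitz_minorant fC (cf x))).
  have [m Gm] : exists m, \int[G]_x f x - e / 2 <= \int[G]_x fm m x.
    have /cvgrPdist_le/(_ (e / 2)) := cvgG; rewrite divr_gt0// => /(_ isT)[m _ Hm].
    exists m; have := Hm m (leqnn m); rewrite /= ler_norml => /andP[_]; lra.
  have := H _ (bfm m) => /cvgrPdist_le/(_ (e / 2)); rewrite divr_gt0// => /(_ isT).
  apply: filterS => N; rewrite ler_norml => /andP[_ h].
  have : \int[P]_w fm m (X N w) <= \int[P]_w f (X N w).
    apply: le_Rintegral => //.
    - apply: bounded_measurable_integrable.
      exact: (random_vector_bounded_measurable N (buc_bounded_continuous (bfm m))).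
    - by apply: bounded_measurable_integrable; exact: random_vector_bounded_measurable.
    - by move=> w _; exact: lipschitz_minorant_below fC m _.
  lra.
move=> f bcf; apply/cvgrPdist_le => e e0.
have bcN : bounded_continuous (fun x => - f x).
  have [cf [C fC]] := bcf; split; last by exists C => x; rewrite normrN.
  by move=> x; exact: continuousN (cf x).
have h1 := half f e bcf e0; have h2 := half (fun x => - f x) e bcN e0.
near=> N; have : \int[G]_x f x - e <= \int[P]_w f (X N w) by near: N.
have : \int[G]_x (- f x) - e <= \int[P]_w (- f (X N w)) by near: N.
have RN d' (T' : measurableType d') (Q : probability T' R) (h : T' -> R) :
    bounded_measurable h -> \int[Q]_x (- h x) = - \int[Q]_x h x.
  move=> bh; under eq_Rintegral do rewrite -mulN1r.
  by rewrite Rintegral_boundedZ// mulN1r.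
rewrite (RN _ _ G f (bounded_continuous_measurable bcf)).
rewrite (RN _ _ P _ (random_vector_bounded_measurable N bcf)) => a b.
by rewrite ler_norml; apply/andP; split; lra.
Unshelve. all: by end_near. Qed.

End Portmanteau.

(** * Central limit theorem for Poisson counts *)

Lemma Rintegral_sum_seq {d} {T : measurableType d} {R : realType}
    (P : probability T R) {I : Type} (s : seq I) (f : I -> T -> R) :
  (forall i, P.-integrable [set: T] (EFin \o f i)) ->
  P.-integrable [set: T] (EFin \o (fun w => \sum_(i <- s) f i w)) /\
  \int[P]_w (\sum_(i <- s) f i w) = \sum_(i <- s) \int[P]_w f i w.
Proof.
move=> fi; elim: s => [|i s [IH1 IH2]].
  under [X in EFin \o X]eq_fun do rewrite big_nil.
  under eq_Rintegral do rewrite big_nil.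
  rewrite big_nil Rintegral_prob_cst; split => //; apply: bounded_measurable_integrable.
  by split => //; exists 0 => _; rewrite normr0.
under [X in EFin \o X]eq_fun do rewrite big_cons.
under eq_Rintegral do rewrite big_cons.
rewrite RintegralD// IH2 big_cons; split => //.
have := integrableD measurableT (fi i) IH1; exact.
Qed.

Lemma near_inv_sqrt {R : realType} (D e : R) : 0 < e ->
  \forall N \near \oo, D * (Num.sqrt N%:R)^-1 <= e.
Proof.
move=> e0; near=> N.
have N0 : (0 < N)%N by near: N; exact: nbhs_infty_gt.
have N1 : (D / e) ^+ 2 <= N%:R by near: N; exact: nbhs_infty_ger.
have s0 : 0 < Num.sqrt (N%:R : R) by rewrite sqrtr_gt0 ltr0n.
have : `|D / e| <= Num.sqrt N%:R by rewrite -sqrtr_sqr ler_sqrt ?ler0n.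
move=> /(le_trans (ler_norm _)); rewrite !ler_pdivrMr// mulrC; exact.
Unshelve. all: by end_near. Qed.

Section PoissonMeans.
Context {d} {T : measurableType d} {R : realType} (P : probability T R)
  {K : finType} (V : nat -> K -> T -> nat) (v : K -> R).
Hypothesis mV : forall i k, measurable_fun [set: T] (V i k).
Hypothesis v0 : forall k, 0 < v k.
Hypothesis poissonV : forall i k (A : set nat),
  P (V i k @^-1` A) = poisson_prob (v k) 0 A.
Hypothesis iV : mutually_independent P (fun b : nat * K => V b.1 b.2).

Let mW (b : nat * K) : measurable_fun [set: T] (V b.1 b.2). Proof. exact: mV. Qed.

Let stepP h i k := poisson_centered_step (mV i k) (v0 k) (poissonV i k) h.

Definition mean_error (N : nat) (k : K) (w : T) : R :=
  N%:R^-1 * \sum_(i < N) (V i k w)%:R - v k.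

Let dev i k w : R := (V i k w)%:R - v k.

Let mean_errorE N k w : (0 < N)%N ->
  mean_error N k w = N%:R^-1 * \sum_(i <- iota 0 N) dev i k w.
Proof.
move=> N0; rewrite /mean_error /dev sumrB big_const_seq count_predT size_iota iter_addr addr0.
rewrite mulrBr -(mulr_natl (v k)) mulKf ?pnatr_eq0 -?lt0n//.
by rewrite -(big_mkord xpredT (fun i => (V i k w)%:R)) /index_iota subn0.
Qed.

Let dev_integrable i k : P.-integrable [set: T] (EFin \o dev i k).
Proof.
have [_ [i1 _ _] _ _ _] := stepP 1 i k.
by move: i1; rewrite (_ : (fun w => 1 * _) = dev i k)//; apply/funext => w; rewrite mul1r.
Qed.

Let dev_mean i k : \int[P]_w dev i k w = 0.
Proof.
have [_ _ + _ _] := stepP 1 i k.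
by rewrite (_ : (fun w => 1 * _) = dev i k)//; apply/funext => w; rewrite mul1r.
Qed.

Let dev_sum_mean k s :
  P.-integrable [set: T] (EFin \o (fun w => \sum_(i <- s) dev i k w)) /\
  \int[P]_w (\sum_(i <- s) dev i k w) = 0.
Proof.
have [i1 ->] := Rintegral_sum_seq s (dev_integrable ^~ k).
by split => //; apply: big1 => i _; exact: dev_mean.
Qed.

Lemma mean_error_integrable N k : (0 < N)%N ->
  P.-integrable [set: T] (EFin \o mean_error N k).
Proof.
move=> N0; have [i1 _] := dev_sum_mean k (iota 0 N).
rewrite (_ : mean_error N k = fun w => N%:R^-1 * \sum_(i <- iota 0 N) dev i k w).
  have := integrableZl measurableT N%:R^-1 i1; exact.
by apply/funext => w; exact: mean_errorE.
Qed.

Lemma mean_error_mean N k : (0 < N)%N -> \int[P]_w mean_error N k w = 0.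
Proof.
move=> N0; have [i1 E] := dev_sum_mean k (iota 0 N).
under eq_Rintegral do rewrite mean_errorE//.
by rewrite RintegralZl// E mulr0.
Qed.

Let square_step (b : nat * K) (j : nat) (x : R) : R := x + (j%:R - v b.2).

Let run_square_step k s w x :
  run (fun b : nat * K => V b.1 b.2) square_step [seq (i, k) | i <- s] w x =
  x + \sum_(i <- s) dev i k w.
Proof.
elim: s x => [|i s IH] x; first by rewrite big_nil addr0.
by rewrite big_cons addrA -IH.
Qed.

Let iter_square_step k s x :
  iter_integral P (fun (b : nat * K) w => square_step b (V b.1 b.2 w))
    [seq (i, k) | i <- s] (fun x => (x ^+ 2)%:E) x = (x ^+ 2 + (size s)%:R * v k)%:E.
Proof.
elim: s x => [|i s IH] x /=; first by rewrite mul0r addr0.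
under eq_integral do rewrite IH.
have [_ [_ + _] _ + _] := stepP 1 i k.
rewrite (_ : (fun w => (1 * _) ^+ 2) = (fun w => dev i k w ^+ 2)); last first.
  by apply/funext => w; rewrite mul1r.
rewrite expr1n mul1r => i2 E2.
pose c : R := x ^+ 2 + (size s)%:R * v k.
have ic : P.-integrable [set: T] (EFin \o (fun _ : T => c)).
  by apply: bounded_measurable_integrable; split => //; exists `|c|.
have i1 : P.-integrable [set: T] (EFin \o (fun w => 2 * x * dev i k w)).
  have := integrableZl measurableT (2 * x) (dev_integrable i k); exact.
have i12 : P.-integrable [set: T] (EFin \o (fun w => 2 * x * dev i k w + dev i k w ^+ 2)).
  have := integrableD measurableT i1 i2; exact.
have i012 : P.-integrable [set: T] (EFin \o (fun w => c + (2 * x * dev i k w + dev i k w ^+ 2))).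
  have := integrableD measurableT ic i12; exact.
rewrite (eq_integral (EFin \o (fun w => c + (2 * x * dev i k w + dev i k w ^+ 2)))); last first.
  by move=> w _ /=; congr EFin; rewrite /square_step /dev /c /=; ring.
rewrite -[LHS]fineK; last exact: (integrable_fin_num measurableT i012).
rewrite -[fine _]/(\int[P]_w (c + (2 * x * dev i k w + dev i k w ^+ 2))).
rewrite (RintegralD measurableT ic i12) (RintegralD measurableT i1 i2).
rewrite RintegralZl// dev_mean E2 Rintegral_prob_cst.
by congr EFin; rewrite /c -natr1; ring.
Qed.

(** The square of a sum of independent centered counts is integrated along the
    chain of partial sums, each count adding its variance. *)
Lemma mean_error_variance N k : (0 < N)%N ->
  P.-integrable [set: T] (EFin \o (fun w => mean_error N k w ^+ 2)) /\
  \int[P]_w (mean_error N k w ^+ 2) = N%:R^-1 * v k.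
Proof.
move=> N0; pose s := iota 0 N.
have us : uniq [seq (i, k) | i <- s].
  by rewrite map_inj_uniq ?iota_uniq// => i j [].
have E : (\int[P]_w ((\sum_(i <- s) dev i k w) ^+ 2)%:E = (N%:R * v k)%:E)%E.
  have := @independent_iter_integral _ _ R P _ (fun b : nat * K => V b.1 b.2) R
    square_step mW iV (fun x => (x ^+ 2)%:E) _ 0 (fun x => _) us.
  rewrite iter_square_step expr0n add0r size_iota => <-; last first.
    by move=> x; rewrite lee_fin sqr_ge0.
  by apply: eq_integral => w _; rewrite run_square_step add0r.
have ms : measurable_fun [set: T] (fun w => \sum_(i <- s) dev i k w).
  have [i1 _] := dev_sum_mean k s.
  by apply/measurable_EFinP; exact: (measurable_int P i1).
have i2 : P.-integrable [set: T] (EFin \o (fun w => (\sum_(i <- s) dev i k w) ^+ 2)).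
  apply/integrableP; split.
    by apply/measurable_EFinP; exact: measurable_funX.
  rewrite (eq_integral (fun w => ((\sum_(i <- s) dev i k w) ^+ 2)%:E)) ?E ?ltry//.
  by move=> w _; rewrite /= ger0_norm ?sqr_ge0.
have F : (fun w => mean_error N k w ^+ 2) =
    (fun w => N%:R ^- 2 * (\sum_(i <- s) dev i k w) ^+ 2).
  by apply/funext => w; rewrite mean_errorE// exprMn exprVn.
rewrite F; split.
  have := integrableZl measurableT (N%:R ^- 2) i2; exact.
rewrite RintegralZl// /Rintegral E /= mulrA expr2 invfM mulfVK//.
by rewrite pnatr_eq0 -lt0n.
Qed.

Section CentralLimit.
Context {n : nat} (L : K -> 'rV[R]_n).
Local Notation mR := (measurableTypeR R).
Local Notation N01 := (@normal_prob R 0 1).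

Let indices (N : nat) : seq (nat * K) := [seq (i, k) | k <- enum K, i <- iota 0 N].

Let vector_step (h : R) (b : nat * K) (j : nat) (x : 'rV[R]_n) :=
  x + (h * (j%:R - v b.2)) *: L b.2.

Let run_vector_step N w : (0 < N)%N ->
  run (fun b : nat * K => V b.1 b.2) (vector_step (Num.sqrt N%:R)^-1) (indices N) w 0 =
  Num.sqrt N%:R *: \sum_k mean_error N k w *: L k.
Proof.
move=> N0; set h := (Num.sqrt N%:R)^-1.
have runE s x : run (fun b : nat * K => V b.1 b.2) (vector_step h) s w x =
    x + \sum_(b <- s) (h * dev b.1 b.2 w) *: L b.2.
  elim: s x => [|b s IH] x; first by rewrite big_nil addr0.
  by rewrite big_cons addrA -IH.
rewrite runE add0r big_allpairs_dep /= big_enum /= scaler_sumr; apply: eq_bigr => k _.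
rewrite -scaler_suml -mulr_sumr mean_errorE// scalerA mulrA; congr (_ * _ *: _).
have N1 : Num.sqrt N%:R != 0 :> R by rewrite sqrtr_eq0 -ltNge ltr0n.
have -> : (N%:R : R)^-1 = h * h by rewrite -invfM -expr2 sqr_sqrtr.
by rewrite mulrA mulfV// mul1r.
Qed.

Let uniq_indices N : uniq (indices N).
Proof.
by apply: allpairs_uniq => [||[k i] [k' i'] _ _ [-> ->]]//; rewrite ?enum_uniq ?iota_uniq.
Qed.

Let run_average N h f : buc f ->
  \int[P]_w f (run (fun b : nat * K => V b.1 b.2) (vector_step h) (indices N) w 0) =
  iter_average (fun=> P) (fun (b : nat * K) w => h * dev b.1 b.2 w) (L \o snd)
    (indices N) f 0.
Proof.
have mdev (b : nat * K) : measurable_fun [set: T] (fun w => h * dev b.1 b.2 w).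
  by have [] := stepP h b.1 b.2.
have brun f' : buc f' -> bounded_measurable
    (fun w => f' (run (fun b : nat * K => V b.1 b.2) (vector_step h) (indices N) w 0)).
  move=> bf; split; last by have [[C fC] _] := bf; exists C.
  apply/measurable_EFinP.
  exact: (measurable_run _ mW (indices N) (fun x => (f' x)%:E)).
apply: (@agree_ge0 _ _
  (fun f => \int[P]_w f (run (fun b : nat * K => V b.1 b.2) (vector_step h) (indices N) w 0))
  (fun f => iter_average (fun=> P) (fun (b : nat * K) w => h * dev b.1 b.2 w)
    (L \o snd) (indices N) f 0)).
- by move=> f' c bf; rewrite RintegralD_cst//; exact: brun.
- by move=> f' c bf; rewrite iter_averageD_cst.
move=> f' bf f0; apply: EFin_inj.
have := @iter_integral_average _ _ R P n _ (fun (b : nat * K) w => h * dev b.1 b.2 w)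
  (L \o snd) mdev (indices N) f' 0 bf => <-.
rewrite /Rintegral fineK; last first.
  apply: (@integrable_fin_num _ _ _ P) => //; apply: bounded_measurable_integrable.
  exact: brun.
apply: (@independent_iter_integral _ _ R P _ (fun b : nat * K => V b.1 b.2) _
  (vector_step h) mW iV (EFin \o f')) => //.
Qed.

Let centered_step_le {d'} {T' : measurableType d'} (Q : probability T' R) xi
    (s m m' : R) : m <= m' -> centered_step Q xi s m -> centered_step Q xi s m'.
Proof. by move=> mm' [? ? ? ? h]; split => //; exact: le_trans mm'. Qed.

Let third_moment_stationary i k :
  \int[P]_w (`|(V i k w)%:R - v k| ^+ 3) = \int[P]_w (`|(V 0%N k w)%:R - v k| ^+ 3).
Proof.
have F0 j : (0 <= (`|(j : nat)%:R - v k| ^+ 3)%:E)%E by rewrite lee_fin exprn_ge0.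
congr fine.
rewrite (@ge0_integral_poisson _ _ _ P _ _ (mV i k) (v0 k) (poissonV i k) _ F0).
by rewrite -(@ge0_integral_poisson _ _ _ P _ _ (mV 0%N k) (v0 k) (poissonV 0%N k) _ F0).
Qed.

(** Lindeberg's replacement on the [N * #|K|] counts, whose third moments are
    of order [N^(-3/2)] after normalization. *)
Lemma poisson_clt (G : probability (borel_rV R n) R) :
  (forall f : borel_rV R n -> \bar R, measurable_fun [set: borel_rV R n] f ->
    (forall x, 0 <= f x)%E ->
    (\int[G]_y f y = gaussian_integral [seq Num.sqrt (v k) *: L k | k <- enum K] f 0)%E) ->
  forall f, buc f ->
    \int[P]_w f (Num.sqrt N%:R *: \sum_k mean_error N k w *: L k) @[N --> \oo]
      --> \int[G]_y f y.
Proof.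
move=> HG f bf; apply/cvgrPdist_le => e e0.
have triangle (a b a' b' q : R) : `|a - a'| <= q / 4 -> `|b - b'| <= q / 4 ->
    `|a - b| <= q / 4 -> `|b' - a'| <= q.
  rewrite !ler_norml => /andP[? ?] /andP[? ?] /andP[? ?].
  by apply/andP; split; lra.
have e40 : 0 < e / 4 by rewrite divr_gt0.
have [g [C [C0 bg tg gf]]] := smooth_approximation L (enum K) bf e40.
pose m3 k := \int[P]_w (`|(V 0%N k w)%:R - v k| ^+ 3).
pose n3 : R := \int[N01]_z `|z : R| ^+ 3.
have m30 k : 0 <= m3 k by apply: Rintegral_ge0 => w _; rewrite exprn_ge0.
have n30 : 0 <= n3 by apply: Rintegral_ge0 => w _; rewrite exprn_ge0.
pose M : R := \sum_k (m3 k + Num.sqrt (v k) ^+ 3 * n3).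
have M1 k : m3 k <= M /\ Num.sqrt (v k) ^+ 3 * n3 <= M.
  have s0 j : 0 <= Num.sqrt (v j) ^+ 3 * n3 by rewrite mulr_ge0// exprn_ge0.
  have := @le_sum_term R K (fun k => m3 k + Num.sqrt (v k) ^+ 3 * n3) k
    (fun j => addr_ge0 (m30 j) (s0 j)).
  by rewrite -/M => h; split; apply: le_trans h; rewrite ?lerDl ?lerDr.
have gap N : (0 < N)%N -> `|\int[P]_w g (Num.sqrt N%:R *: \sum_k mean_error N k w *: L k)
    - \int[G]_y g y| <= (#|K|%:R * C * (M + M)) * (Num.sqrt N%:R)^-1.
  move=> N0; set h := (Num.sqrt N%:R)^-1.
  have h0 : 0 < h by rewrite invr_gt0 sqrtr_gt0 ltr0n.
  have hN : N%:R * h ^+ 2 = 1.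
    by rewrite exprVn sqr_sqrtr// mulfV// pnatr_eq0 -lt0n.
  under eq_Rintegral do rewrite -run_vector_step//.
  rewrite (gaussian_law_average HG bg) run_average//.
  have -> : iter_average (fun=> N01) (fun (_ : 'rV[R]_n) (z : mR) => z) id
      [seq Num.sqrt (v k) *: L k | k <- enum K] g 0 =
      iter_average (fun=> N01) (fun (b : nat * K) (z : mR) => h * Num.sqrt (v b.2) * z)
        (L \o snd) (indices N) g 0.
    rewrite (iter_average_normal_merge (fun k => h * Num.sqrt (v k)))// size_iota.
    elim: (enum K) (0 : 'rV[R]_n) => //= k ks IH x.
    rewrite exprMn sqr_sqrtr ?(ltW (v0 k))// mulrA hN mul1r.
    apply: eq_Rintegral => z _; rewrite IH scalerA; congr (_ (_ + _ *: _)).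
    by rewrite mulrC.
  have sP (b : nat * K) : centered_step P (fun w => h * dev b.1 b.2 w)
      (h ^+ 2 * v b.2) (h ^+ 3 * M).
    apply: centered_step_le (stepP h b.1 b.2).
    rewrite gtr0_norm// third_moment_stationary ler_pM2l ?exprn_gt0//.
    exact: (M1 b.2).1.
  have sN (b : nat * K) : centered_step N01 (fun z : mR => h * Num.sqrt (v b.2) * z)
      (h ^+ 2 * v b.2) (h ^+ 3 * M).
    have := normal_centered_step (h * Num.sqrt (v b.2)).
    rewrite exprMn sqr_sqrtr ?(ltW (v0 _))//; apply: centered_step_le.
    have hv : 0 <= h * Num.sqrt (v b.2) by rewrite mulr_ge0 ?sqrtr_ge0 ?(ltW h0).
    rewrite (ger0_norm hv) exprMn -mulrA (ler_pM2l (exprn_gt0 3 h0)).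
    exact: (M1 b.2).2.
  apply: (le_trans (iter_average_replacement (P := fun=> P) (Q := fun=> N01)
    (L := L \o snd) sP sN bg C0 _ 0)).
    by move=> b _; apply: tg; rewrite mem_enum.
  rewrite size_allpairs size_iota -cardE natrM le_eqVlt; apply/orP; left; apply/eqP.
  transitivity (#|K|%:R * C * (M + M) * h * (N%:R * h ^+ 2)); first by clearbody h M; ring.
  by rewrite hN mulr1.
have gfR d' (T' : measurableType d') (Q : probability T' R) (X : T' -> 'rV[R]_n) :
    bounded_measurable (g \o X) -> bounded_measurable (f \o X) ->
    `|\int[Q]_w g (X w) - \int[Q]_w f (X w)| <= e / 4.
  move=> bgX bfX; rewrite -Rintegral_boundedB//.
  apply: norm_Rintegral_le_cst => [|w]; last exact: gf.
  exact: (bounded_measurableB bgX bfX).1.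
have brun N f' : (0 < N)%N -> buc f' -> bounded_measurable
    (fun w => f' (Num.sqrt N%:R *: \sum_k mean_error N k w *: L k)).
  move=> N0 bf'; split; last by have [[D fD] _] := bf'; exists D.
  apply/measurable_EFinP; rewrite [X in measurable_fun _ X](_ : _ = fun w => (f' (run
    (fun b : nat * K => V b.1 b.2) (vector_step (Num.sqrt N%:R)^-1) (indices N) w 0))%:E).
    exact: (measurable_run _ mW (indices N) (fun x => (f' x)%:E)).
  by apply/funext => w; rewrite /= run_vector_step.
pose D := #|K|%:R * C * (M + M).
near=> N.
have N0 : (0 < N)%N by near: N; exact: nbhs_infty_gt.
have h1 := gap N N0.
have h2 := gfR _ _ P _ (brun N g N0 bg) (brun N f N0 bf).
have h3 := gfR _ _ G id (buc_bounded_measurable bg) (buc_bounded_measurable bf).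
have h4 : D * (Num.sqrt N%:R)^-1 <= e / 4 by near: N; exact: near_inv_sqrt.
exact: triangle h2 h3 (le_trans h1 h4).
Unshelve. all: by end_near. Qed.

End CentralLimit.
End PoissonMeans.

(** * Estimators linear in the counts up to a quadratic error *)

Lemma sqr_sum_le {R : realType} (K : finType) (a : K -> R) :
  (\sum_k a k) ^+ 2 <= #|K|%:R * \sum_k a k ^+ 2.
Proof.
have -> : (\sum_k a k) ^+ 2 = \sum_i \sum_j a i * a j by rewrite expr2 big_distrlr.
have -> : #|K|%:R * \sum_k a k ^+ 2 = \sum_i \sum_j (a i ^+ 2 / 2 + a j ^+ 2 / 2).
  transitivity (\sum_i (a i ^+ 2 / 2 *+ #|K| + \sum_j a j ^+ 2 / 2)).
    by rewrite big_split/= sumr_const sumrMnl -mulr_suml -mulr_natl; field.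
  by apply: eq_bigr => i _; rewrite big_split/= sumr_const.
apply: ler_sum => i _; apply: ler_sum => j _.
by have := sqr_ge0 (a i - a j); lra.
Qed.

Section LinearizedEstimator.
Context {d} {T : measurableType d} {R : realType} (P : probability T R)
  {K : finType} (V : nat -> K -> T -> nat) (v : K -> R).
Hypothesis mV : forall i k, measurable_fun [set: T] (V i k).
Hypothesis v0 : forall k, 0 < v k.
Hypothesis poissonV : forall i k (A : set nat),
  P (V i k @^-1` A) = poisson_prob (v k) 0 A.
Hypothesis iV : mutually_independent P (fun b : nat * K => V b.1 b.2).
Context {n : nat} (L : K -> 'rV[R]_n) (t0 : 'rV[R]_n) (C : R)
  (X : nat -> T -> 'rV[R]_n).
Hypothesis C0 : 0 <= C.
Hypothesis mX : forall N, random_vector (X N).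

Let err N k w := mean_error V v N k w.
Let lin N w := \sum_k err N k w *: L k.

Hypothesis linearized : forall N w, (0 < N)%N ->
  `|X N w - t0 - lin N w| <= C * (\sum_k `|err N k w|) ^+ 2.

Let Q N w := \sum_k err N k w ^+ 2.

Let Q_ge0 N w : 0 <= Q N w.
Proof. by apply: sumr_ge0 => k _; exact: sqr_ge0. Qed.

Let sum_err N w : (\sum_k `|err N k w|) ^+ 2 <= #|K|%:R * Q N w.
Proof.
apply: le_trans (sqr_sum_le _) _; rewrite le_eqVlt; apply/orP; left; apply/eqP.
by congr (_ * _); apply: eq_bigr => k _; rewrite real_normK ?num_real.
Qed.

Let c := \sum_k v k.

Let Q_mean N : (0 < N)%N -> P.-integrable [set: T] (EFin \o Q N) /\
  \int[P]_w Q N w = N%:R^-1 * c.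
Proof.
move=> N0; have H k := mean_error_variance mV v0 poissonV iV k N0.
have [i1 E] := Rintegral_sum_seq (index_enum K) (fun k => (H k).1).
split; first exact: i1.
by rewrite E mulr_sumr; apply: eq_bigr => k _; exact: (H k).2.
Qed.

Let remainder N w : (0 < N)%N -> `|X N w - t0 - lin N w| <= C * #|K|%:R * Q N w.
Proof.
by move=> N0; rewrite (le_trans (linearized w N0))// -mulrA ler_wpM2l.
Qed.

Let lin_entry N i :
  (0 < N)%N -> P.-integrable [set: T] (EFin \o (fun w => lin N w 0 i)) /\
  \int[P]_w lin N w 0 i = 0.
Proof.
move=> N0; have H k : P.-integrable [set: T] (EFin \o (fun w => err N k w * L k 0 i)).
  have := integrableZr measurableT (L k 0 i) (mean_error_integrable mV v0 poissonV k N0); exact.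
have [i1 E] := Rintegral_sum_seq (index_enum K) H.
have F w : lin N w 0 i = \sum_k err N k w * L k 0 i.
  by rewrite summxE; apply: eq_bigr => k _; rewrite mxE.
split; first by under [X in EFin \o X]eq_fun do rewrite F; exact: i1.
under eq_Rintegral do rewrite F.
rewrite E big1// => k _; rewrite RintegralZr//; last exact: mean_error_integrable.
by rewrite (mean_error_mean mV v0 poissonV k N0) mul0r.
Qed.

Let X_entry_measurable N i : measurable_fun [set: T] (fun w => X N w 0 i).
Proof. exact: (measurableT_comp (measurable_coordinate i) (mX N)). Qed.

(** The linear term is centered, so the bias is at most the expectation of the
    quadratic remainder. *)
Lemma linearized_bias : exists2 B : R, 0 <= B & forall N, (0 < N)%N ->
  `|mean_vec P (X N) - t0| <= B * N%:R^-1.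
Proof.
have c0 : 0 <= c by apply: sumr_ge0 => k _; rewrite ltW.
exists (C * #|K|%:R * c); first by rewrite !mulr_ge0.
move=> N N0; apply: norm_le_entry => [|i]; first by rewrite !mulr_ge0.
have [l1 l2] := lin_entry i N0; have [q1 q2] := Q_mean N0.
pose rem w := X N w 0 i - t0 0 i - lin N w 0 i.
have ml : measurable_fun [set: T] (fun w => lin N w 0 i).
  by apply/measurable_EFinP; exact: (measurable_int P l1).
have mrem : measurable_fun [set: T] rem.
  by apply: measurable_funB => //; apply: measurable_funB.
have iq : P.-integrable [set: T] (EFin \o (fun w => C * #|K|%:R * Q N w)).
  have := integrableZl measurableT (C * #|K|%:R) q1; exact.
have remQ w : `|rem w| <= C * #|K|%:R * Q N w.
  by apply: le_trans (remainder w N0); have := entry_le_norm (X N w - t0 - lin N w) i; rewrite !mxE.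
have irem : P.-integrable [set: T] (EFin \o rem).
  apply: le_integrable iq => //; first exact/measurable_EFinP.
  by move=> w _ /=; rewrite lee_fin (le_trans (remQ w))// ler_norm.
have it : P.-integrable [set: T] (EFin \o (fun _ : T => t0 0 i)).
  by apply: bounded_measurable_integrable; split => //; exists `|t0 0 i|.
have ilr : P.-integrable [set: T] (EFin \o (fun w => lin N w 0 i + rem w)).
  have := integrableD measurableT l1 irem; exact.
rewrite !mxE unlock -[fine _]/(\int[P]_w X N w 0 i).
have -> : \int[P]_w X N w 0 i = \int[P]_w (t0 0 i + (lin N w 0 i + rem w)).
  by apply: eq_Rintegral => w _; rewrite /rem; ring.
rewrite (RintegralD measurableT it ilr) (RintegralD measurableT l1 irem).
rewrite Rintegral_prob_cst l2 add0r addrAC subrr add0r.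
rewrite (le_trans (norm_Rintegral_le irem iq remQ))// RintegralZl// q2.
by rewrite [N%:R^-1 * c]mulrC mulrA.
Qed.

(** An estimation error of at least [e] forces [Q N] to be at least a positive
    constant: the linear term is bounded through [2 x <= x^2 / e + e]. Markov's
    inequality for [Q N] concludes. *)
Lemma linearized_consistent : cvg_in_probability P X t0.
Proof.
move=> e e0; pose B := \sum_k `|L k|.
have B0 : 0 <= B by apply: sumr_ge0.
pose s : R := Num.sqrt n%:R; have s0 : 0 <= s by exact: sqrtr_ge0.
have quadratic (a q x y : R) : 0 < q -> q <= a * x + y -> 1 <= 2 / q * (a ^+ 2 / (2 * q) * x ^+ 2 + y).
  move=> q0 h; rewrite -(ler_pM2l q0).
  have -> : q * (2 / q * (a ^+ 2 / (2 * q) * x ^+ 2 + y)) = (a * x) ^+ 2 / q + 2 * y.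
    by field; rewrite gt_eqF.
  have : 2 * (a * x) - q <= (a * x) ^+ 2 / q.
    by rewrite ler_pdivlMr//; have := sqr_ge0 (a * x - q); lra.
  lra.
pose k0 := 2 / e * ((s * B) ^+ 2 / (2 * e) + s * C).
have k00 : 0 <= k0.
  by rewrite mulr_ge0 ?addr_ge0 ?mulr_ge0 ?invr_ge0 ?sqr_ge0 ?mulr_ge0 ?(ltW e0).
have normlin N w : `|lin N w| <= B * \sum_k `|err N k w|.
  rewrite (le_trans (ler_norm_sum _ _ _))// mulr_sumr ler_sum// => k _.
  rewrite normrZ mulrC ler_wpM2r//.
  by apply: (@le_sum_term R K (fun k => `|L k|)).
have key N w : (0 < N)%N -> e <= enorm (X N w - t0) -> 1 <= k0 * #|K|%:R * Q N w.
  move=> N0 /le_trans/(_ (enorm_le_norm _)); rewrite -/s => h.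
  set S := \sum_k `|err N k w|.
  have h2 : e <= s * B * S + s * C * S ^+ 2.
    apply: (le_trans h); rewrite -!mulrA -mulrDr ler_wpM2l//.
    rewrite -[X in `|X|](subrK (lin N w)) (le_trans (ler_normD _ _))// addrC lerD//.
    exact: linearized.
  apply: (le_trans (quadratic _ _ _ _ e0 h2)).
  by rewrite -mulrDl mulrA -/k0 -mulrA ler_wpM2l// sum_err.
pose A N := [set w | e <= enorm (X N w - t0)].
have mA N : measurable (A N).
  have -> : A N = (fun w => dot (X N w - t0) (X N w - t0)) @^-1` `[e ^+ 2, +oo[%classic.
    apply/seteqP; split => w; rewrite /A /= in_itv/= andbT /enorm => h.
      rewrite -(ler_sqrt); last first.
        by apply: sumr_ge0 => i _; rewrite -expr2 sqr_ge0.
      by rewrite sqrtr_sqr gtr0_norm.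
    by rewrite -(gtr0_norm e0) -sqrtr_sqr ler_wsqrtr.
  rewrite -[X in measurable X]setTI.
  have mD : measurable_fun [set: T] (fun w => dot (X N w - t0) (X N w - t0)).
    apply: measurable_sum => i; under eq_fun do rewrite !mxE.
    by apply: measurable_funM; apply: measurable_funB.
  exact: mD.
have PA N : (0 < N)%N -> (P (A N) <= (k0 * #|K|%:R * (N%:R^-1 * c))%:E)%E.
  move=> N0; have [q1 q2] := Q_mean N0.
  have iq : P.-integrable [set: T] (EFin \o (fun w => k0 * #|K|%:R * Q N w)).
    have := integrableZl measurableT (k0 * #|K|%:R) q1; exact.
  rewrite -[X in P X]setIT -(integral_indic P measurableT (mA N)).
  rewrite -q2 -RintegralZl// /Rintegral fineK; last exact: integrable_fin_num iq.
  apply: ge0_le_integral => //.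
  - by apply/measurable_EFinP; exact: measurable_indic.
  - exact: (measurable_int P iq).
  move=> w _; rewrite lee_fin indicE; case: (boolP (w \in A N)) => [/set_mem/key->//|_].
  by apply: mulr_ge0 (Q_ge0 _ _); exact: mulr_ge0 k00 (ler0n _ _).
apply/fine_cvgP; split.
  by apply: nearW => N; exact: fin_num_measure (mA N).
apply/cvgrPdist_le => r r0; near=> N.
have N0 : (0 < N)%N by near: N; exact: nbhs_infty_gt.
have pf : P (A N) \is a fin_num by exact: fin_num_measure (mA N).
rewrite sub0r normrN ger0_norm ?fine_ge0//.
rewrite -lee_fin fineK// (le_trans (PA N N0))// lee_fin.
have N1 : k0 * #|K|%:R * c / r <= N%:R by near: N; exact: nbhs_infty_ger.
have -> : k0 * #|K|%:R * (N%:R^-1 * c) = k0 * #|K|%:R * c / N%:R by ring.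
by rewrite ler_pdivrMr ?ltr0n// [r * _]mulrC -ler_pdivrMr.
Unshelve. all: by end_near. Qed.

(** The test function moves by at most [e / 4] plus a multiple of the distance,
    and the expected distance between the normalized error and its linear part
    is of order [N^(-1/2)]. *)
Lemma linearized_clt (G : probability (borel_rV R n) R) :
  (forall f : borel_rV R n -> \bar R, measurable_fun [set: borel_rV R n] f ->
    (forall x, 0 <= f x)%E ->
    (\int[G]_y f y = gaussian_integral [seq Num.sqrt (v k) *: L k | k <- enum K] f 0)%E) ->
  cvg_in_distribution P (fun N w => Num.sqrt N%:R *: (X N w - t0)) G.
Proof.
move=> HG.
have mY N : random_vector (fun w => Num.sqrt N%:R *: (X N w - t0)).
  apply: measurable_coordinates => i; under eq_fun do rewrite !mxE.
  by apply: measurable_funM => //; apply: measurable_funB.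
have mZ N : (0 < N)%N -> random_vector (fun w => Num.sqrt N%:R *: lin N w).
  move=> N0; apply: measurable_coordinates => i; under eq_fun do rewrite mxE.
  apply: measurable_funM => //; have [l1 _] := lin_entry i N0.
  by apply/measurable_EFinP; exact: (measurable_int P l1).
apply: (cvg_in_distribution_buc mY) => f bf.
have clt := poisson_clt mV v0 poissonV iV HG bf.
have [[F fF] fu] := bf; have F0 : 0 <= F by exact: le_trans (fF 0).
have triangle (a b g q : R) : `|g - b| <= q / 2 -> `|a - b| <= q / 2 -> `|g - a| <= q.
  by rewrite !ler_norml => /andP[? ?] /andP[? ?]; apply/andP; split; lra.
apply/cvgrPdist_le => e e0.
have [dl dl0 fd] := fu (e / 4) (ltac:(by rewrite divr_gt0)).
have lip x y : `|f x - f y| <= e / 4 + 2 * F / dl * `|x - y|.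
  have p0 : 0 <= 2 * F / dl * `|x - y| by rewrite !mulr_ge0 ?invr_ge0 ?(ltW dl0).
  have [xy|xy] := ltP `|x - y| dl; first by have := fd _ _ xy; lra.
  have h : 2 * F <= 2 * F / dl * `|x - y|.
    by rewrite mulrAC ler_pdivlMr// ler_wpM2l// mulr_ge0.
  by have := ler_normB (f x) (f y); have := fF x; have := fF y; lra.
pose D := 2 * F / dl * (C * #|K|%:R * c).
near=> N.
have N0 : (0 < N)%N by near: N; exact: nbhs_infty_gt.
have h1 : `|\int[G]_y f y - \int[P]_w f (Num.sqrt N%:R *: lin N w)| <= e / 2.
  by near: N; move/cvgrPdist_le : clt; apply; rewrite divr_gt0.
have h2 : D * (Num.sqrt N%:R)^-1 <= e / 4.
  by near: N; apply: near_inv_sqrt; rewrite divr_gt0.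
apply: triangle h1 _.
have bY := random_vector_bounded_measurable mY N (buc_bounded_continuous bf).
have bZ := random_vector_bounded_measurable (fun=> mZ N N0) 0%N (buc_bounded_continuous bf).
rewrite -Rintegral_boundedB//.
have [q1 q2] := Q_mean N0.
pose a := 2 * F / dl * (Num.sqrt N%:R * (C * #|K|%:R)).
have iaq : P.-integrable [set: T] (EFin \o (fun w => a * Q N w)).
  have := integrableZl measurableT a q1; exact.
have ie : P.-integrable [set: T] (EFin \o (fun _ : T => e / 4)).
  by apply: bounded_measurable_integrable; split => //; exists `|e / 4|.
have ib : P.-integrable [set: T] (EFin \o (fun w => e / 4 + a * Q N w)).
  have := integrableD measurableT ie iaq; exact.
have idiff := bounded_measurable_integrable P (bounded_measurableB bY bZ).
apply: (le_trans (norm_Rintegral_le idiff ib _)) => [w|].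
  apply: (le_trans (lip _ _)); rewrite lerD2l /a -!mulrA ler_wpM2l//.
  rewrite ler_wpM2l// ler_wpM2l ?invr_ge0 ?(ltW dl0)//.
  rewrite -scalerBr normrZ ger0_norm ?sqrtr_ge0// ler_wpM2l ?sqrtr_ge0// mulrA.
  exact: remainder.
rewrite (RintegralD measurableT ie iaq) RintegralZl// q2 Rintegral_prob_cst.
have -> : a * (N%:R^-1 * c) = D * (Num.sqrt N%:R)^-1.
  have s0 : Num.sqrt (N%:R : R) != 0 by rewrite sqrtr_eq0 -ltNge ltr0n.
  have -> : (N%:R : R)^-1 = (Num.sqrt N%:R)^-1 * (Num.sqrt N%:R)^-1.
    by rewrite -invfM -expr2 sqr_sqrtr.
  by rewrite /a /D; field; rewrite s0 gt_eqF.
by rewrite (_ : e / 2 = e / 4 + e / 4) ?lerD2l//; field.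
Unshelve. all: by end_near. Qed.

End LinearizedEstimator.

(** * Asymptotic behavior of the maximum-likelihood estimator *)

Lemma outer_scale {R : comPzRingType} {n : nat} (a : R) (l : 'rV[R]_n) :
  (a *: l)^T *m (a *: l) = a ^+ 2 *: (l^T *m l).
Proof. by apply/matrixP => i j; rewrite !mxE !big_ord1 !mxE; ring. Qed.

Section GaussianRescaling.
Context {R : realType} {n : nat}.
Implicit Types (x m : 'rV[R]_n) (Ls : seq 'rV[R]_n).

Let gaussian_law (G : probability (borel_rV R n) R) Ls m :=
  forall f : borel_rV R n -> \bar R, measurable_fun [set: borel_rV R n] f ->
    (forall x, 0 <= f x)%E -> (\int[G]_y f y = gaussian_integral Ls f m)%E.

(** The normal law around [theta0] at scale [1 / sqrt N] is built from rescaled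
    directions, so recentering and rescaling it gives back the limit law
    exactly, for every [N]. *)
Lemma gaussian_integral_rescale Ls (c : R) f m x : c != 0 ->
  gaussian_integral [seq c^-1 *: l | l <- Ls] (fun y => f (c *: (y - m))) x =
  gaussian_integral Ls f (c *: (x - m)).
Proof.
move=> c0; elim: Ls x => //= l Ls IH x; apply: eq_integral => z _.
rewrite [LHS]IH; congr (gaussian_integral Ls f _); rewrite /translation.
by rewrite addrAC scalerDr !scalerA mulrAC mulfV// mul1r.
Qed.

Lemma gaussian_law_rescale (G G' : probability (borel_rV R n) R) Ls (c : R) m f :
  c != 0 -> gaussian_law G Ls 0 -> gaussian_law G' [seq c^-1 *: l | l <- Ls] m ->
  bounded_continuous f ->
  \int[G']_x f (c *: ((x : 'rV[R]_n) - m)) = \int[G]_x f x.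
Proof.
move=> c0 HG HG' bcf; have [cf [C fC]] := bcf.
have bf := bounded_continuous_measurable bcf.
have ms : measurable_fun [set: borel_rV R n]
    ((fun x => c *: (x - m)) : borel_rV R n -> borel_rV R n).
  apply: measurable_coordinates => i; under eq_fun do rewrite !mxE.
  by apply: measurable_funM => //; apply: measurable_funB => //; exact: measurable_coordinate.
have bs : bounded_measurable ((fun x => f (c *: (x - m))) : borel_rV R n -> R).
  by split; [exact: (measurableT_comp bf.1 ms)|exists C].
apply: (@addIr _ C); rewrite -!RintegralD_cst//.
have mD : measurable_fun [set: borel_rV R n] ((fun x => (f x + C)%:E) : borel_rV R n -> \bar R).
  by apply/measurable_EFinP; apply: measurable_funD => //; exact: bf.1.
have D0 x : (0 <= (f x + C)%:E)%E.
  by rewrite lee_fin; have := fC x; rewrite ler_norml => /andP[]; lra.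
congr fine; rewrite HG//.
apply: (eq_trans (HG' _ (measurableT_comp mD ms) _)); first by move=> x; exact: D0.
by rewrite (gaussian_integral_rescale Ls (fun x => (f x + C)%:E) m m c0) subrr scaler0.
Qed.

End GaussianRescaling.

Theorem theorem1 (R : realType) (d M Kx Ky : nat)
    (hd : d = 2%N \/ d = 3%N) (hM : (1 <= M)%N)
    (S : @frame_model R d M Kx Ky)
    (theta0 : 'rV[R]_(M * d))
    (C1 : compact (Theta S) /\ (Theta S)° theta0)
    (C2 : (exists2 vmin : R, 0 < vmin &
             forall k t, Theta S t -> vmin <= rate S k t) /\
          ((forall k, Ck 3 (Theta S) (rate S k)) \/ dqm S))
    (C3 : posdef (fisher S theta0))
    (identifiable : identifiable_up_to_relabeling S theta0)
    (dT : measure_display) (T : measurableType dT) (P : probability T R)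
    (V : nat -> 'I_Kx * 'I_Ky -> {RV P >-> nat})
    (hV : iid_frames S theta0 V)
    (C4 : third_derivatives_dominated S theta0 (V 0%N))
    (gml : nat -> T -> 'rV[R]_(M * d))
    (gml_measurable : forall N, random_vector (gml N))
    (gml_argmax : forall N w, (1 <= N)%N -> is_gml S V N w (gml N w))
    (gml_labels : forall N w, (1 <= N)%N -> labels_matched S theta0 (gml N w)) :
  [/\ (* (i) *)
      cvg_in_probability P gml theta0,
      (* (ii) *)
      exists2 G : probability (borel_rV R (M * d)) R,
        is_gaussian G 0 (invmx (fisher S theta0)) &
        cvg_in_distribution P
          (fun N w => Num.sqrt N%:R *: (gml N w - theta0)) G,
      (* (iii) *)
      mean_vec P (gml N) @[N --> \oo] --> theta0 /\
      (fun N => mean_vec P (gml N) - theta0) =O_\oo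
        (fun N => (N%:R : R)^-1)
    & (* Gaussian approximation by N(theta0, CRB) at scale 1 / sqrt N *)
      exists2 G : nat -> probability (borel_rV R (M * d)) R,
        (forall N, (1 <= N)%N -> is_gaussian (G N) theta0 (cramer_rao S N theta0)) &
        forall f : 'rV[R]_(M * d) -> R, bounded_continuous f ->
          \int[P]_w f (Num.sqrt N%:R *: (gml N w - theta0))
          - \int[G N]_x f (Num.sqrt N%:R *: ((x : 'rV[R]_(M * d)) - theta0))
          @[N --> \oo] --> 0].
Proof.
have [cT intT] := C1; have [[vmin vmin0 hvmin] smooth] := C2.
have rate_gt0 k t : Theta S t -> 0 < rate S k t.
  by move=> tT; exact: lt_le_trans vmin0 (hvmin k t tT).
have tT : Theta S theta0 by exact: interior_subset.
pose v k := rate S k theta0.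
pose L k := gradient (fun t => ln (rate S k t)) theta0 *m invmx (fisher S theta0).
have v0 k : 0 < v k by exact: rate_gt0.
have expansion := log_rate_expansion intT C4.
have [C C0 linC] := mean_argmax_linearization intT rate_gt0 expansion
  cT identifiable (fun k t => rate_continuous rate_gt0 smooth) C3.
have covE : \sum_k v k *: ((L k)^T *m L k) = invmx (fisher S theta0).
  exact: linearization_covariance rate_gt0 expansion C3.
pose W i k : T -> nat := V i k.
have mW i k : measurable_fun [set: T] (W i k) by exact: measurable_funP.
have poissonW i k (A : set nat) : P (W i k @^-1` A) = poisson_prob (v k) 0 A.
  exact: hV.1.
have indepW : mutually_independent P (fun b : nat * ('I_Kx * 'I_Ky) => W b.1 b.2).
  exact: hV.2.
have loglikE N w t : (0 < N)%N -> loglik S V N w t =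
    N%:R * mean_loglik S (fun k => mean_error W v N k w + v k) t.
  move=> N0; rewrite /loglik /mean_loglik /loglik1 exchange_big mulr_sumr/=.
  apply: eq_bigr => k _; rewrite /mean_error subrK sumrB sumr_const card_ord.
  have n0 : (N%:R : R) != 0 by rewrite pnatr_eq0 -lt0n.
  rewrite [in RHS]mulrBr -[in RHS]mulrA mulVKf// [in RHS]mulr_natl mulr_suml.
  by congr (_ - _); apply: eq_bigr => i _; rewrite ffunE.
have linearized N w : (0 < N)%N -> `|gml N w - theta0 - \sum_k mean_error W v N k w *: L k|
    <= C * (\sum_k `|mean_error W v N k w|) ^+ 2.
  move=> N0; have := linC (fun k => mean_error W v N k w + v k) (gml N w).
  under eq_bigr do rewrite addrK; under [X in _ <= C * X ^+ 2]eq_bigr do rewrite addrK.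
  apply; last exact: gml_labels.
  have [gT gmax] := gml_argmax N w N0; split => // t' t'T.
  by have := gmax _ t'T; rewrite !loglikE// ler_pM2l// ltr0n.
pose Ls := [seq Num.sqrt (v k) *: L k | k <- enum {: 'I_Kx * 'I_Ky}].
have covLs : \sum_(l <- Ls) l^T *m l = invmx (fisher S theta0).
  rewrite big_map big_enum -covE; apply: eq_bigr => k _.
  by rewrite outer_scale sqr_sqrtr// ltW.
have [G gG HG] := gaussian_vector Ls 0.
have clt := linearized_clt mW v0 poissonW indepW C0 gml_measurable linearized HG.
have [B B0 bias] := linearized_bias mW v0 poissonW indepW C0 gml_measurable linearized.
split.
- have := linearized_consistent mW v0 poissonW indepW C0 gml_measurable linearized; exact.
- by exists G; [rewrite -covLs; exact: gG|exact: clt].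
- split.
    apply/cvgrPdist_le => e e0; near=> N.
    have N0 : (0 < N)%N by near: N; exact: nbhs_infty_gt.
    rewrite distrC (le_trans (bias N N0))// ler_pdivrMr ?ltr0n// mulrC -ler_pdivrMr//.
    by near: N; exact: nbhs_infty_ger.
  apply/eqO_exP; exists (B + 1); first by rewrite ltr_wpDl.
  near=> N; have N0 : (0 < N)%N by near: N; exact: nbhs_infty_gt.
  rewrite (le_trans (bias N N0))// ger0_norm ?invr_ge0// ler_wpM2r ?invr_ge0//.
  by rewrite lerDl.
have scaled N := gaussian_vector [seq (Num.sqrt N%:R)^-1 *: l | l <- Ls] theta0.
pose GN N := s2val (cid2 (scaled N)).
exists GN => [N N1|f bcf].
  have -> : cramer_rao S N theta0 = \sum_(l <- [seq (Num.sqrt N%:R)^-1 *: l | l <- Ls]) l^T *m l.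
    have uN : N%:R *: fisher S theta0 \in unitmx.
      by rewrite unitmxZ ?posdef_unitmx// unitfE pnatr_eq0 -lt0n.
    rewrite big_map /cramer_rao invmxZ// -covLs scaler_sumr.
    by apply: eq_bigr => l _; rewrite outer_scale exprVn sqr_sqrtr.
  exact: s2valP (cid2 (scaled N)).
have /cvgrPdist_le cltf := clt f bcf; apply/cvgrPdist_le => e e0.
near=> N; have N0 : (0 < N)%N by near: N; exact: nbhs_infty_gt.
have c0 : Num.sqrt (N%:R : R) != 0 by rewrite sqrtr_eq0 -ltNge ltr0n.
rewrite sub0r opprB (gaussian_law_rescale c0 HG (s2valP' (cid2 (scaled N))) bcf).
by near: N; exact: cltf.
Unshelve. all: by end_near. Qed.
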